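(* Let $H:T^*M\to\mathbb{R}$ be a Tonelli Hamiltonian, $\phi\in\mathrm{SCL}(M)$ and $T>0$. (1) For partitions $\Delta$ of $[-T,T]$ with $|\Delta|\leq\tau(\phi)$, $$\lim_{|\Delta|\to0}W_\Delta(t,x)=H_p(x,\mathbf{p}^{\#}_{\phi,H}(x)),\qquad\forall t\in[-T,T),\ x\in M.$$ (2) Let $\{\Delta_k\}$ be a sequence of partitions of $[-T,T]$ with $|\Delta_k|\leq\tau(\phi)$ for all $k$, and for each $k$ let $\gamma_k:[-T,T]\to M$ be a solution of $\dot\gamma_k(t)=W_{\Delta_k}(t,\gamma_k(t))$ for a.e. $t\in[-T,T]$. If $\lim_{k\to\infty}|\Delta_k|=0$ and $\gamma_k$ converges uniformly to $\gamma:[-T,T]\to M$, then $\gamma$ is a strict singular characteristic for the pair $(\phi,H)$, i.e. $\dot\gamma(t)=H_p(\gamma(t),\mathbf{p}^{\#}_{\phi,H}(\gamma(t)))$ for a.e. $t\in[-T,T]$.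
   Context: $M$ is a smooth, compact, connected manifold without boundary, with a Riemannian metric and distance $d$. $\mathrm{SCL}(M)$ is the set of functions $\phi:M\to\mathbb{R}$ that are semiconcave with linear modulus: for some $C>0$, $\lambda\phi(x)+(1-\lambda)\phi(y)-\phi(\gamma(\lambda))\leq C\lambda(1-\lambda)d(x,y)^2$ for all $x,y$, $\lambda\in[0,1]$ and every geodesic $\gamma:[0,1]\to M$ joining $x$ and $y$ (parametrized so that $\gamma(\lambda)$ plays the role of the convex combination with weights $\lambda,1-\lambda$). $D^+\phi(x)=\{D\psi(x): r>0,\psi\in C^1(B_r(x)),\psi\geq\phi,\psi(x)=\phi(x)\}$. $H$ is a Tonelli Hamiltonian if it is $C^2$, $H_{pp}>0$ everywhere, and $H(x,\cdot)$ is superlinear uniformly in $x$; $L(x,v)=\sup_{p}\{\langle p,v\rangle-H(x,p)\}$. $\mathbf{p}^{\#}_{\phi,H}(x)$ is the unique minimizer of $H(x,\cdot)$ on $D^+\phi(x)$. $A_t(x,y)=\inf\int_0^tL(\xi,\dot\xi)\,ds$ over absolutely continuous $\xi:[0,t]\to M$ with $\xi(0)=x,\xi(t)=y$. Lax–Oleinik operators: $T^+_t\phi(x)=\sup_{y\in M}\{\phi(y)-A_t(x,y)\}$, $T^-_t\phi(x)=\inf_{y\in M}\{\phi(y)+A_t(y,x)\}$ for $t>0$, $T^\pm_0=\mathrm{id}$. $\Phi^t_H$ is the Hamiltonian flow of $H$. $\tau(\phi)>0$ is a fixed constant (depending on $\phi$ and $H$; its existence is known) chosen so that: (a) there is $\lambda_0>0$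 such that for $t\in(0,\tau(\phi)]$ and $x\in M$ all maximizers of $\phi(\cdot)-A_t(x,\cdot)$ lie in $B(x,\lambda_0t)$, and on $B(x,(\lambda_0+1)t)$ the function $A_t(x,\cdot)$ is $C^2$ and $\phi(\cdot)-A_t(x,\cdot)$ is strictly concave, so that the maximizer is unique; (b) $\tau(\phi)\leq\tau_1(\phi)$, where $\tau_1(\phi)>0$ is such that $T^+_t\phi=T^-_{\tau_1(\phi)-t}T^+_{\tau_1(\phi)}\phi$ for $t\in[0,\tau_1(\phi)]$, $T_t^+\phi\in C^{1,1}(M)$ for $t\in(0,\tau_1(\phi)]$, $\{(x,DT^+_t\phi(x)):x\in M\}=\Phi_H^{-t}(\{(x,p):p\in D^+\phi(x)\})$ for $t\in(0,\tau_1(\phi))$, and $u(t,x)=T_t^+\phi(x)$ is $C^{1,1}_{loc}$ on $(0,\tau_1(\phi))\times M$ and solves $u_t-H(x,\nabla u)=0$ there. For a partition $\Delta:-T=\tau_0<\tau_1<\dots<\tau_N=T$ put $|\Delta|=\max_i(\tau_i-\tau_{i-1})$, and for $t\in[-T,T)$ put $\tau^+_\Delta(t)=\inf\{\tau_i:\tau_i>t\}$. If $|\Delta|\leq\tau(\phi)$ define $W_\Delta(t,x)=H_p(x,DT^+_{\tau_\Delta^+(t)-t}\phi(x))$ for $t\in[-T,T)$, $x\in M$. *)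

(* Defs.v *)
From HB Require Import structures.
From mathcomp Require Import all_boot all_order all_algebra.
From mathcomp Require Import all_classical all_reals all_analysis.

Set Implicit Arguments.
Unset Strict Implicit.
Unset Printing Implicit Defensive.

Import Order.TTheory GRing.Theory Num.Theory.
Import numFieldNormedType.Exports.

Local Open Scope classical_set_scope.
Local Open Scope ring_scope.

Section Calculus.
Variable R : realType.

(* Meant for open U. *)
Fixpoint Ck (V W : normedModType R) (k : nat) (U : set V) (f : V -> W) : Prop :=
  match k with
  | 0 => forall x, U x -> {for x, continuous f}
  | k'.+1 => (forall x, U x -> differentiable f x) /\
             (forall v : V, Ck k' U (fun x => 'd f x v))
  end.

(* C^1 with locally Lipschitz derivative. *)
Definition C11loc (V W : normedModType R) (U : set V) (f : V -> W) : Prop :=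
  Ck 1 U f /\
  forall (v x : V), U x -> lipschitz_on (fun y => 'd f y v) (nbhs (x, x)).

Definition grad (n : nat) (f : 'rV[R]_n -> R) (q : 'rV[R]_n) : 'rV[R]_n :=
  \row_i 'd f q (delta_mx 0 i).

Definition pairing (n : nat) (p v : 'rV[R]_n) : R := \sum_(i < n) p 0 i * v 0 i.

End Calculus.

(* A smooth structure on M of dimension n: an atlas indexed by the points of M,
   the chart of index c being defined on a neighbourhood [dom c] of c.
   Repetitions are allowed, so every smooth manifold has such an atlas.
   A tangent vector (resp. covector) at x is given by its coordinates in the
   chart of index x, as an element of 'rV[R]_n; thus a function
   H : M -> 'rV[R]_n -> R is a function on the cotangent bundle. *)
Record smooth_structure (R : realType) (n : nat) (M : topologicalType) :=
  SmoothStructure {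
  dom : M -> set M;
  chart : M -> M -> 'rV[R]_n;
  param : M -> 'rV[R]_n -> M;
  open_dom : forall c, open (dom c);
  mem_dom : forall c, dom c c;
  open_image_chart : forall c, open (chart c @` dom c);
  chartK : forall c x, dom c x -> param c (chart c x) = x;
  chart_continuous : forall c x, dom c x -> {for x, continuous (chart c)};
  param_continuous : forall c q, (chart c @` dom c) q ->
    {for q, continuous (param c)};
  smooth_transition : forall c c' k,
    Ck k (chart c @` (dom c `&` dom c')) (chart c' \o param c) }.

Section Manifold.
Variables (R : realType) (n : nat) (M : topologicalType).
Variable X : smooth_structure R n M.

Local Notation E := 'rV[R]_n.
Local Notation mu := (@lebesgue_measure R).

(* From coordinates in the chart c to coordinates in the chart c', for vectors
   tangent at x. *)
Definition tangent_change (c c' x : M) (v : E) : E :=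
  'd (chart X c' \o param X c) (chart X c x) v.

Definition cotangent_change (c c' x : M) (p : E) : E :=
  \row_i pairing p (tangent_change c' c x (delta_mx 0 i)).

Definition CkM (k : nat) (U : set M) (f : M -> R) : Prop :=
  forall c, Ck k (chart X c @` (dom X c `&` U)) (f \o param X c).

(* On a compact manifold, C^{1,1} is the same as locally C^{1,1}. *)
Definition C11M (f : M -> R) : Prop :=
  forall c, C11loc (chart X c @` dom X c) (f \o param X c).

Definition DM (f : M -> R) (x : M) : E := grad (f \o param X x) (chart X x x).

Definition velocity (gamma : R -> M) (t : R) : E :=
  derive1 (chart X (gamma t) \o gamma) t.

(* Continuity ensures that gamma stays in the domain of the chart near t. *)
Definition has_velocity (gamma : R -> M) (t : R) (v : E) : Prop :=
  {for t, continuous gamma} /\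
  is_derive t 1 (chart X (gamma t) \o gamma : R -> E) v.

Definition C1_curve (gamma : R -> M) : Prop :=
  continuous gamma /\
  forall c, Ck 1 (gamma @^-1` dom X c) (chart X c \o gamma).

Definition piecewise_C1 (a b : R) (gamma : R -> M) : Prop :=
  exists s : seq R, itv_partition a b s /\
    forall u, u \in zip (a :: s) s ->
      exists eta, C1_curve eta /\
        forall r, u.1 <= r <= u.2 -> gamma r = eta r.

Record riemannian_metric := RiemannianMetric {
  metric_matrix : M -> 'M[R]_n;
  metric_sym : forall x, (metric_matrix x)^T = metric_matrix x;
  metric_pos : forall x (v : E), v != 0 ->
    0 < (v *m metric_matrix x *m v^T) 0 0;
  metric_smooth : forall c (i j : 'I_n) k,
    Ck k (chart X c @` dom X c) (fun q =>
      let x := param X c q in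
      (tangent_change c x x (delta_mx 0 i) *m metric_matrix x *m
       (tangent_change c x x (delta_mx 0 j))^T) 0 0 : R) }.

Variable g : riemannian_metric.

Definition tnorm (x : M) (v : E) : R :=
  Num.sqrt ((v *m metric_matrix g x *m v^T) 0 0).

Definition conorm (x : M) (p : E) : R :=
  sup [set pairing p v | v in [set v | tnorm x v <= 1]].

Definition curve_length (gamma : R -> M) : R :=
  (\int[mu]_(s in `[0, 1]) tnorm (gamma s) (velocity gamma s))%R.

Definition dist (x y : M) : R :=
  inf [set curve_length gamma | gamma in
        [set gamma | [/\ piecewise_C1 0 1 gamma, gamma 0 = x & gamma 1 = y]]].

Definition dball (x : M) (r : R) : set M := [set y | dist x y < r].

(* Geodesics joining two points are minimizing, with constant speed. *)
Definition geodesic (gamma : R -> M) : Prop :=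
  forall s r, 0 <= s <= 1 -> 0 <= r <= 1 ->
    dist (gamma s) (gamma r) = `|s - r| * dist (gamma 0) (gamma 1).

Definition SCL (phi : M -> R) : Prop :=
  exists2 C : R, 0 < C & forall gamma, geodesic gamma ->
    forall l, 0 <= l <= 1 ->
      l * phi (gamma 1) + (1 - l) * phi (gamma 0) - phi (gamma l)
        <= C * l * (1 - l) * dist (gamma 1) (gamma 0) ^+ 2.

Definition strictly_concave_on (U : set M) (f : M -> R) : Prop :=
  forall gamma, geodesic gamma -> gamma 0 <> gamma 1 ->
    (forall s, 0 <= s <= 1 -> U (gamma s)) ->
    forall l, 0 < l < 1 ->
      l * f (gamma 1) + (1 - l) * f (gamma 0) < f (gamma l).

Definition superdifferential (phi : M -> R) (x : M) : set E :=
  [set p | exists r psi, [/\ 0 < r, CkM 1 (dball x r) psi,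
     forall y, dball x r y -> phi y <= psi y, psi x = phi x & p = DM psi x]].

Definition absolutely_continuous (a b : R) (gamma : R -> M) : Prop :=
  forall eps, 0 < eps -> exists2 delta, 0 < delta &
    forall (m : nat) (u v : 'I_m -> R),
      (forall i, [/\ a <= u i, u i <= v i & v i <= b]) ->
      (forall i j, i != j -> v i <= u j \/ v j <= u i) ->
      \sum_i (v i - u i) < delta ->
      \sum_i dist (gamma (u i)) (gamma (v i)) < eps.

Definition ae_solution (a b : R) (F : R -> M -> E) (gamma : R -> M) : Prop :=
  absolutely_continuous a b gamma /\
  {ae mu, forall t, a <= t <= b -> has_velocity gamma t (F t (gamma t))}.

Section Hamiltonian.
Variable H : M -> E -> R.

(* H in the canonical coordinates of the cotangent bundle induced by c. *)
Definition localH (c : M) (z : E * E) : R :=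
  let x := param X c z.1 in H x (cotangent_change c x x z.2).

Definition Hp (x : M) (p : E) : E := grad (H x) p.

Definition tonelli : Prop :=
  [/\ forall c, Ck 2 ((chart X c @` dom X c) `*` [set: E]) (localH c),
      forall x (p v : E), v != 0 ->
        0 < 'd (fun p' => 'd (H x) p' v : R) p v
    & forall K : R, exists r : R, forall x p, r <= conorm x p ->
        K * conorm x p <= H x p].

(* At each time, Hamilton's equations are written in the canonical coordinates
   of the chart centred at the current base point. *)
Definition hamiltonian_flow (Phi : R -> M * E -> M * E) : Prop :=
  forall z, Phi 0 z = z /\
    forall s, let c := (Phi s z).1 in let q := chart X c c in
      let p := (Phi s z).2 in
      [/\ {for s, continuous (fun r => (Phi r z).1)},
          is_derive s 1 (fun r => chart X c (Phi r z).1 : E)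
            (grad (fun p' => localH c (q, p')) p)
        & is_derive s 1
            (fun r => cotangent_change (Phi r z).1 c (Phi r z).1 (Phi r z).2 : E)
            (- grad (fun q' => localH c (q', p)) q)].

Definition lagrangian (x : M) (v : E) : R :=
  sup [set pairing p v - H x p | p in [set: E]].

(* The infimum is taken in the extended reals, as a curve may have infinite
   action; it is finite for t > 0 when M is compact and connected. *)
Definition action (t : R) (x y : M) : R :=
  fine (ereal_inf
    [set (\int[mu]_(s in `[0%R, t]) (lagrangian (xi s) (velocity xi s))%:E)%E
      | xi in [set xi | [/\ absolutely_continuous 0 t xi, xi 0 = x & xi t = y]]]).

Definition Tplus (t : R) (phi : M -> R) (x : M) : R :=
  if t == 0 then phi x else sup [set phi y - action t x y | y in [set: M]].

Definition Tminus (t : R) (phi : M -> R) (x : M) : R :=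
  if t == 0 then phi x else inf [set phi y + action t y x | y in [set: M]].

(* The minimizer exists and is unique when H is Tonelli and phi is SCL. *)
Definition psharp (phi : M -> R) (x : M) : E :=
  xget 0 [set p | superdifferential phi x p /\
                  forall p', superdifferential phi x p' -> H x p <= H x p'].

Definition Tplus_maximizer (phi : M -> R) (t : R) (x y : M) : Prop :=
  forall z, phi z - action t x z <= phi y - action t x y.

Definition tau_local (phi : M -> R) (tau : R) : Prop :=
  exists2 lambda0 : R, 0 < lambda0 & forall t x, 0 < t <= tau ->
    [/\ forall y, Tplus_maximizer phi t x y -> dball x (lambda0 * t) y,
        CkM 2 (dball x ((lambda0 + 1) * t)) (action t x),
        strictly_concave_on (dball x ((lambda0 + 1) * t))
          (fun y => phi y - action t x y)
      & exists! y, Tplus_maximizer phi t x y].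

Definition tau1_spec (Phi : R -> M * E -> M * E) (phi : M -> R) (tau1 : R)
    : Prop :=
  [/\ 0 < tau1,
      forall t, 0 <= t <= tau1 ->
        Tplus t phi = Tminus (tau1 - t) (Tplus tau1 phi),
      forall t, 0 < t <= tau1 -> C11M (Tplus t phi),
      forall t, 0 < t < tau1 ->
        [set (x, DM (Tplus t phi) x) | x in [set: M]] =
        Phi (- t) @` [set z | superdifferential phi z.1 z.2]
    & (forall c, C11loc (`]0, tau1[ `*` (chart X c @` dom X c))
         (fun z : R * E => Tplus z.1 phi (param X c z.2))) /\
      (forall t x, 0 < t < tau1 ->
         derive1 (fun s => Tplus s phi x) t - H x (DM (Tplus t phi) x) = 0)].

Definition tau_spec (Phi : R -> M * E -> M * E) (phi : M -> R) (tau : R)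
    : Prop :=
  [/\ 0 < tau, tau_local phi tau
    & exists2 tau1, tau1_spec Phi phi tau1 & tau <= tau1].

(* A partition a = tau_0 < ... < tau_N = b is given by the sequence
   Delta = [:: tau_1; ...; tau_N], as in [itv_partition a b Delta]. *)
Definition mesh (a : R) (Delta : seq R) : R :=
  \big[Num.max/0]_(u <- zip (a :: Delta) Delta) (u.2 - u.1).

(* For t >= tau_0, omitting tau_0 does not matter. *)
Definition next_node (Delta : seq R) (t : R) : R :=
  inf [set u | u \in Delta /\ t < u].

Definition Wfield (phi : M -> R) (Delta : seq R) (t : R) (x : M) : E :=
  Hp x (DM (Tplus (next_node Delta t - t) phi) x).

Definition strict_singular_characteristic (phi : M -> R) (a b : R)
    (gamma : R -> M) : Prop :=
  ae_solution a b (fun _ x => Hp x (psharp phi x)) gamma.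

End Hamiltonian.
End Manifold.

(* Main.v *)
Require Import Defs.
From HB Require Import structures.
From mathcomp Require Import all_boot all_order all_algebra.
From mathcomp Require Import all_classical all_reals all_analysis.
From mathcomp Require Import measurable_realfun ring lra.

(* Write u(t, x) = T^+_t phi(x) and m(x) = H(x, p^#(x)).  The graph of Du(t) is the image of
   the graph of D^+phi under the backward flow, which conserves H; hence momenta are bounded
   on these graphs, limits of points of the graphs of Du(t) as t -> 0 lie in D^+phi, and
   u_t = H(y, Du(t, y)) >= m(x) - o(1) as (t, y) -> (0, x).  If g' = H_p(g, Du(b - s, g)) on
   [a, b], convexity of H gives d/ds (u(b - s, g) - <q, g>) >= - H(g, q) for every constant
   covector q in a chart, so that, letting s -> b,
     phi(g(b)) - phi(g(a)) >= <q, g(b) - g(a)> - (b - a) (H(x, q) - m(x) + o(1))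
   near x.  This inequality adds up over the cells of a partition and passes to uniform limits
   of curves.  Compared with phi(z) - phi(x) <= <p^#, z - x> + o(|z - x|), it bounds the mean
   velocity w of a curve starting at x: <p^# - q, w> >= H(x, p^#) - H(x, q) - o(1) for q near
   p^#, and q = p^# + l e_i forces w -> H_p(x, p^#).  For a characteristic starting at
   (x, Du(t, x)) this is (1).  In (2) it gives a right derivative of gamma at every time;
   gamma being Lipschitz, this is its velocity almost everywhere. *)

Set Implicit Arguments.
Unset Strict Implicit.
Unset Printing Implicit Defensive.

Import Order.TTheory GRing.Theory Num.Theory.
Import numFieldNormedType.Exports.

Local Open Scope classical_set_scope.
Local Open Scope ring_scope.

(** * Dini derivatives of absolutely continuous functions *)

Section SlopeArithmetic.
Variable R : realType.
Implicit Types (a b e f g h t : R).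

(** The covector [p^#] is in general discontinuous in the point, so the pointwise limit (1) says
    nothing about limits of integral curves, and the differential equations of (2) do not pass to
    the limit directly. The energy inequality does: it sees a curve only through its end points and
    the values of [phi] there, and [phi] is locally Lipschitz. It determines the velocity
    nevertheless, because it holds for all covectors [q] near [p^#]: up to o(1) it says that the
    mean velocity is a subgradient of [H(x, .)] at [p^#], and a differentiable function has only one
    candidate. The minimality of [p^#] enters through m(x), the least energy on D^+phi(x).

    A second difficulty is that curves are absolutely continuous for a distance defined as an
    infimum of lengths, while all computations take place in one chart. Cutoff distance functions,
    constant outside a chart ball, show that curves of bounded speed cannot leave the chart in a
    short time. As these functions are only Lipschitz, monotonicity is deduced from Dini
    derivatives. *)

Lemma slope_compare e h g f f' G G' : `|f' - f - g * h| <= e / 2 * h ->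
  `|G' - G - h * g| <= e / 2 * h -> - (e * h) <= f' - G' - (f - G).
Proof. by rewrite !ler_norml => /andP[? ?] /andP[? ?]; lra. Qed.

Lemma opp_slope_compare e h g f f' G G' : `|f' - f - g * h| <= e / 2 * h ->
  `|G' - G - h * g| <= e / 2 * h -> - (e * h) <= - f' + G' - (- f + G).
Proof. by rewrite !ler_norml => /andP[? ?] /andP[? ?]; lra. Qed.

Lemma shift_itv a b t h : - (t - a) < h -> h < b - t -> a <= t + h <= b.
Proof. by move=> h1 h2; apply/andP; split; lra. Qed.

Lemma sub_swap a b e f g : a - b = g -> e - f = g -> b - f = a - e.
Proof. lra. Qed.

End SlopeArithmetic.

Section Dini.
Variable R : realType.
Implicit Types (F : R -> R) (a b t : R).

(** The lower right Dini derivative of [F] at [t] is nonnegative. *)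
Definition right_dini_ge0 F t := forall e : R, 0 < e ->
  exists2 d : R, 0 < d & forall h : R, 0 < h < d -> - (e * h) <= F (t + h) - F t.

(** Continuous induction on the set [S] of the points up to which [F] stays above the line of slope
    [-e] through [(a, F a)]. The bound from the left puts the supremum of [S] into [S], and the Dini
    bound carries the inequality beyond it. *)
Lemma dini_le F a b : a <= b ->
  (forall t, a < t <= b -> forall e : R, 0 < e ->
    exists2 d : R, 0 < d & forall s : R, t - d < s < t -> a <= s -> F s <= F t + e) ->
  (forall t, a <= t < b -> right_dini_ge0 F t) ->
  F a <= F b.
Proof.
move=> ab lF rF; apply/ler_addgt0Pr => e0 e0_gt0.
have ab1 : 0 < b - a + 1 by rewrite ltr_wpDl// subr_ge0.
(* A slope for which the total loss [e * (b - a)] is at most [e0]; the [+ 1] covers [a = b]. *)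
pose e := e0 / (b - a + 1).
have e_gt0 : 0 < e by rewrite divr_gt0.
pose S := [set s | a <= s <= b /\ forall r, a <= r <= s ->
             F a - e * (r - a) <= F r].
have Sa : S a.
  split; first by rewrite lexx ab.
  move=> r; rewrite -eq_le => /eqP <-.
  by rewrite subrr mulr0 subr0.
have Sb : ubound S b by move=> s [/andP[]].
have hS : has_sup S by split; [exists a | exists b].
pose s := sup S.
have as_ : a <= s by apply: sup_upper_bound.
have sb : s <= b by apply: ge_sup; [exists a|].
have below r : a <= r < s -> F a - e * (r - a) <= F r.
  move=> /andP[ar rs].
  have [s' [_ Ss'] rs'] := sup_adherent (eps := s - r) (ltac:(by rewrite subr_gt0)) hS.
  apply: Ss'; rewrite ar/= ltW//; move: rs'; rewrite -/s; lra.
have Ss : S s.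
  split; first by rewrite as_ sb.
  move=> r /andP[ar]; rewrite le_eqVlt => /orP[/eqP ->|rs]; last first.
    by apply: below; rewrite ar.
  have [->|sNa] := eqVneq s a; first by rewrite subrr mulr0 subr0.
  have as' : a < s by rewrite lt_neqAle eq_sym sNa.
  apply/ler_addgt0Pr => e1 e1_gt0.
  have [d d_gt0 Hd] := lF s (ltac:(by rewrite as' sb)) _ e1_gt0.
  pose r' := Num.max a (s - d / 2).
  have ar' : a <= r' by rewrite /r' le_max lexx.
  have r's : r' < s by rewrite /r' gt_max as' /=; lra.
  have r'd : s - d < r' by rewrite /r' lt_max; apply/orP; right; lra.
  have H1 := Hd r' (ltac:(by rewrite r'd)) ar'.
  have H2 := below r' (ltac:(by rewrite ar')).
  have H3 : e * (r' - a) <= e * (s - a) by rewrite ler_pM2l// lerD2r ltW.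
  lra.
have [sb'|bs] := ltP s b; last first.
  have /(_ b) := Ss.2.
  rewrite ab bs/= => /(_ isT) H.
  have : e * (b - a) <= e0 by rewrite /e -mulrA ger_pMr// mulrC ler_pdivrMr//; lra.
  lra.
have [d d_gt0 Hd] := rF s (ltac:(by rewrite as_ sb')) _ e_gt0.
pose h := Num.min (d / 2) (b - s).
have h_gt0 : 0 < h by rewrite /h lt_min divr_gt0//= subr_gt0.
have hd : h < d by rewrite /h gt_min; apply/orP; left; lra.
have hb : h <= b - s by rewrite /h ge_min lexx orbT.
have : S (s + h).
  split; first by apply/andP; split; lra.
  move=> r /andP[ar rs].
  have [rs'|sr] := leP r s; first by apply: Ss.2; rewrite ar.
  have := Hd (r - s) (ltac:(apply/andP; split; lra)).
  have := Ss.2 s (ltac:(by rewrite as_ lexx)).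
  have -> : s + (r - s) = r by ring.
  lra.
move=> /(sup_upper_bound hS); rewrite -/s; lra.
Qed.

Definition ac a b F := forall eps : R, 0 < eps -> exists2 delta : R, 0 < delta &
  forall (m : nat) (u v : 'I_m -> R),
    (forall i, [/\ a <= u i, u i <= v i & v i <= b]) ->
    (forall i j, i != j -> v i <= u j \/ v j <= u i) ->
    \sum_i (v i - u i) < delta ->
    \sum_i `|F (v i) - F (u i)| < eps.

Local Notation mu := (@lebesgue_measure R).

Lemma sum_disjoint_itv_le (O : set R) m (u v : 'I_m -> R) :
  measurable O ->
  (forall i, u i <= v i) ->
  (forall i j, i != j -> v i <= u j \/ v j <= u i) ->
  (forall i s, u i <= s <= v i -> O s) ->
  ((\sum_i (v i - u i))%:E <= mu O)%E.
Proof.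
move=> mO uv dis sO.
pose A i : set R := `]u i, v i[%classic.
have -> : (\sum_i (v i - u i))%:E = (\sum_i mu (A i))%E.
  rewrite -sumEFin; apply: eq_bigr => i _.
  rewrite /A lebesgue_measure_itv/=; case: ifPn => //; rewrite lte_fin -leNgt => vu.
  by congr EFin; have := uv i; lra.
rewrite -measure_bigsetU_ord//.
- apply: le_measure; rewrite ?inE//.
    by apply: bigsetU_measurable => i _; exact: measurable_itv.
  elim/big_ind : _ => //; first by move=> X Y; rewrite subUset.
  move=> i _ x; rewrite /A /= in_itv/= => /andP[/ltW h1 /ltW h2].
  by apply: (sO i); rewrite h1.
- by move=> i; exact: measurable_itv.
- apply/trivIsetP => i j _ _ /= ij; apply/seteqP; split=> // x [/=].
  rewrite /A /= !in_itv/= => /andP[h1 h2] /andP[h3 h4].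
  by case: (dis _ _ ij); lra.
Qed.

Lemma ac_cvg_left F a b : ac a b F ->
  forall t, a < t <= b -> forall e : R, 0 < e ->
    exists2 d : R, 0 < d & forall s : R, t - d < s < t -> a <= s -> F s <= F t + e.
Proof.
move=> acF t /andP[at_ tb] e e0; have [d d0 Hd] := acF _ e0.
exists d => // s /andP[st ts] as_.
have := Hd 1%N (fun=> s) (fun=> t).
rewrite !big_ord1 => H.
have : `|F t - F s| < e.
  apply: H; [by move=> _; split => //; exact: ltW | | lra].
  by move=> i j; rewrite !ord1.
by rewrite ltr_norml => /andP[]; lra.
Qed.

(* The exceptional null set is covered by an open set O of small measure; adding to F its
   variation over O makes the right Dini derivative nonnegative everywhere. *)
Lemma ac_dini_le F a b : a <= b -> ac a b F ->
  {ae mu, forall t, a < t < b -> right_dini_ge0 F t} ->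
  F a <= F b.
Proof.
move=> ab acF aeF.
(* The point [a] joins the exceptional set, because [dini_le] asks for the Dini bound at [a] as
   well. *)
have : mu.-negligible (~` [set t | a < t < b -> right_dini_ge0 F t] `|` [set a]).
  apply: negligibleU => //; exists [set a]; split => //.
  exact: lebesgue_measure_set1.
move=> [N [mN N0 subN]].
apply/ler_addgt0Pr => eps eps0; have [d d0 Hd] := acF _ eps0.
have muN : mu N = 0%E by [].
have muNoo : (mu N < +oo)%E by rewrite muN.
have [U [oU NU UND]] := lebesgue_regularity_outer mN muNoo d0.
have mU : measurable U by apply: open_measurable.
have muU : (mu U < d%:E)%E.
  apply: le_lt_trans UND; rewrite -{1}(setDKU NU).
  have H : (mu (U `\` N `|` N) <= mu (U `\` N) + mu N)%E.
    by apply: measureU2 => //; exact: measurableD.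
  by rewrite muN adde0 in H.
(* The variations of [F] over finite families of disjoint intervals of [[a, t]] contained in the
   open set [U]. They are at most [eps], since the total length of such a family is below [d]; [g t]
   is their supremum. *)
pose V t := [set x | exists m (u v : 'I_m -> R), [/\
   (forall i, [/\ a <= u i, u i <= v i & v i <= t]),
   (forall i j, i != j -> v i <= u j \/ v j <= u i),
   (forall i s, u i <= s <= v i -> U s) & x = \sum_i `|F (v i) - F (u i)|]].
have Vle t : t <= b -> ubound (V t) eps.
  move=> tb x [m [u [v [h1 h2 h3 ->]]]]; apply/ltW/Hd => //.
  - by move=> i; have [? ? ?] := h1 i; split => //; lra.
  - rewrite -lte_fin; apply: le_lt_trans muU.
    by apply: sum_disjoint_itv_le => // i; have [] := h1 i.
have V0 t : V t 0.
  exists 0%N, (fun=> a), (fun=> a); split; try by case.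
  by rewrite big_ord0.
have hV t : t <= b -> has_sup (V t).
  by move=> tb; split; [exists 0 | exists eps; exact: Vle].
pose g t := sup (V t).
have gmono s t : s <= t -> t <= b -> g s <= g t.
  move=> st tb; apply: ge_sup; first by exists 0.
  move=> x [m [u [v [h1 h2 h3 ->]]]]; apply: sup_upper_bound; first exact: hV.
  exists m, u, v; split => // i; have [? ? ?] := h1 i; split => //; lra.
(* If [[s, t]] lies in [U], it can be added to any family in [[a, s]]. So [g] grows by at least the
   variation of [F], and [F + g] does not decrease there. *)
have gstep s t : a <= s -> s <= t -> t <= b -> (forall r, s <= r <= t -> U r) ->
    g s + `|F t - F s| <= g t.
  move=> as_ st tb sU; rewrite -lerBrDr; apply: ge_sup; first by exists 0.
  move=> x [m [u [v [h1 h2 h3 ->]]]]; rewrite lerBrDr.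
  apply: sup_upper_bound; first exact: hV.
  exists m.+1, (fun i => oapp u s (unlift ord0 i)), (fun i => oapp v t (unlift ord0 i)).
  split.
  - move=> i; case: (unliftP ord0 i) => [j|] _ /=; last by split.
    by have [? ? ?] := h1 j; split => //; lra.
  - move=> i j; case: (unliftP ord0 i) => [i'|] ->; case: (unliftP ord0 j) => [j'|] -> /=.
    + by rewrite (inj_eq (lift_inj (h:=ord0))) => /h2.
    + by move=> _; left; have [] := h1 i'.
    + by move=> _; right; have [] := h1 j'.
    + by [].
  - move=> i r; case: (unliftP ord0 i) => [j|] _ /=; [exact: h3|exact: sU].
  - rewrite big_ord_recl unlift_none/= addrC; congr (_ + _).
    by apply: eq_bigr => i _; rewrite liftK.
have ga : 0 <= g a by apply: sup_upper_bound => //; exact: hV.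
have gb : g b <= eps by apply: ge_sup; [exists 0|exact: Vle].
suff : F a + g a <= F b + g b by lra.
apply: (@dini_le (fun t => F t + g t)) => //.
  move=> t tab e e0; have [dl dl0 Hl] := ac_cvg_left acF tab e0.
  exists dl => // s st as_; have := Hl s st as_; have := gmono s t.
  case/andP: tab => _ -> /(_ _ isT); case/andP: st => _ /ltW -> /(_ isT); lra.
move=> t tab; have [tN|tN] := pselect (N t).
  move=> e e0; have [dl /= dl0 Hl] := (oU _ (NU _ tN)).
  exists (Num.min dl (b - t)); first by case/andP: tab => ? ?; rewrite lt_min dl0 subr_gt0.
  move=> h /andP[h0]; rewrite lt_min => /andP[hd hb].
  have eh : 0 < e * h by rewrite mulr_gt0.
  have := @gstep t (t + h); case/andP: tab => -> _ /(_ isT).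
  have -> : t <= t + h by lra.
  move=> /(_ isT) H; have : g t + `|F (t + h) - F t| <= g (t + h).
    apply: H; first by lra.
    move=> r /andP[tr rt]; apply: Hl => /=; rewrite distrC ger0_norm; lra.
  have : - `|F (t + h) - F t| <= F (t + h) - F t by rewrite lerNnormlW.
  lra.
have : right_dini_ge0 F t.
  apply: contrapT => H; apply: tN; apply: subN.
  have [ta|ta] := eqVneq t a; first by right.
  left => /= H'; apply/H/H'; rewrite lt_neqAle eq_sym ta/=.
  by case/andP: tab => -> ->.
move=> Ht e e0; have [dl dl0 Hl] := Ht _ e0.
exists (Num.min dl (b - t)); first by case/andP: tab => ? ?; rewrite lt_min dl0 subr_gt0.
move=> h /andP[h0]; rewrite lt_min => /andP[hd hb].
have := Hl h; rewrite h0 hd => /(_ isT).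
have := gmono t (t + h); have -> : t <= t + h by lra.
have -> : t + h <= b by lra.
by move=> /(_ isT isT); lra.
Qed.

Lemma lipschitz_ac a b K F :
  (forall s t, a <= s <= b -> a <= t <= b -> `|F t - F s| <= K * `|t - s|) ->
  ac a b F.
Proof.
move=> lF eps eps0; have K0 : 0 < `|K| + 1 by rewrite ltr_wpDl.
exists (eps / (`|K| + 1)); first by rewrite divr_gt0.
move=> m u v h1 h2; rewrite ltr_pdivlMr// => h3; apply: le_lt_trans h3.
rewrite mulr_suml; apply: ler_sum => i _; have [h4 h5 h6] := h1 i.
apply: le_trans (lF _ _ _ _) _; [by apply/andP; split; lra|by apply/andP; split; lra|].
rewrite ger0_norm ?subr_ge0// mulrC ler_wpM2l ?subr_ge0//.
by rewrite (le_trans (ler_norm _))// lerDl.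
Qed.

Lemma acD a b F G : ac a b F -> ac a b G -> ac a b (fun t => F t + G t).
Proof.
move=> acF acG e e0; have e2 : 0 < e / 2 by rewrite divr_gt0.
have [d d0 Hd] := acF _ e2; have [d' d'0 Hd'] := acG _ e2.
exists (Num.min d d'); first by rewrite lt_min d0.
move=> m u v h1 h2; rewrite lt_min => /andP[h3 h4].
apply: (@le_lt_trans _ _ (\sum_i (`|F (v i) - F (u i)| + `|G (v i) - G (u i)|))).
  apply: ler_sum => i _; apply: le_trans (ler_normD _ _).
  by rewrite le_eqVlt; apply/orP; left; apply/eqP; congr `|_|; ring.
by rewrite big_split/= [ltRHS]splitr ltrD ?Hd ?Hd'.
Qed.

(** The form used in all estimates: non-strict, without quotient and valid at [h = 0]. *)
Lemma is_deriveP (V : normedModType R) (f : R -> V) t (l : V) :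
  is_derive t 1 f l <-> forall e : R, 0 < e -> exists2 d : R, 0 < d &
    forall h : R, `|h| < d -> `|f (t + h) - f t - h *: l| <= e * `|h|.
Proof.
have -> : is_derive t 1 f l <->
    (fun h => h^-1 *: (f (h *: (1 : R) + t) - f t)) @ 0^' --> l.
  split=> [[df <-]|H]; first exact: df.
  by apply: DeriveDef; [apply/cvg_ex; exists l|apply/cvg_lim].
split=> [/cvgrPdist_le H e e0|H].
  have [d /= d0 Hd] := H _ e0; exists d => // h hd.
  have [->|h0] := eqVneq h 0.
    by rewrite addr0 subrr scale0r subr0 !normr0 mulr0.
  have := Hd h; rewrite /= sub0r normrN => /(_ hd h0).
  rewrite scaler1 [h + t]addrC distrC => H1.
  rewrite (_ : _ - h *: l = h *: (h^-1 *: (f (t + h) - f t) - l)).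
    by rewrite normrZ mulrC ler_wpM2r.
  by rewrite scalerBr scalerA divff// scale1r.
apply/cvgrPdist_le => e e0; have [d d0 Hd] := H _ e0.
exists d => // h /=; rewrite sub0r normrN => hd h0.
have := Hd h hd; rewrite scaler1 [h + t]addrC => H1; rewrite distrC.
rewrite (_ : _ - l = h^-1 *: (f (t + h) - f t - h *: l)).
  by rewrite normrZ normfV mulrC ler_pdivrMr ?normr_gt0.
by rewrite [in RHS]scalerBr scalerA mulVf// scale1r.
Qed.

Lemma is_derive_right_dini F t (l : R) : is_derive t 1 F l -> 0 <= l ->
  right_dini_ge0 F t.
Proof.
move=> /is_deriveP dF l0 e e0; have [d d0 Hd] := dF _ e0.
exists d => // h /andP[h0 hd]; have := Hd h; rewrite gtr0_norm// => /(_ hd).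
have : 0 <= h * l by rewrite mulr_ge0// ltW.
rewrite ler_norml /GRing.scale/= => h1 /andP[h2 h3]; lra.
Qed.

(** The right derivative [g] is a pointwise limit of continuous difference quotients, hence
    measurable, and it is bounded by [K]. Its integral [G] is Lipschitz and has derivative [g]
    almost everywhere by Lebesgue's differentiation theorem. Then [f - G] and [G - f] both have
    nonnegative right Dini derivative almost everywhere, so [f - G] is constant by [ac_dini_le]. *)
Lemma lipschitz_right_derivable_ae (f g : R -> R) a b K : a < b ->
  (forall s t, a <= s <= b -> a <= t <= b -> `|f t - f s| <= K * `|t - s|) ->
  (forall t, a <= t < b -> forall e : R, 0 < e -> exists2 d : R, 0 < d &
    forall h : R, 0 < h < d -> `|f (t + h) - f t - g t * h| <= e * h) ->
  {ae mu, forall t, a < t < b -> is_derive t 1 f (g t)}.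
Proof.
move=> ab lf rf.
(* Clamping the argument to [[a, b]] makes the difference quotients [q] continuous on the whole
   line. Outside [[a, b[] they tend to 0, the value given to [gt] there. *)
pose cl x := Num.max a (Num.min x b).
have cla x : a <= cl x <= b by rewrite /cl le_max lexx/= ge_max ltW//= ge_min lexx orbT.
have clid x : a <= x <= b -> cl x = x.
  by move=> /andP[ax xb]; rewrite /cl min_l// max_r.
have K0 : 0 <= K.
  have := lf a b; rewrite !lexx (ltW ab) => /(_ isT isT) H.
  have := le_trans (normr_ge0 _) H; rewrite pmulr_lge0// normr_gt0; lra.
pose gt x := if a <= x < b then g x else 0.
pose q n x := n.+1%:R * (f (cl (x + n.+1%:R^-1)) - f (cl x)).
have cll x y : x <= y -> 0 <= cl y - cl x <= y - x.
  move=> xy; have : 0 <= Num.min y b - Num.min x b <= y - x.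
    rewrite /Num.min; case: (ltP y b) => ?; case: (ltP x b) => ?; lra.
  rewrite /cl; move: (Num.min y b) (Num.min x b) => y' x' /andP[h1 h2].
  by rewrite /Num.max; case: (ltP a y') => ?; case: (ltP a x') => ?; lra.
have clL x y : `|cl y - cl x| <= `|y - x|.
  have [/cll/andP[h1 h2]|/ltW/cll/andP[h1 h2]] := leP x y.
    by rewrite !ger0_norm// (le_trans h1).
  by rewrite distrC [leRHS]distrC !ger0_norm// (le_trans h1).
have flL x y : `|f (cl y) - f (cl x)| <= K * `|y - x|.
  by apply: le_trans (lf _ _ (cla _) (cla _)) _; rewrite ler_wpM2l.
have cf : continuous (fun x => f (cl x)).
  move=> x; apply/cvgrPdist_lt => e e0.
  have K1 : 0 < K + 1 by lra.
  near=> y; apply: (@le_lt_trans _ _ ((K + 1) * `|y - x|)).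
    by rewrite distrC; apply: le_trans (flL x y) _; rewrite ler_wpM2r// lerDl.
  rewrite -ltr_pdivlMl// distrC; near: y.
  by apply: cvgr_dist_lt; rewrite ?mulr_gt0 ?invr_gt0.
have mf : measurable_fun setT (fun x => f (cl x)) by exact: continuous_measurable_fun.
have mq n : measurable_fun setT (q n).
  apply: measurable_funM => //; apply: measurable_funB => //.
  apply: (measurableT_comp mf); apply: measurable_funD => //.
have qgt x : q ^~ x @ \oo --> gt x.
  rewrite /q /gt; apply/cvgrPdist_le => e e0.
  suff [d d0 Hd] : exists2 d : R, 0 < d & forall h : R, 0 < h < d ->
      `|f (cl (x + h)) - f (cl x) - (if a <= x < b then g x else 0) * h| <= e * h.
    near=> n.
    have n0 : 0 < n.+1%:R^-1 :> R by [].
    have nd : n.+1%:R^-1 < d by near: n; exact: near_infty_natSinv_lt (PosNum d0).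
    have := Hd n.+1%:R^-1; rewrite n0 nd/= => /(_ isT).
    move: (if _ then _ else _) (f _ - f _) => G D H.
    rewrite distrC (_ : _ - G = n.+1%:R * (D - G / n.+1%:R)); last by field.
    by rewrite normrM ger0_norm// -ler_pdivlMl// [leRHS]mulrC.
  case: ifPn => [/andP[ax xb]|].
    have [d d0 Hd] := rf x (ltac:(by rewrite ax xb)) _ e0.
    exists (Num.min d (b - x)); first by rewrite lt_min d0 subr_gt0.
    move=> h /andP[h0]; rewrite lt_min => /andP[hd hb].
    rewrite !clid; [|by apply/andP; split; lra..].
    by apply: Hd; rewrite h0.
  rewrite negb_and -!ltNge => /orP[xa|bx].
    exists (a - x); first by rewrite subr_gt0.
    move=> h /andP[h0 hx].
    rewrite mul0r subr0 /cl !max_l ?subrr ?normr0 ?mulr_ge0 ?ltW//.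
      by rewrite gt_min xa.
    by rewrite gt_min; apply/orP; left; lra.
  exists 1 => // h /andP[h0 _].
  have -> : cl (x + h) = cl x.
    by rewrite /cl !min_r//; lra.
  by rewrite mul0r subr0 subrr normr0 mulr_ge0 ?ltW.
have mgt : measurable_fun setT gt.
  apply/measurable_EFinP.
  apply: (@emeasurable_fun_cvg _ _ _ _ (fun n x => (q n x)%:E)).
    by move=> n; apply/measurable_EFinP.
  by move=> x _; apply: cvg_EFin => //; [exact: nearW|exact: qgt].
have gK x : `|gt x| <= K.
  have : (fun n => `|q n x|) @ \oo --> `|gt x| by apply: cvg_norm; exact: qgt.
  move=> /cvg_lim <- //; apply: limr_le; first by apply: is_cvg_norm; apply/cvg_ex; exists (gt x).
  near=> n; rewrite /q normrM ger0_norm// -ler_pdivlMl//.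
  apply: le_trans (flL _ _) _; rewrite addrC addKr ger0_norm// mulrC//.
have mufin c d : (mu `]c, d] < +oo)%E.
  rewrite lebesgue_measure_itv/=; case: ifP => // _.
  by rewrite -EFinB ltry.
have gint A : measurable A -> (mu A < +oo)%E -> mu.-integrable A (EFin \o gt).
  move=> mA Aoo; apply: measurable_bounded_integrable => //.
    exact: measurable_funTS.
  by exists K; split; rewrite ?num_real// => x Kx y _ /=; apply: le_trans (gK y) (ltW Kx).
have gint2 c d : mu.-integrable `[c, d] (EFin \o gt).
  apply: gint => //; rewrite lebesgue_measure_itv/=; case: ifP => // _.
  by rewrite -EFinB ltry.
pose G x := (\int[mu]_(t in `[a, x]) gt t)%R.
have GL x y : a <= x -> x <= y -> `|G y - G x| <= K * `|y - x|.
  move=> ax xy.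
  rewrite /G Rintegral_itvB ?bnd_simp//.
  have h1 : mu.-integrable `]x, y] (EFin \o gt).
    by apply: gint => //; exact: mufin.
  apply: (le_trans (le_normr_Rintegral _ h1)) => //.
  apply: (@le_trans _ _ (\int[mu]_(t in `]x, y]) K)%R).
    apply: le_Rintegral => //.
      by have := integrable_norm h1.
    apply: measurable_bounded_integrable => //; first exact: mufin.
    exact: bounded_cst.
  rewrite Rintegral_cst//= lebesgue_measure_itv/= lte_fin.
  rewrite ger0_norm ?subr_ge0//; case: ltP => //= _.
  by rewrite mulr0 mulr_ge0// subr_ge0.
have acG : ac a b (fun t => - G t).
  apply: (@lipschitz_ac _ _ K) => s t /andP[as_ sb] /andP[at_ tb].
  rewrite -opprD normrN -[in leRHS]normrN opprB [in leRHS]distrC.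
  have [st|/ltW ts] := leP s t; first by apply: GL.
  by rewrite (distrC (G t)) (distrC t); apply: GL.
have acG' : ac a b G.
  apply: (@lipschitz_ac _ _ K) => s t /andP[as_ sb] /andP[at_ tb].
  have [st|/ltW ts] := leP s t; first by apply: GL.
  by rewrite (distrC (G t)) (distrC t); apply: GL.
have G' : {ae mu, forall x, a < x -> is_derive x 1 G (gt x)}.
  have locg : locally_integrable setT gt.
    split => //; first exact: openT.
    move=> A _ cA; have := gint A (compact_measurable cA) (compact_finite_measure cA).
    by move=> /integrableP[_].
  have := FTC1 (a := BLeft a) (fun y => gint2 a y) locg.
  apply: filterS; first exact: (ae_filter_ringOfSetsType mu).
  move=> x /= H ax; have ax' : (a%:E < x%:E)%E by rewrite lte_fin.
  have [dG Gx] := H ax'.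
  apply: (DeriveDef dG); rewrite -derive1E; exact: Gx.
have acf : ac a b f by apply: lipschitz_ac lf.
have acNf : ac a b (fun t => - f t).
  by apply: (@lipschitz_ac _ _ K) => s t h1 h2; rewrite -opprD normrN lf.
have sub_ac F t : ac a b F -> t <= b -> ac a t F.
  move=> acF tb e e0; have [d d0 Hd] := acF _ e0; exists d => // m u v h1 h2 h3.
  by apply: Hd => // i; have [h4 h5 h6] := h1 i; split => //; lra.
have fG t : a <= t <= b -> f t - G t = f a - G a.
  move=> /andP[at_ tb]; apply/le_anti/andP; split.
    suff : - f a + G a <= - f t + G t by lra.
    apply: (@ac_dini_le (fun s => - f s + G s)) => //.
      by apply: sub_ac tb; apply: acD.
    apply: filterS G'; first exact: (ae_filter_ringOfSetsType mu).
    move=> s /= H /andP[as_ st] e e0.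
    have sb : a <= s < b by rewrite ltW//= (lt_le_trans st).
    have e2 : 0 < e / 2 by rewrite divr_gt0.
    have [d d0 Hd] := (is_deriveP _ _ _).1 (H as_) _ e2; have [d' d'0 Hd'] := rf s sb _ e2.
    exists (Num.min d d'); first by rewrite lt_min d0.
    move=> h /andP[h0]; rewrite lt_min => /andP[h1 h2].
    have := Hd h; rewrite gtr0_norm// /gt sb => /(_ h1).
    have := Hd' h; rewrite h0 h2 => /(_ isT).
    exact: opp_slope_compare.
  suff : f a - G a <= f t - G t by lra.
  apply: (@ac_dini_le (fun s => f s - G s)) => //.
    by apply: sub_ac tb; apply: acD.
  apply: filterS G'; first exact: (ae_filter_ringOfSetsType mu).
  move=> s /= H /andP[as_ st] e e0.
  have sb : a <= s < b by rewrite ltW//= (lt_le_trans st).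
  have e2 : 0 < e / 2 by rewrite divr_gt0.
  have [d d0 Hd] := (is_deriveP _ _ _).1 (H as_) _ e2; have [d' d'0 Hd'] := rf s sb _ e2.
  exists (Num.min d d'); first by rewrite lt_min d0.
  move=> h /andP[h0]; rewrite lt_min => /andP[h1 h2].
  have := Hd h; rewrite gtr0_norm// /gt sb => /(_ h1).
  have := Hd' h; rewrite h0 h2 => /(_ isT).
  exact: slope_compare.
apply: filterS G'; first exact: (ae_filter_ringOfSetsType mu).
move=> t /= Gt /andP[at_ tb]; have := Gt at_; rewrite /gt (ltW at_) tb/=.
move=> /is_deriveP H; apply/is_deriveP => e e0; have [d d0 Hd] := H _ e0.
exists (Num.min d (Num.min (t - a) (b - t))).
  by rewrite !lt_min d0 !subr_gt0 at_.
move=> h; rewrite !lt_min ltr_norml => /andP[hd].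
rewrite !ltr_norml => /andP[/andP[h1 h2] /andP[h3 h4]].
have := Hd h; rewrite ltr_norml => /(_ hd).
have := fG t; have := fG (t + h).
rewrite (ltW at_) (ltW tb) => /(_ _) h5 /(_ isT).
have := h5 (shift_itv h1 h4).
by move=> h6 h7; rewrite (_ : G _ - G _ = f (t + h) - f t)//; exact: sub_swap h6 h7.
Unshelve. all: by end_near.
Qed.

End Dini.

(** * Differential calculus *)

Section Calculus.
Variable R : realType.

Lemma differentiable_approx (V W : normedModType R) (f : V -> W) x :
  differentiable f x -> forall e : R, 0 < e -> exists2 d : R, 0 < d &
    forall v, `|v| < d -> `|f (x + v) - f x - 'd f x v| <= e * `|v|.
Proof.
move=> /diff_locally/eqaddoP H e e0.
have /nbhs_ballP[d /= d0 Hd] := H _ e0; exists d => // v vd.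
have := Hd v; rewrite /= -ball_normE /= sub0r normrN => /(_ vd).
rewrite -[_ v]/(f (v + x) - (f x + 'd f x v)) opprD addrA.
by rewrite [v + x]addrC.
Qed.

Lemma is_derive_diff_comp (V W : normedModType R) (F : V -> W) (g : R -> V) (t : R) v :
  differentiable F (g t) -> is_derive t 1 g v ->
  is_derive t 1 (fun s => F (g s)) ('d F (g t) v).
Proof.
move=> dF [dg gv]; have dg' : differentiable g t by apply/derivable1_diffP.
have dc : differentiable (F \o g) t by apply: differentiable_comp.
apply: DeriveDef; first exact/derivable1_diffP.
rewrite -gv deriveE// diff_comp//= deriveE//.
Qed.

Lemma is_derive_line (V W : normedModType R) (f : V -> W) x v (t : R) :
  differentiable f (x + t *: v) ->
  is_derive t 1 (fun s : R => f (x + s *: v)) ('d f (x + t *: v) v).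
Proof.
move=> df; apply: (is_derive_diff_comp (g := fun s : R => x + s *: v)) => //.
apply/is_deriveP => e e0; exists 1 => // h _.
rewrite [X in `|X|](_ : _ = 0); first by rewrite normr0 mulr_ge0// ltW.
by rewrite scalerDl opprD addrACA subrr add0r [t *: v + _]addrC addrK subrr.
Qed.

Lemma is_derive_pair (V W : normedModType R) (f : R -> V) (g : R -> W) (t : R) v w :
  is_derive t 1 f v -> is_derive t 1 g w ->
  is_derive t 1 (fun s => (f s, g s)) (v, w).
Proof.
move=> /is_deriveP df /is_deriveP dg; apply/is_deriveP => e e0.
have [d d0 Hd] := df _ e0; have [d' d'0 Hd'] := dg _ e0.
exists (Num.min d d'); first by rewrite lt_min d0.
move=> h; rewrite lt_min => /andP[h1 h2].
by rewrite [leLHS]prod_normE/= ge_max Hd// Hd'.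
Qed.

Lemma coord_norm_le n (v : 'rV[R]_n) i : `|v 0 i| <= `|v|.
Proof.
rewrite [leRHS]/Num.Def.normr/= mx_normrE.
by apply: (le_trans _ (le_bigmax _ _ (0, i))).
Qed.

Lemma rv_norm_le n (v : 'rV[R]_n) (C : R) : 0 <= C ->
  (forall i, `|v 0 i| <= C) -> `|v| <= C.
Proof.
move=> C0 H; rewrite [leLHS]/Num.Def.normr/= mx_normrE bigmax_le//= => -[i j] _.
by rewrite (ord1 i).
Qed.

Lemma is_derive_coord n (f : R -> 'rV[R]_n) (t : R) v :
  is_derive t 1 f v <-> forall i, is_derive t 1 (fun s => f s 0 i) (v 0 i).
Proof.
split=> [/is_deriveP H i|H].
  apply/is_deriveP => e e0; have [d d0 Hd] := H _ e0; exists d => // h hd.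
  apply: le_trans (Hd h hd); apply: le_trans (coord_norm_le _ i).
  by rewrite !mxE.
apply/is_deriveP => e e0.
have /choice[d Hd] : forall i, exists d : R, 0 < d /\ forall h : R, `|h| < d ->
    `|f (t + h) 0 i - f t 0 i - h *: v 0 i| <= e * `|h|.
  by move=> i; have [d d0 Hd] := (is_deriveP _ _ _).1 (H i) _ e0; exists d.
exists (\big[Num.min/1]_i d i).
  by apply/bigmin_gtP; split => // i _; case: (Hd i).
move=> h hd; apply: rv_norm_le; first by rewrite mulr_ge0// ltW.
move=> i; rewrite !mxE; have [_] := Hd i; apply.
by apply: lt_le_trans hd _; exact: bigmin_le.
Qed.

Lemma diff_coord n (V : normedModType R) (f : V -> 'rV[R]_n) x i :
  differentiable f x ->
  differentiable (fun y => f y 0 i) x /\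
  forall v, 'd (fun y => f y 0 i) x v = 'd f x v 0 i.
Proof.
move=> df; have dF : differentiable (fun y => f y 0 i) x.
  apply: (@differentiable_comp _ _ _ _ f (fun N : 'rV[R]_n => N 0 i : R)) => //.
  exact: differentiable_coord.
split=> // v.
have h1 := is_derive_line (f := f) (x := x) (v := v) (t := 0).
have h2 := is_derive_line (f := fun y => f y 0 i) (x := x) (v := v) (t := 0).
rewrite scale0r addr0 in h1 h2.
have /is_derive_coord/(_ i) h3 := h1 df.
have [_ <-] := h2 dF; by have [_ <-] := h3.
Qed.

Lemma rv_sum_delta n (v : 'rV[R]_n) : v = \sum_i v 0 i *: delta_mx 0 i.
Proof. exact: row_sum_delta. Qed.

Lemma diff_sum_delta n (W : normedModType R) (f : 'rV[R]_n -> W) x v :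
  'd f x v = \sum_i v 0 i *: 'd f x (delta_mx 0 i).
Proof.
by rewrite {1}[v]rv_sum_delta linear_sum/=; apply: eq_bigr => i _; rewrite linearZ.
Qed.

Lemma pairing_grad n (f : 'rV[R]_n -> R) x v : pairing (grad f x) v = 'd f x v.
Proof.
rewrite diff_sum_delta; apply: eq_bigr => i _.
by rewrite mxE mulrC.
Qed.

Lemma is_derive_within_continuous (V : normedModType R) (f : R -> V) (df : R -> V) (a b : R) :
  (forall t, a <= t <= b -> is_derive t 1 f (df t)) ->
  {within `[a, b], continuous f}.
Proof.
move=> H; apply: continuous_in_subspaceT => t; rewrite inE/= in_itv/= => tab.
apply: differentiable_continuous; apply/derivable1_diffP.
by case: (H t tab).
Qed.

Lemma is_derive_ge_incr (f df : R -> R) (a b c : R) : a <= b ->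
  (forall t, a <= t <= b -> is_derive t 1 f (df t)) ->
  (forall t, a <= t <= b -> c <= df t) -> c * (b - a) <= f b - f a.
Proof.
move=> ab H1 H2; have [||t] := MVT_segment (df := df) (f := f) ab.
- by move=> t; rewrite in_itv/= => /andP[/ltW h1 /ltW h2]; apply: H1; rewrite h1.
- exact: is_derive_within_continuous H1.
by rewrite in_itv/= => tab ->; rewrite ler_wpM2r ?subr_ge0// H2.
Qed.

Lemma is_derive_near_incr n (f df : R -> 'rV[R]_n) (w : 'rV[R]_n) (a b C : R) : a <= b ->
  (forall t, a <= t <= b -> is_derive t 1 f (df t)) ->
  (forall t, a <= t <= b -> `|df t - w| <= C) ->
  `|f b - f a - (b - a) *: w| <= C * (b - a).
Proof.
move=> ab H1 H2; have C0 : 0 <= C by apply: le_trans (H2 a _); rewrite ?lexx.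
apply: rv_norm_le; first by rewrite mulr_ge0// subr_ge0.
move=> i; rewrite !mxE.
have Hi t : a <= t <= b -> is_derive t 1 (fun s => f s 0 i) (df t 0 i).
  by move=> /H1/is_derive_coord.
have [||t] := MVT_segment (df := fun t => df t 0 i) (f := fun t => f t 0 i) ab.
- by move=> t; rewrite in_itv/= => /andP[/ltW h1 /ltW h2]; apply: Hi; rewrite h1.
- exact: is_derive_within_continuous Hi.
rewrite in_itv/= => tab ->; rewrite mulrC -mulrBr normrM mulrC [X in _ * X]ger0_norm ?subr_ge0//.
rewrite ler_wpM2r ?subr_ge0//; apply: le_trans (H2 t tab).
by apply: le_trans (coord_norm_le _ i); rewrite !mxE.
Qed.

Lemma diff_le_lipschitz (V : normedModType R) (f : V -> R) x y (C : R) :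
  (forall s : R, 0 <= s <= 1 -> differentiable f (x + s *: (y - x)) /\
     `|'d f (x + s *: (y - x)) (y - x)| <= C) ->
  `|f y - f x| <= C.
Proof.
move=> H.
have Hd (t : R) : 0 <= t <= 1 -> is_derive t 1 (fun s : R => f (x + s *: (y - x)))
    ('d f (x + t *: (y - x)) (y - x)).
  by move=> /H[h1 _]; exact: is_derive_line.
have [||t] := MVT_segment (a := 0) (b := 1)
  (df := fun t => 'd f (x + t *: (y - x)) (y - x))
  (f := fun s : R => f (x + s *: (y - x))) ler01.
- by move=> t; rewrite in_itv/= => /andP[/ltW h1 /ltW h2]; apply: Hd; rewrite h1.
- exact: is_derive_within_continuous Hd.
rewrite in_itv/= scale1r scale0r addr0 subr0 mulr1 [x + _]addrC subrK => tab ->.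
by case: (H t tab).
Qed.

Lemma continuous_compact_bounded (V : topologicalType) (f : V -> R) (K : set V) :
  compact K -> (forall x, K x -> {for x, continuous f}) ->
  exists2 C : R, 0 <= C & forall x, K x -> `|f x| <= C.
Proof.
move=> cK cf; have [M [_ HM]] : bounded_set (f @` K).
  apply: compact_bounded; apply: continuous_compact => //.
  by apply: continuous_in_subspaceT => x /set_mem; exact: cf.
exists (`|M| + 1); first by rewrite addr_ge0.
move=> x Kx; apply: (HM (`|M| + 1)); last by exists x.
by rewrite (le_lt_trans (ler_norm _))// ltrDl.
Qed.

(** [Ck] controls directional derivatives one at a time. A bound on the whole differential comes
    from expanding the direction in the finite family [e], whose coordinate functions [l] are
    bounded by the norm; the mean value theorem on the convex set [K] does the rest. *)
Lemma Ck1_lipschitz (V : normedModType R) m (e : 'I_m -> V) (l : 'I_m -> V -> R)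
    (f : V -> R) (U K : set V) :
  (forall v, v = \sum_i l i v *: e i) -> (forall i v, `|l i v| <= `|v|) ->
  Ck 1 U f -> K `<=` U -> compact K ->
  (forall x y (s : R), K x -> K y -> 0 <= s <= 1 -> K (x + s *: (y - x))) ->
  exists2 C : R, 0 <= C & forall x y, K x -> K y -> `|f y - f x| <= C * `|y - x|.
Proof.
move=> vE lv [df cf] KU cK convK.
have /choice[C HC] : forall i, exists C : R, 0 <= C /\ forall x, K x -> `|'d f x (e i)| <= C.
  move=> i; have [C C0 HC] := continuous_compact_bounded cK
    (fun x Kx => cf (e i) x (KU _ Kx)).
  by exists C.
exists (\sum_i C i); first by apply: sumr_ge0 => i _; case: (HC i).
move=> x y Kx Ky; apply: diff_le_lipschitz => s s01.
have Ks := convK _ _ _ Kx Ky s01; split; first exact/df/KU.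
rewrite (_ : 'd f _ _ = \sum_i l i (y - x) *: 'd f (x + s *: (y - x)) (e i)); last first.
  move: (x + _) => z; rewrite {1}[y - x]vE linear_sum/=.
  by apply: eq_bigr => i _; rewrite linearZ.
rewrite mulr_suml.
apply: le_trans (ler_norm_sum _ _ _) _; apply: ler_sum => i _.
rewrite normrZ mulrC ler_pM//.
by have [_] := HC i; apply.
Qed.

End Calculus.

(** * Partial derivatives and symmetry of second derivatives *)

Section SecondDerivatives.
Variable R : realType.

Lemma diff_compE (U V W : normedModType R) (f : U -> V) (g : V -> W) x v :
  differentiable f x -> differentiable g (f x) ->
  'd (fun y => g (f y)) x v = 'd g (f x) ('d f x v).
Proof. by move=> df dg; rewrite (diff_comp df dg). Qed.

Lemma near_eq_diff (V W : normedModType R) (f g : V -> W) x :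
  (\forall y \near x, f y = g y) -> differentiable f x ->
  differentiable g x /\ forall v, 'd g x v = 'd f x v.
Proof.
move=> fg df; have H : g \o shift x = cst (g x) + 'd f x +o_ 0 id.
  apply/eqaddoP => e e0; have [d d0 Hd] := differentiable_approx df e0.
  have /nbhs_ballP[d' /= d'0 Hd'] := fg.
  apply/nbhs_ballP; exists (Num.min d d'); first by rewrite /= lt_min d0.
  move=> v; rewrite -ball_normE/= sub0r normrN lt_min => /andP[vd vd'].
  rewrite -[_ v]/(g (v + x) - (g x + 'd f x v)).
  have <- : f x = g x by apply: Hd'; exact: ballxx.
  have <- : f (v + x) = g (v + x).
    by apply: Hd'; rewrite -ball_normE/= opprD [- v + _]addrC addrA subrr sub0r normrN.
  by rewrite opprD addrA [v + x]addrC; apply: Hd.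
have E : 'd g x = 'd f x :> (V -> W).
  by apply: diff_unique => //; exact: diff_continuous.
split; last by move=> v; rewrite E.
by apply/diff_locallyP; rewrite E; split => //; exact: diff_continuous.
Qed.

Lemma partial_fst (U V W : normedModType R) (f : U * V -> W) x y :
  differentiable f (x, y) -> differentiable (fun x' => f (x', y)) x /\
  forall u, 'd (fun x' => f (x', y)) x u = 'd f (x, y) (u, 0).
Proof.
move=> df; have dp : differentiable (fun x' => (x', y)) x.
  by apply: differentiable_pair.
split; first exact: (differentiable_comp dp).
move=> u; rewrite (diff_compE u dp df) (diff_pair (f := id) (g := cst y))//.
by rewrite diff_cst diff_val.
Qed.

Lemma partial_snd (U V W : normedModType R) (f : U * V -> W) x y :
  differentiable f (x, y) -> differentiable (fun y' => f (x, y')) y /\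
  forall v, 'd (fun y' => f (x, y')) y v = 'd f (x, y) (0, v).
Proof.
move=> df; have dp : differentiable (fun y' => (x, y')) y.
  by apply: differentiable_pair.
split; first exact: (differentiable_comp dp).
move=> u; rewrite (diff_compE u dp df) (diff_pair (f := cst x) (g := id))//.
by rewrite diff_cst diff_val.
Qed.

Lemma diff_prod (U V W : normedModType R) (f : U * V -> W) x y u v :
  differentiable f (x, y) -> 'd f (x, y) (u, v) =
  'd (fun x' => f (x', y)) x u + 'd (fun y' => f (x, y')) y v.
Proof.
move=> df; rewrite (partial_fst df).2 (partial_snd df).2 -linearD/=.
by congr ('d _ _ _); apply/pair_equal_spec; rewrite /= addr0 add0r.
Qed.

(** The mean value theorem twice: in direction [v], for the increment of [f] under translation by
    [s *: w], and in direction [w], for the derivative along [v]. *)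
Lemma second_difference (V : normedModType R) (f : V -> R) x v w (s : R) : 0 < s ->
  (forall a b : R, 0 <= a <= s -> 0 <= b <= s ->
    differentiable f (x + b *: w + a *: v) /\
    differentiable (fun y => 'd f y v) (x + a *: v + b *: w)) ->
  exists a b : R, [/\ 0 <= a <= s, 0 <= b <= s &
    f (x + s *: w + s *: v) - f (x + s *: v) - (f (x + s *: w) - f x) =
    'd (fun y => 'd f y v) (x + a *: v + b *: w) w * s * s].
Proof.
move=> s0 H.
have H1 (t : R) : 0 <= t <= s -> is_derive t 1
    (fun t : R => f (x + s *: w + t *: v) - f (x + t *: v))
    ('d f (x + s *: w + t *: v) v - 'd f (x + t *: v) v).
  move=> ts; apply: is_deriveB; apply: is_derive_line.
    by have [] := H t s ts (ltac:(by rewrite lexx ltW)).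
  by have [] := H t 0 ts (ltac:(by rewrite lexx ltW)); rewrite scale0r addr0.
have [||a] := MVT_segment (df := fun t => 'd f (x + s *: w + t *: v) v - 'd f (x + t *: v) v)
  (f := fun t : R => f (x + s *: w + t *: v) - f (x + t *: v)) (ltW s0).
- by move=> t; rewrite in_itv/= => /andP[/ltW h1 /ltW h2]; apply: H1; rewrite h1.
- exact: is_derive_within_continuous H1.
rewrite in_itv/= scale0r !addr0 subr0 => as_ ->.
have H2 (t : R) : 0 <= t <= s -> is_derive t 1
    (fun t : R => 'd f (x + a *: v + t *: w) v)
    ('d (fun y => 'd f y v) (x + a *: v + t *: w) w).
  by move=> ts; apply: is_derive_line; have [] := H a t as_ ts.
have [||b] := MVT_segment (df := fun t => 'd (fun y => 'd f y v) (x + a *: v + t *: w) w)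
  (f := fun t : R => 'd f (x + a *: v + t *: w) v) (ltW s0).
- by move=> t; rewrite in_itv/= => /andP[/ltW h1 /ltW h2]; apply: H2; rewrite h1.
- exact: is_derive_within_continuous H2.
rewrite in_itv/= scale0r !addr0 subr0 [x + _ + _]addrAC => bs E.
by exists a, b; split => //; rewrite E.
Qed.

(** Schwarz's theorem: the second difference of [f] over a small parallelogram is symmetric in [v]
    and [w], and [second_difference] evaluates it in two ways at points close to [x], where the
    second derivatives are continuous. *)
Lemma diff2_sym (V : normedModType R) (f : V -> R) (U : set V) x v w :
  nbhs x U -> Ck 2 U f ->
  'd (fun y => 'd f y v) x w = 'd (fun y => 'd f y w) x v.
Proof.
move=> nU [df /= d2f]; have Ux : U x by apply: nbhs_singleton.
apply/eqP; rewrite -subr_eq0 -normr_le0; apply/ler_addgt0Pr => e e0.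
have e2 : 0 < e / 2 by rewrite divr_gt0.
have c1 : {for x, continuous (fun y => 'd (fun y => 'd f y v) y w)} by apply: (d2f v).2.
have c2 : {for x, continuous (fun y => 'd (fun y => 'd f y w) y v)} by apply: (d2f w).2.
have /nbhs_ballP[d /= d0 Hd] : \forall y \near x, [/\ U y,
   `|'d (fun y => 'd f y v) x w - 'd (fun y => 'd f y v) y w| <= e / 2 &
   `|'d (fun y => 'd f y w) x v - 'd (fun y => 'd f y w) y v| <= e / 2].
  near=> y; split.
  - by near: y.
  - by near: y; move/cvgrPdist_le : c1; apply.
  - by near: y; move/cvgrPdist_le : c2; apply.
(* A side for which the whole parallelogram lies in the ball of radius [d]; the [+ 1] covers
   [v = w = 0]. *)
pose s := d / 2 / (`|v| + `|w| + 1).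
have vw : 0 < `|v| + `|w| + 1 by rewrite ltr_wpDl// addr_ge0.
have s0 : 0 < s by rewrite !divr_gt0.
have inb (a b : R) : 0 <= a <= s -> 0 <= b <= s -> ball x d (x + a *: v + b *: w).
  move=> /andP[a0 as_] /andP[b0 bs]; rewrite -ball_normE/=.
  rewrite opprD opprD !addrA subrr sub0r -opprD normrN.
  apply: le_lt_trans (ler_normD _ _) _; rewrite !normrZ !ger0_norm//.
  apply: (@le_lt_trans _ _ (s * (`|v| + `|w|))).
    by rewrite mulrDr lerD// ler_wpM2r.
  apply: (@le_lt_trans _ _ (d / 2)); last by lra.
  rewrite /s -mulrA ler_piMr//; first by rewrite divr_ge0// ltW.
  by rewrite mulrC ler_pdivrMr//; lra.
have [|a [b [as_ bs E1]]] := @second_difference _ f x v w s s0.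
  move=> a b as_ bs; split.
    by rewrite addrAC; apply: df; have [] := Hd _ (inb _ _ as_ bs).
  by apply: (d2f v).1; have [] := Hd _ (inb _ _ as_ bs).
have [|b' [a' [bs' as' E2]]] := @second_difference _ f x w v s s0.
  move=> a' b' as' bs'; split.
    by apply: df; have [] := Hd _ (inb _ _ bs' as').
  by apply: (d2f w).1; rewrite addrAC; have [] := Hd _ (inb _ _ bs' as').
have [_ h1 _] := Hd _ (inb _ _ as_ bs).
have [_ _ h2] := Hd _ (inb _ _ as' bs').
have E : 'd (fun y => 'd f y v) (x + a *: v + b *: w) w =
         'd (fun y => 'd f y w) (x + a' *: v + b' *: w) v.
  have s_neq0 : s != 0 by rewrite gt_eqF.
  apply: (mulIf s_neq0); apply: (mulIf s_neq0) => /=.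
  rewrite -E1 [x + a' *: v + _]addrAC -E2 [x + s *: v + _]addrAC.
  by ring.
rewrite E in h1; rewrite add0r (splitr e).
by apply: le_trans (ler_distD _ _ _) (lerD h1 _); rewrite distrC.
Unshelve. all: by end_near.
Qed.

(* An opaque copy of ['d], so that unification does not unfold the differential. *)
Fact Dd_sig : {D : forall V W : normedModType R, (V -> W) -> V -> V -> W |
  forall V W f x v, D V W f x v = 'd f x v}.
Proof. by exists (fun V W f x v => 'd f x v). Qed.
Definition Dd (V W : normedModType R) (f : V -> W) (x v : V) : W := sval Dd_sig V W f x v.

Lemma DdE (V W : normedModType R) (f : V -> W) x v : 'd f x v = Dd f x v.
Proof. by rewrite /Dd (svalP Dd_sig). Qed.

Lemma DdZ (V W : normedModType R) (f : V -> W) x (a : R) v :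
  Dd f x (a *: v) = a *: Dd f x v.
Proof. by rewrite -!DdE linearZ. Qed.

Lemma Dd_delta n (W : normedModType R) (f : 'rV[R]_n -> W) x v :
  Dd f x v = \sum_i v 0 i *: Dd f x (delta_mx 0 i).
Proof. by rewrite -DdE diff_sum_delta; apply: eq_bigr => i _; rewrite -DdE. Qed.

Lemma Dd_approx (V W : normedModType R) (f : V -> W) x :
  differentiable f x -> forall e : R, 0 < e -> exists2 d : R, 0 < d &
    forall v, `|v| < d -> `|f (x + v) - f x - Dd f x v| <= e * `|v|.
Proof.
move=> df e e0; have [d d0 Hd] := differentiable_approx df e0.
by exists d => // v vd; rewrite -DdE; exact: Hd.
Qed.

Lemma is_derive_Dd_comp (V W : normedModType R) (F : V -> W) (g : R -> V) (t : R) v :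
  differentiable F (g t) -> is_derive t 1 g v ->
  is_derive t 1 (fun s => F (g s)) (Dd F (g t) v).
Proof. by rewrite -DdE; exact: is_derive_diff_comp. Qed.

Lemma Dd_comp (U V W : normedModType R) (f : U -> V) (g : V -> W) x v :
  differentiable f x -> differentiable g (f x) ->
  Dd (fun y => g (f y)) x v = Dd g (f x) (Dd f x v).
Proof. by move=> df dg; rewrite -!DdE; exact: diff_compE. Qed.

Lemma near_eq_Dd (V W : normedModType R) (f g : V -> W) x :
  (\forall y \near x, f y = g y) -> differentiable f x ->
  differentiable g x /\ forall v, Dd g x v = Dd f x v.
Proof.
by move=> fg /(near_eq_diff fg)[h1 h2]; split=> // v; rewrite -!DdE.
Qed.

Lemma Dd_id (V : normedModType R) (x v : V) : Dd id x v = v.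
Proof. by rewrite -DdE diff_val. Qed.

Lemma Dd_coord n (V : normedModType R) (f : V -> 'rV[R]_n) x i :
  differentiable f x ->
  differentiable (fun y => f y 0 i) x /\
  forall v, Dd (fun y => f y 0 i) x v = Dd f x v 0 i.
Proof.
by move=> /(@diff_coord _ _ _ _ _ i)[h1 h2]; split=> // v; rewrite -!DdE.
Qed.

Lemma Dd_partial_fst (U V W : normedModType R) (f : U * V -> W) x y :
  differentiable f (x, y) -> differentiable (fun x' => f (x', y)) x /\
  forall u, Dd (fun x' => f (x', y)) x u = Dd f (x, y) (u, 0).
Proof. by move=> /partial_fst[h1 h2]; split=> // v; rewrite -!DdE. Qed.

Lemma Dd_partial_snd (U V W : normedModType R) (f : U * V -> W) x y :
  differentiable f (x, y) -> differentiable (fun y' => f (x, y')) y /\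
  forall u, Dd (fun y' => f (x, y')) y u = Dd f (x, y) (0, u).
Proof. by move=> /partial_snd[h1 h2]; split=> // v; rewrite -!DdE. Qed.

Lemma Dd_prod (U V W : normedModType R) (f : U * V -> W) x y u v :
  differentiable f (x, y) -> Dd f (x, y) (u, v) =
  Dd (fun x' => f (x', y)) x u + Dd (fun y' => f (x, y')) y v.
Proof. by rewrite -!DdE; exact: diff_prod. Qed.

Lemma Ck_subset (V W : normedModType R) k (A B : set V) (f : V -> W) :
  A `<=` B -> Ck k B f -> Ck k A f.
Proof.
move=> AB; elim: k f => [|k IH] f /=; first by move=> H x /AB/H.
by move=> [h1 h2]; split=> [x /AB/h1//|v]; exact/IH/h2.
Qed.

Lemma Ck_diffE (V W : normedModType R) k (U : set V) (f : V -> W) : Ck k.+1 U f ->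
  (forall x, U x -> differentiable f x) /\ forall v, Ck k U (fun y => Dd f y v).
Proof.
move=> /=[h1 h2]; split=> // v.
by rewrite (_ : (fun y => Dd f y v) = (fun x => 'd f x v))//; apply/funext => y; rewrite DdE.
Qed.

Lemma Ck1_intro (V W : normedModType R) (U : set V) (f : V -> W) :
  (forall x, U x -> differentiable f x) ->
  (forall v x, U x -> {for x, continuous (fun y => Dd f y v)}) -> Ck 1 U f.
Proof.
move=> h1 h2; split=> // v; rewrite (_ : (fun x => 'd f x v) = (fun y => Dd f y v)).
  exact: h2.
by apply/funext => y; rewrite DdE.
Qed.

Lemma Ck_lower (V W : normedModType R) k (U : set V) (f : V -> W) : Ck k.+1 U f -> Ck k U f.
Proof.
elim: k f => [|k IH] f /=.
  by move=> [df _] x Ux; apply: differentiable_continuous; exact: df.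
by move=> [df d2f]; split=> // v; apply: IH; exact: d2f.
Qed.

Lemma Dd_sym (V : normedModType R) (f : V -> R) (U : set V) x v w :
  nbhs x U -> Ck 2 U f ->
  Dd (fun y => Dd f y v) x w = Dd (fun y => Dd f y w) x v.
Proof.
move=> nU c2; have E z : (fun y => Dd f y z) = (fun y => 'd f y z).
  by apply/funext => y; rewrite DdE.
by rewrite !E -!DdE; exact: diff2_sym nU c2.
Qed.

End SecondDerivatives.

(** * The pairing of covectors and vectors *)

Section Pairing.
Variables (R : realType) (n : nat).
Implicit Types p v w : 'rV[R]_n.

Lemma pairing_delta p i : pairing p (delta_mx 0 i) = p 0 i.
Proof.
rewrite /pairing (bigD1 i)//= big1 ?mxE ?eqxx ?mulr1 ?addr0//.
by move=> j ji; rewrite mxE eqxx (negbTE ji) mulr0.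
Qed.

Lemma pairingDr p v w : pairing p (v + w) = pairing p v + pairing p w.
Proof. by rewrite /pairing -big_split; apply: eq_bigr => i _; rewrite mxE mulrDr. Qed.

Lemma pairingDl p q v : pairing (p + q) v = pairing p v + pairing q v.
Proof. by rewrite /pairing -big_split; apply: eq_bigr => i _; rewrite mxE mulrDl. Qed.

Lemma pairingZr p a v : pairing p (a *: v) = a * pairing p v.
Proof. by rewrite /pairing mulr_sumr; apply: eq_bigr => i _; rewrite mxE mulrCA. Qed.

Lemma pairingZl a p v : pairing (a *: p) v = a * pairing p v.
Proof. by rewrite /pairing mulr_sumr; apply: eq_bigr => i _; rewrite mxE mulrA. Qed.

Lemma pairingNr p v : pairing p (- v) = - pairing p v.
Proof. by rewrite -scaleN1r pairingZr mulN1r. Qed.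

Lemma pairingNl p v : pairing (- p) v = - pairing p v.
Proof. by rewrite -scaleN1r pairingZl mulN1r. Qed.

Lemma pairingBr p v w : pairing p (v - w) = pairing p v - pairing p w.
Proof. by rewrite pairingDr pairingNr. Qed.

Lemma pairingBl p q v : pairing (p - q) v = pairing p v - pairing q v.
Proof. by rewrite pairingDl pairingNl. Qed.

Lemma pairingC p v : pairing p v = pairing v p.
Proof. by apply: eq_bigr => i _; rewrite mulrC. Qed.

Lemma pairing_sumr p m (f : 'I_m -> 'rV[R]_n) :
  pairing p (\sum_i f i) = \sum_i pairing p (f i).
Proof.
elim/big_ind2 : _ => // [|x1 x2 y1 y2 <- <-]; last exact: pairingDr.
by rewrite /pairing big1// => i _; rewrite mxE mulr0.
Qed.

Lemma pairing_norm p v : `|pairing p v| <= n%:R * `|p| * `|v|.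
Proof.
apply: le_trans (ler_norm_sum _ _ _) _.
apply: (@le_trans _ _ (\sum_(i < n) `|p| * `|v|)).
  by apply: ler_sum => i _; rewrite normrM ler_pM// coord_norm_le.
by rewrite sumr_const card_ord -[leLHS]mulr_natl mulrA.
Qed.

Lemma pairing_inj p q : (forall v, pairing p v = pairing q v) -> p = q.
Proof.
by move=> H; apply/rowP => i; rewrite -!pairing_delta.
Qed.

Definition gr (f : 'rV[R]_n -> R) q : 'rV[R]_n := \row_i Dd f q (delta_mx 0 i).

Lemma grE (f : 'rV[R]_n -> R) q : grad f q = gr f q.
Proof. by apply/rowP => i; rewrite !mxE DdE. Qed.

Lemma pairing_gr (f : 'rV[R]_n -> R) q v : pairing (gr f q) v = Dd f q v.
Proof. by rewrite -grE pairing_grad DdE. Qed.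

End Pairing.

(** * Coordinate changes *)

Section Charts.
Variables (R : realType) (n : nat) (M : topologicalType).
Variable X : smooth_structure R n M.
Local Notation E := 'rV[R]_n.
Implicit Types (c x : M) (v : E) (q : E).

Lemma image_param c q : (chart X c @` dom X c) q ->
  dom X c (param X c q) /\ chart X c (param X c q) = q.
Proof. by move=> [x dx <-]; rewrite chartK. Qed.

Lemma image_nbhs c (U : set M) x : dom X c x -> nbhs x U ->
  nbhs (chart X c x) (chart X c @` (dom X c `&` U)).
Proof.
move=> dx xU; have qV : (chart X c @` dom X c) (chart X c x) by exists x.
have := param_continuous qV; rewrite /prop_for /continuous_at chartK// => /(_ _ xU) H1.
have H2 : nbhs (chart X c x) (chart X c @` dom X c).
  by apply: open_nbhs_nbhs; split => //; exact: open_image_chart.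
have H3 : nbhs (chart X c x) (param X c @^-1` U) by exact: H1.
apply: filterS2 H3 H2 => q /= Uq /image_param[h1 h2].
by exists (param X c q).
Qed.

Lemma dom_nbhs c x : dom X c x -> nbhs x (dom X c).
Proof. by move=> dx; apply: open_nbhs_nbhs; split => //; exact: open_dom. Qed.

Lemma chart_nbhs c x (A : set E) : dom X c x -> nbhs (chart X c x) A ->
  \forall y \near x, A (chart X c y).
Proof. by move=> dx; exact: chart_continuous. Qed.

Lemma transition_diff c c' x : dom X c x -> dom X c' x ->
  differentiable (chart X c' \o param X c) (chart X c x).
Proof.
by move=> dx dx'; have [h _] := smooth_transition X c c' 1; apply: h; exists x.
Qed.

(** [tc] and [cc] are sealed copies of the coordinate changes of vectors and covectors, made for the
    same reason as [Dd]. *)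
Fact tc_sig : {f : M -> M -> M -> E -> E | f = tangent_change X}.
Proof. by exists (tangent_change X). Qed.
Definition tc c c' x v : E := sval tc_sig c c' x v.

Fact cc_sig : {f : M -> M -> M -> E -> E | f = cotangent_change X}.
Proof. by exists (cotangent_change X). Qed.
Definition cc c c' x (p : E) : E := sval cc_sig c c' x p.

Lemma tcE c c' x v : tangent_change X c c' x v = tc c c' x v.
Proof. by rewrite /tc (svalP tc_sig). Qed.

Lemma ccE c c' x p : cotangent_change X c c' x p = cc c c' x p.
Proof. by rewrite /cc (svalP cc_sig). Qed.

Lemma tcdE c c' x v : tc c c' x v = Dd (chart X c' \o param X c) (chart X c x) v.
Proof. by rewrite -tcE /tangent_change DdE. Qed.

Lemma tcZ c c' x a v : tc c c' x (a *: v) = a *: tc c c' x v.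
Proof. by rewrite !tcdE DdZ. Qed.

Lemma tc0 c c' x : tc c c' x 0 = 0.
Proof. by have := tcZ c c' x 0 0; rewrite !scale0r. Qed.

Lemma tc_sum c c' x v : tc c c' x v = \sum_i v 0 i *: tc c c' x (delta_mx 0 i).
Proof.
by rewrite tcdE Dd_delta; apply: eq_bigr => i _; rewrite tcdE.
Qed.

Lemma tc_id c x v : dom X c x -> tc c c x v = v.
Proof.
move=> dx; rewrite tcdE.
have H : \forall q \near chart X c x, id q = (chart X c \o param X c) q.
  apply: filterS (image_nbhs dx (dom_nbhs dx)) => q [y [dy _] <-] /=.
  by rewrite chartK.
by rewrite (near_eq_Dd H _).2// Dd_id.
Qed.

Lemma tc_comp c c' c'' x v : dom X c x -> dom X c' x -> dom X c'' x ->
  tc c' c'' x (tc c c' x v) = tc c c'' x v.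
Proof.
move=> d d' d''; rewrite [tc c c' x v]tcdE.
have Ex : chart X c' x = (chart X c' \o param X c) (chart X c x) by rewrite /= chartK.
have d1 := transition_diff d d'; have d2 := transition_diff d' d''.
rewrite tcdE Ex.
have d2' : differentiable (chart X c'' \o param X c') ((chart X c' \o param X c) (chart X c x)).
  by rewrite -Ex.
rewrite -(Dd_comp v d1 d2').
have H : \forall q \near chart X c x,
   (chart X c'' \o param X c') ((chart X c' \o param X c) q) =
   (chart X c'' \o param X c) q.
  apply: filterS (image_nbhs d (dom_nbhs d')) => q [y [dy dy'] <-] /=.
  by rewrite (chartK dy) (chartK dy').
have [_ <-] := near_eq_Dd H (differentiable_comp d1 d2').
by rewrite tcdE.
Qed.

(** [cc c c'] is the transpose of [tc c' c]. With [pairing_inj], this reduces identities between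
    covectors to the corresponding ones between vectors. *)
Lemma pairing_cc c c' x p v : pairing (cc c c' x p) v = pairing p (tc c' c x v).
Proof.
rewrite [tc _ _ _ _]tc_sum pairing_sumr -ccE; apply: eq_bigr => i _.
by rewrite mxE mulrC pairingZr tcE.
Qed.

Lemma cc_id c x p : dom X c x -> cc c c x p = p.
Proof. by move=> d; apply: pairing_inj => v; rewrite pairing_cc tc_id. Qed.

Lemma cc_comp c c' c'' x p : dom X c x -> dom X c' x -> dom X c'' x ->
  cc c' c'' x (cc c c' x p) = cc c c'' x p.
Proof.
by move=> d d' d''; apply: pairing_inj => v; rewrite !pairing_cc tc_comp.
Qed.

Lemma Dd_change_chart (W : normedModType R) (f : M -> W) c c' x v :
  dom X c x -> dom X c' x ->
  differentiable (f \o param X c) (chart X c x) ->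
  differentiable (f \o param X c') (chart X c' x) /\
  Dd (f \o param X c') (chart X c' x) (tc c c' x v) =
  Dd (f \o param X c) (chart X c x) v.
Proof.
move=> d d' df.
have Ex : (chart X c \o param X c') (chart X c' x) = chart X c x by rewrite /= chartK.
have d1 := transition_diff d' d; have d2 := transition_diff d d'.
have H : \forall q \near chart X c' x,
   (f \o param X c) ((chart X c \o param X c') q) = (f \o param X c') q.
  apply: filterS (image_nbhs d' (dom_nbhs d)) => q [y [dy dy'] <-] /=.
  by rewrite (chartK dy) (chartK dy').
have df' : differentiable (f \o param X c) ((chart X c \o param X c') (chart X c' x)).
  by rewrite Ex.
have [h1 h2] := near_eq_Dd H (differentiable_comp d1 df').
split=> //.
have h3 := Dd_comp (tc c c' x v) d1 df'.
have h4 := tcdE c' c x (tc c c' x v).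
rewrite tc_comp// tc_id// in h4.
apply: (etrans (h2 _)); apply: (etrans h3); apply: (etrans (congr1 (fun q => Dd (f \o param X c) q _) Ex)).
by rewrite -h4.
Qed.

Lemma gr_change_chart (f : M -> R) c c' x :
  dom X c x -> dom X c' x ->
  differentiable (f \o param X c) (chart X c x) ->
  gr (f \o param X c') (chart X c' x) =
  cc c c' x (gr (f \o param X c) (chart X c x)).
Proof.
move=> d d' df; apply: pairing_inj => v; rewrite pairing_cc.
apply: (etrans (pairing_gr _ _ _)); apply: etrans (esym (pairing_gr _ _ _)).
have [_ <-] := Dd_change_chart (tc c' c x v) d d' df.
by rewrite tc_comp// tc_id.
Qed.

Lemma is_derive_change_chart (gamma : R -> M) (t : R) c c' w :
  {for t, continuous gamma} -> dom X c (gamma t) -> dom X c' (gamma t) ->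
  is_derive t 1 (fun s => chart X c (gamma s)) w ->
  is_derive t 1 (fun s => chart X c' (gamma s)) (tc c c' (gamma t) w).
Proof.
move=> cg d d' dg; have dT := transition_diff d d'.
have := is_derive_Dd_comp (F := chart X c' \o param X c)
  (g := fun s => chart X c (gamma s)) dT dg.
rewrite tcdE; apply: near_eq_is_derive.
have H : \forall s \near t, dom X c (gamma s) by apply: cg; exact: dom_nbhs.
by apply: filterS H => s /= ds; rewrite chartK.
Qed.

End Charts.

Lemma continuous_sum_at (R : realType) (T : topologicalType) m (F : 'I_m -> T -> R) x :
  (forall i, {for x, continuous (F i)}) -> {for x, continuous (fun y => \sum_i F i y)}.
Proof.
move=> H; rewrite /prop_for /continuous_at.
apply: (@cvg_big _ _ (fun a b : R => a + b) 0 xpredT _ _ (nbhs x)) => //.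
  exact: add_continuous.
by move=> i _; exact: H.
Qed.

(** * The Riemannian distance in charts *)

Section QuadraticForm.
Variables (R : realType) (n : nat).
Local Notation E := 'rV[R]_n.

Definition qform (G : 'I_n -> 'I_n -> R) (w : E) : R :=
  \sum_i \sum_j w 0 i * w 0 j * G i j.

Lemma qformZ G (a : R) w : qform G (a *: w) = a ^+ 2 * qform G w.
Proof.
rewrite /qform mulr_sumr; apply: eq_bigr => i _; rewrite mulr_sumr.
by apply: eq_bigr => j _; rewrite !mxE; ring.
Qed.

Lemma qform_sub G G' (e : R) w : (forall i j, `|G i j - G' i j| <= e) ->
  `|qform G w - qform G' w| <= n%:R * n%:R * e * `|w| ^+ 2.
Proof.
move=> H; rewrite /qform -sumrB; apply: le_trans (ler_norm_sum _ _ _) _.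
apply: (@le_trans _ _ (\sum_(i < n) \sum_(j < n) (e * `|w| ^+ 2))).
  apply: ler_sum => i _; rewrite -sumrB; apply: le_trans (ler_norm_sum _ _ _) _.
  apply: ler_sum => j _; rewrite -mulrBr mulrC !normrM expr2.
  by rewrite ler_pM// ?mulr_ge0// ler_pM// coord_norm_le.
rewrite -[in leRHS]mulrA; move: (e * _ ^+ 2) => y.
by rewrite !sumr_const !card_ord -mulrnA -[leLHS]mulr_natl natrM.
Qed.

Lemma qform0 w : qform (fun _ _ => 0) w = 0.
Proof. by rewrite /qform big1// => i _; rewrite big1// => j _; rewrite mulr0. Qed.

Lemma qform_continuous G : continuous (qform G).
Proof.
move=> w; apply: continuous_sum_at => i; apply: continuous_sum_at => j.
have h k : {for w, continuous (fun y : E => y 0 k)} by exact: coord_continuous.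
by apply: continuousM; [apply: continuousM; exact: h|exact: cst_continuous].
Qed.

(** The form has a positive minimum on the compact unit sphere, and it is homogeneous of degree
    2. *)
Lemma qform_coercive G : (forall w, w != 0 -> 0 < qform G w) ->
  exists2 a : R, 0 < a & forall w, a * `|w| ^+ 2 <= qform G w.
Proof.
move=> Gpos; pose S := [set w : E | `|w| = 1].
(* In dimension 0 the sphere is empty and every vector is 0. *)
have [[w0 Sw0]|NS] := pselect (exists w, S w); last first.
  exists 1 => // w; have [->|w0] := eqVneq w 0.
    by rewrite normr0 expr0n mulr0 -(scale0r (0 : E)) qformZ expr0n mul0r.
  exfalso; apply: NS; exists (`|w|^-1 *: w).
  by rewrite /S/= normrZ normfV normr_id mulVf// normr_eq0.
have cS : compact S.
  apply: bounded_closed_compact.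
    by exists 1; split => // x x1 w /= ->; exact: ltW.
  have -> : S = (fun w : E => `|w|) @^-1` [set 1] by [].
  apply: closed_comp; last exact: closed_eq.
  by move=> w _; exact: norm_continuous.
have [w1 Sw1 Hmin] : exists2 w1, w1 \in S & forall w, w \in S -> qform G w1 <= qform G w.
  apply: compact_EVT_min => //; first by exists w0.
  by apply: continuous_subspaceT; exact: qform_continuous.
have w1_neq0 : w1 != 0 by move/set_mem: Sw1; rewrite /S/= -normr_eq0 => ->; rewrite oner_eq0.
exists (qform G w1); first exact: Gpos.
move=> w; have [->|w_neq0] := eqVneq w 0.
  by rewrite normr0 expr0n mulr0 -(scale0r (0 : E)) qformZ expr0n mul0r.
have nw : `|w| != 0 by rewrite normr_eq0.
have := Hmin (`|w|^-1 *: w); rewrite inE /S/= normrZ normfV normr_id mulVf// => /(_ erefl).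
rewrite qformZ exprVn mulrC => H; rewrite -ler_pdivlMr ?exprn_gt0 ?normr_gt0//.
Qed.

End QuadraticForm.

Section Metric.
Variables (R : realType) (n : nat) (M : topologicalType).
Variables (X : smooth_structure R n M) (g : riemannian_metric X).
Local Notation E := 'rV[R]_n.
Implicit Types (c x : M) (v w : E) (q : E).

(** The classical coefficients g_ij of the metric in the chart [c], as functions of the
    coordinates. *)
Definition metric_coef c (q : E) (i j : 'I_n) : R :=
  let x := param X c q in
  (tc X c x x (delta_mx 0 i) *m metric_matrix g x *m (tc X c x x (delta_mx 0 j))^T) 0 0.

Lemma metric_coef_Ck k c i j :
  Ck k (chart X c @` dom X c) (fun q => metric_coef c q i j).
Proof.
have := metric_smooth g c i j k; congr Ck.
by apply/funext => q; rewrite /= !tcE.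
Qed.

Lemma tnorm_chart c x w : dom X c x ->
  tnorm g x (tc X c x x w) = Num.sqrt (qform (metric_coef c (chart X c x)) w).
Proof.
move=> dx; rewrite /tnorm; congr Num.sqrt.
rewrite [tc X c x x w]tc_sum mulmx_suml [X in _ *m X]raddf_sum mulmx_suml summxE.
apply: eq_bigr => i _; rewrite mulmx_sumr summxE; apply: eq_bigr => j _.
rewrite -[matrix_trmx__canonical__Algebra_Additive _ _ _ _]/((w 0 j *: _)^T) linearZ/= -!scalemxAl -scalemxAr scalerA mxE/= /metric_coef chartK//.
Qed.

Lemma qform_metric_pos c q w : (chart X c @` dom X c) q -> w != 0 ->
  0 < qform (metric_coef c q) w.
Proof.
move=> [x dx <-] w0; have tw0 : tc X c x x w != 0.
  apply: contraNneq w0 => h; rewrite -(tc_id w dx) -(tc_comp w dx (mem_dom X x) dx) h.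
  by rewrite tc0.
have := metric_pos g x tw0; rewrite -sqrtr_gt0 -/(tnorm g x (tc X c x x w)) tnorm_chart//.
by rewrite sqrtr_gt0.
Qed.

Lemma tnorm0 x : tnorm g x 0 = 0.
Proof. by rewrite /tnorm mul0mx mul0mx mxE sqrtr0. Qed.

(** Near [x0] the Riemannian norm is uniformly equivalent to the coordinate norm: the form is
    coercive at [x0] and its coefficients are continuous. All comparisons of [dist] with coordinates
    rest on this. *)
Lemma tnorm_bounds c x0 : dom X c x0 -> exists r a b : R, [/\ 0 < r, 0 < a, 0 < b,
  (forall q, `|q - chart X c x0| < r -> (chart X c @` dom X c) q) &
  forall q w, `|q - chart X c x0| < r ->
    a * `|w| <= Num.sqrt (qform (metric_coef c q) w) <= b * `|w|].
Proof.
move=> dx0; set q0 := chart X c x0.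
have Vq0 : (chart X c @` dom X c) q0 by exists x0.
have [a a0 Ha] := qform_coercive (fun w => @qform_metric_pos c q0 w Vq0).
(* A positive bound for the number of coefficients. With [N2 * e = a / 2], a perturbation of each
   coefficient by [e] costs at most half of the coercivity constant [a]. *)
pose N2 : R := n%:R * n%:R + 1.
have N20 : 0 < N2 by rewrite /N2 ltr_wpDl// mulr_ge0.
pose e := a / 2 / N2.
have e0 : 0 < e by rewrite !divr_gt0.
have [r /= r0 Hr] : exists2 r : R, 0 < r & forall q, `|q - q0| < r ->
    (chart X c @` dom X c) q /\
    forall i j, `|metric_coef c q i j - metric_coef c q0 i j| <= e.
  suff : \forall q \near q0, (chart X c @` dom X c) q /\
    forall i j, `|metric_coef c q i j - metric_coef c q0 i j| <= e.
    move=> /nbhs_ballP[r /= r0 Hr]; exists r => // q qr; apply: Hr.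
    by rewrite -ball_normE/= distrC.
  near=> q; split.
    near: q; apply: open_nbhs_nbhs; split => //; exact: open_image_chart.
  near: q; apply: filter_forall => i; apply: filter_forall => j.
  have /= /(_ _ Vq0)/cvgrPdist_le/(_ _ e0) := metric_coef_Ck 0 c i j.
  by apply: filterS => q; rewrite distrC.
pose m := \sum_i \sum_j `|metric_coef c q0 i j|.
have m0 : 0 <= m by apply: sumr_ge0 => i _; apply: sumr_ge0 => j _.
have Hm i j : `|metric_coef c q0 i j - 0| <= m.
  rewrite subr0 /m (bigD1 i)//= (bigD1 j)//= -addrA lerDl.
  by apply: addr_ge0; apply: sumr_ge0 => // k _; apply: sumr_ge0.
have N2e : N2 * e = a / 2 by rewrite /e mulrC divfK// gt_eqF.
have b0 : 0 <= N2 * m + a by rewrite addr_ge0 ?mulr_ge0// ltW.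
exists r, (Num.sqrt (a / 2)), (Num.sqrt (N2 * m + a) + 1); split.
- by [].
- by rewrite sqrtr_gt0 divr_gt0.
- by rewrite ltr_wpDl// sqrtr_ge0.
- by move=> q /Hr[].
move=> q w /Hr[_ Hq].
have W0 : 0 <= `|w| ^+ 2 by rewrite sqr_ge0.
have h1 := qform_sub w Hq.
have h2 := qform_sub w Hm; rewrite qform0 subr0 in h2.
have h3 : n%:R * n%:R * e * `|w| ^+ 2 <= a / 2 * `|w| ^+ 2.
  rewrite ler_wpM2r// -N2e ler_wpM2r ?(ltW e0)//; rewrite /N2; lra.
have h4 : n%:R * n%:R * m * `|w| ^+ 2 <= N2 * m * `|w| ^+ 2.
  by rewrite ler_wpM2r// ler_wpM2r// /N2; lra.
have h5 := Ha w.
move: h1 h2; rewrite !ler_norml => /andP[h6 h7] /andP[h8 h9].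
have sw : `|w| = Num.sqrt (`|w| ^+ 2) by rewrite sqrtr_sqr normr_id.
apply/andP; split.
  rewrite [in leLHS]sw -sqrtrM ?divr_ge0 ?(ltW a0)// ler_wsqrtr//.
  have : a / 2 * `|w| ^+ 2 = a * `|w| ^+ 2 - a / 2 * `|w| ^+ 2 by field.
  move: (a * _) (a / 2 * _) h5 h3 h6 => y z; lra.
apply: (@le_trans _ _ (Num.sqrt (N2 * m + a) * `|w|)).
  rewrite [in leRHS]sw -sqrtrM// ler_wsqrtr// mulrDl.
  have : a / 2 * `|w| ^+ 2 = a * `|w| ^+ 2 - a / 2 * `|w| ^+ 2 by field.
  have : 0 <= a * `|w| ^+ 2 by rewrite mulr_ge0// ltW.
  move: (a * _) (a / 2 * _) (N2 * m * _) h5 h3 h7 h4 h9 => y z t; lra.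
by rewrite ler_wpM2r// lerDl.
Unshelve. all: by end_near.
Qed.

End Metric.

Section Speed.
Variables (R : realType) (n : nat) (M : topologicalType).
Variables (X : smooth_structure R n M) (g : riemannian_metric X).
Local Notation E := 'rV[R]_n.
Local Notation mu := (@lebesgue_measure R).
Implicit Types (c x y : M) (v w : E) (q : E) (t : R).

Fact speed_sig : {s : (R -> M) -> R -> R |
  forall gamma t, s gamma t = tnorm g (gamma t) (velocity X gamma t)}.
Proof. by exists (fun gamma t => tnorm g (gamma t) (velocity X gamma t)). Qed.
Definition speed (gamma : R -> M) t : R := sval speed_sig gamma t.

Lemma speedE gamma t : speed gamma t = tnorm g (gamma t) (velocity X gamma t).
Proof. by rewrite /speed (svalP speed_sig). Qed.

Lemma speed_ge0 gamma t : 0 <= speed gamma t.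
Proof. by rewrite speedE; exact: sqrtr_ge0. Qed.

Lemma curve_lengthE gamma : curve_length g gamma = (\int[mu]_(s in `[0, 1]) speed gamma s)%R.
Proof. by apply: eq_Rintegral => t _; rewrite speedE. Qed.

Lemma velocity_chart gamma t c w : {for t, continuous gamma} -> dom X c (gamma t) ->
  is_derive t 1 (fun s => chart X c (gamma s)) w ->
  velocity X gamma t = tc X c (gamma t) (gamma t) w.
Proof.
move=> cg d dg; have := is_derive_change_chart cg d (mem_dom X (gamma t)) dg.
by move=> [_]; rewrite /velocity derive1E.
Qed.

Lemma speed_chart gamma t c w : {for t, continuous gamma} -> dom X c (gamma t) ->
  is_derive t 1 (fun s => chart X c (gamma s)) w ->
  speed gamma t = Num.sqrt (qform (metric_coef g c (chart X c (gamma t))) w).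
Proof.
by move=> cg d dg; rewrite speedE (velocity_chart cg d dg) tnorm_chart.
Qed.

Lemma C1_curve_derive gamma t c : C1_curve X gamma -> dom X c (gamma t) ->
  is_derive t 1 (fun s => chart X c (gamma s)) (Dd (chart X c \o gamma) t 1).
Proof.
move=> [_ cg] d; have [df _] := cg c; have := df t d => dt.
have dd : derivable (chart X c \o gamma) t 1 by apply/derivable1_diffP.
by apply: DeriveDef => //; rewrite deriveE// DdE.
Qed.

Lemma C1_curve_speed_continuous gamma : C1_curve X gamma -> continuous (speed gamma).
Proof.
move=> C1 t; have [cg C1c] := C1; set c := gamma t.
have dc : \forall s \near t, dom X c (gamma s).
  by apply: cg; apply: dom_nbhs; exact: mem_dom.
pose G s i j := metric_coef g c (chart X c (gamma s)) i j.
pose W s := Dd (chart X c \o gamma) s 1.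
have cW : {for t, continuous W}.
  have [_ /(_ 1)/= h] := Ck_diffE (C1c c); apply: h => /=; exact: mem_dom.
have cG i j : {for t, continuous (fun s => G s i j)}.
  apply: (@continuous_comp _ _ _ (fun s => chart X c (gamma s)) (fun q => metric_coef g c q i j)).
    apply: (@continuous_comp _ _ _ gamma (chart X c)); first exact: cg.
    apply: chart_continuous; exact: mem_dom.
  by apply: (metric_coef_Ck g 0 c i j); exists (gamma t) => //; exact: mem_dom.
have : {for t, continuous (fun s => Num.sqrt (qform (G s) (W s)))}.
  apply: (@continuous_comp _ _ _ (fun s => qform (G s) (W s)) (@Num.sqrt R)); last exact: sqrt_continuous.
  apply: continuous_sum_at => i; apply: continuous_sum_at => j.
  have h k : {for t, continuous (fun s => W s 0 k)}.
    apply: (@continuous_comp _ _ _ W (fun v : E => v 0 k)); first exact: cW.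
    exact: coord_continuous.
  by apply: continuousM; [apply: continuousM; exact: h|exact: cG].
rewrite /prop_for /continuous_at.
have Et : speed gamma t = Num.sqrt (qform (G t) (W t)).
  apply: speed_chart; [exact: cg|exact: mem_dom|].
  by apply: C1_curve_derive => //; exact: mem_dom.
rewrite Et; apply: cvg_trans; apply: near_eq_cvg; apply: filterS dc => s ds.
by apply/esym/speed_chart => //; [exact: cg|exact: C1_curve_derive].
Qed.

(* A C^1 curve is defined for all times: [theta] keeps the segment inside the chart. *)
Definition theta t : R := (1 - cos (pi * t)) / 2.

Lemma theta0 : theta 0 = 0.
Proof. by rewrite /theta mulr0 cos0 subrr mul0r. Qed.

Lemma theta1 : theta 1 = 1.
Proof. by rewrite /theta mulr1 cospi opprK divff. Qed.

Lemma theta_itv t : 0 <= theta t <= 1.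
Proof.
have := cos_max (pi * t); rewrite ler_norml /theta => /andP[h1 h2].
by apply/andP; split; lra.
Qed.

Lemma is_derive_theta t : is_derive t 1 theta (pi / 2 * sin (pi * t)).
Proof.
have h : is_derive t 1 (fun s : R => pi * s) pi.
  by apply: is_derive_eq; rewrite /GRing.scale/= mulr1 // addr0.
have h2 : is_derive t 1 (fun s : R => cos (pi * s)) (- sin (pi * t) * pi).
  have := is_derive_Dd_comp (F := cos) (g := fun s => pi * s) (t := t) (v := pi) _ h.
  rewrite -DdE; have [dc cE] := is_derive_cos (pi * t).
  have dc' : differentiable cos (pi * t) by apply/derivable1_diffP.
  move=> /(_ dc'); rewrite (_ : 'd cos (pi * t) pi = - sin (pi * t) * pi)//.
  transitivity ('d cos (pi * t) (pi *: (1 : R))); first by rewrite /GRing.scale/= mulr1.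
  by rewrite linearZ/= -deriveE// cE /GRing.scale/= mulrC.
have h3 := is_deriveZ 2^-1 (is_deriveB (is_derive_cst (1 : R) t 1) h2).
rewrite (_ : theta = 2^-1 \*: (cst 1 - (fun s => cos (pi * s)))); last first.
  by apply/funext => s; rewrite /theta mulrC.
by apply: (is_derive_eq h3); rewrite sub0r /GRing.scale/=; ring.
Qed.

Lemma dtheta_le t : `|pi / 2 * sin (pi * t)| <= 2.
Proof.
rewrite normrM; apply: (@le_trans _ _ (`|pi / 2| * 1)).
  by rewrite ler_wpM2l// sin_max.
by have /andP[h1 /ltW h2] := @pihalf_02 R; rewrite mulr1 gtr0_norm.
Qed.

Definition segment c (q q' : E) (t : R) : M := param X c (q + theta t *: (q' - q)).

Lemma ball_convex (q0 q q' : E) (r s : R) : `|q - q0| < r -> `|q' - q0| < r ->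
  0 <= s <= 1 -> `|q + s *: (q' - q) - q0| < r.
Proof.
move=> h1 h2 /andP[s0 s1].
have -> : q + s *: (q' - q) - q0 = (1 - s) *: (q - q0) + s *: (q' - q0).
  by apply/rowP => i; rewrite !mxE; ring.
apply: le_lt_trans (ler_normD _ _) _; rewrite !normrZ ger0_norm ?subr_ge0// [`|s|]ger0_norm//.
have [->|sn0] := eqVneq s 0; first by rewrite subr0 mul1r mul0r addr0.
have s0' : 0 < s by rewrite lt_neqAle eq_sym sn0.
have h3 : s * `|q' - q0| < s * r by rewrite ltr_pM2l.
have h4 : (1 - s) * `|q - q0| <= (1 - s) * r by rewrite ler_wpM2l ?subr_ge0// ltW.
by have := ler_ltD h4 h3; rewrite -mulrDl subrK mul1r.
Qed.

Lemma is_derive_segment_line (q w : E) t :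
  is_derive t 1 (fun s => q + theta s *: w) ((pi / 2 * sin (pi * t)) *: w).
Proof.
apply/is_deriveP => e e0.
have w1 : 0 < `|w| + 1 by rewrite ltr_wpDl.
have [d d0 Hd] := (is_deriveP _ _ _).1 (is_derive_theta t) _ (divr_gt0 e0 w1).
exists d => // h hd; have := Hd h hd; set th' := pi / 2 * _ => H.
have -> : q + theta (t + h) *: w - (q + theta t *: w) - h *: (th' *: w) =
    (theta (t + h) - theta t - h *: th') *: w.
  by apply/rowP => i; rewrite !mxE /GRing.scale/=; ring.
rewrite normrZ; apply: le_trans (ler_wpM2r _ H) _ => //.
rewrite mulrAC ler_wpM2r// -mulrA ler_piMr ?(ltW e0)// mulrC ler_pdivrMr//; lra.
Qed.

Lemma segment_continuous c q q' :
  (forall s : R, 0 <= s <= 1 -> (chart X c @` dom X c) (q + s *: (q' - q))) ->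
  continuous (segment c q q').
Proof.
move=> H t; apply: (@continuous_comp _ _ _ (fun s : R => q + theta s *: (q' - q)) (param X c)).
  apply: differentiable_continuous; apply/derivable1_diffP.
  by case: (is_derive_segment_line q (q' - q) t).
by apply: param_continuous; exact/H/theta_itv.
Qed.

Lemma is_derive_segment c c' q q' t :
  (forall s : R, 0 <= s <= 1 -> (chart X c @` dom X c) (q + s *: (q' - q))) ->
  dom X c' (segment c q q' t) ->
  is_derive t 1 (chart X c' \o segment c q q') ((pi / 2 * sin (pi * t)) *:
     Dd (chart X c' \o param X c) (q + theta t *: (q' - q)) (q' - q)).
Proof.
move=> H d'; rewrite -DdZ.
have /H/image_param[dc cE] := theta_itv t.
have dT : differentiable (chart X c' \o param X c) (q + theta t *: (q' - q)).
  by rewrite -cE; exact: transition_diff.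
exact: (is_derive_Dd_comp dT (is_derive_segment_line q (q' - q) t)).
Qed.

Lemma segment_C1 c q q' :
  (forall s : R, 0 <= s <= 1 -> (chart X c @` dom X c) (q + s *: (q' - q))) ->
  C1_curve X (segment c q q').
Proof.
move=> H; have cs := segment_continuous H; split=> // c'; apply: Ck1_intro => [t d'|v t d'].
  by apply/derivable1_diffP; have [] := is_derive_segment H d'.
have nd : \forall s \near t, dom X c' (segment c q q' s).
  by apply: cs; exact: dom_nbhs.
have E1 s : dom X c' (segment c q q' s) -> Dd (chart X c' \o segment c q q') s v =
    v *: ((pi / 2 * sin (pi * s)) *:
     Dd (chart X c' \o param X c) (q + theta s *: (q' - q)) (q' - q)).
  move=> ds; have [dh hE] := is_derive_segment H ds.
  transitivity (Dd (chart X c' \o segment c q q') s (v *: (1 : R))).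
    by rewrite /GRing.scale/= mulr1.
  by rewrite DdZ -DdE -deriveE ?hE//; exact/derivable1_diffP.
rewrite /prop_for /continuous_at E1//.
have : {for t, continuous (fun s => v *: ((pi / 2 * sin (pi * s)) *:
     Dd (chart X c' \o param X c) (q + theta s *: (q' - q)) (q' - q)))}.
  apply: continuousZr; apply: continuousZ.
    apply: continuousM; first exact: cst_continuous.
    apply: (@continuous_comp _ _ _ (fun s : R => pi * s) (@sin R)); last exact: continuous_sin.
    by apply: continuousM; [exact: cst_continuous|move=> ?; exact].
  apply: (@continuous_comp _ _ _ (fun s : R => q + theta s *: (q' - q))
    (fun z => Dd (chart X c' \o param X c) z (q' - q))).
    apply: differentiable_continuous; apply/derivable1_diffP.
    by case: (is_derive_segment_line q (q' - q) t).
  have [_ /(_ (q' - q))/= h] := Ck_diffE (smooth_transition X c c' 1).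
  have /H/image_param[dc cE] := theta_itv t.
  by apply: h; exists (segment c q q' t).
by apply: cvg_trans; apply: near_eq_cvg; apply: filterS nd => s ds; rewrite E1.
Qed.

Lemma segment0 c x q' : dom X c x -> segment c (chart X c x) q' 0 = x.
Proof. by move=> d; rewrite /segment theta0 scale0r addr0 chartK. Qed.

Lemma segment1 c y q : dom X c y -> segment c q (chart X c y) 1 = y.
Proof. by move=> d; rewrite /segment theta1 scale1r [q + _]addrC subrK chartK. Qed.

Definition path_of gamma x y := [/\ piecewise_C1 X 0 1 gamma, gamma 0 = x & gamma 1 = y].

Lemma curve_length_ge0 gamma : 0 <= curve_length g gamma.
Proof. by rewrite curve_lengthE; apply: Rintegral_ge0 => s _; exact: speed_ge0. Qed.

Lemma dist_ge0 x y : 0 <= dist g x y.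
Proof.
rewrite /dist; set S := image _ _.
have [[l Sl]|NS] := pselect (S !=set0); last first.
  by rewrite (_ : S = set0) ?inf0//; apply/eqP/negPn/negP => /set0P.
by apply: lb_le_inf; [exists l|move=> _ [ga _ <-]; exact: curve_length_ge0].
Qed.

Lemma dist_le_length gamma x y : path_of gamma x y -> dist g x y <= curve_length g gamma.
Proof.
move=> p; apply: ge_inf; last by exists gamma.
by exists 0 => _ [ga _ <-]; exact: curve_length_ge0.
Qed.

Lemma C1_path gamma : C1_curve X gamma -> path_of gamma (gamma 0) (gamma 1).
Proof.
move=> C1; split=> //; exists [:: 1]; split; first exact: itv_partition1.
by move=> u; rewrite inE => /eqP ->; exists gamma.
Qed.

Lemma C1_curve_length_le gamma (C : R) : C1_curve X gamma ->
  (forall t, speed gamma t <= C) -> curve_length g gamma <= C.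
Proof.
move=> C1 H; have cs := C1_curve_speed_continuous C1.
have mf : mu `[0%R, 1%R]%classic = 1%E.
  by rewrite lebesgue_measure_itv/= lte_fin ltr01 oppr0 adde0.
have Coo : (mu `[0%R, 1%R]%classic < +oo)%E by rewrite mf ltry.
apply: (@le_trans _ _ (\int[mu]_(s in `[0, 1]) C)%R); last first.
  by rewrite Rintegral_cst//= mf/= mulr1.
rewrite curve_lengthE; apply: le_Rintegral => //.
- apply: continuous_compact_integrable; first exact: segment_compact.
  exact: continuous_subspaceT.
- by apply: measurable_bounded_integrable => //; exact: bounded_cst.
Qed.

(** The coordinate segment is a competitor in [dist]. Its speed is at most [b] times |theta'| times
    the coordinate distance, and |theta'| <= 2, whence the constant [b * 2]. The existence of a
    curve is recorded because it makes reachability an open and closed condition. *)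
Lemma dist_upper c x0 : dom X c x0 -> exists r C : R, [/\ 0 < r, 0 < C,
  (forall q, `|q - chart X c x0| < r -> (chart X c @` dom X c) q) &
  forall x y, dom X c x -> dom X c y -> `|chart X c x - chart X c x0| < r ->
    `|chart X c y - chart X c x0| < r ->
    (exists2 ga, C1_curve X ga & ga 0 = x /\ ga 1 = y) /\
    dist g x y <= C * `|chart X c y - chart X c x|].
Proof.
move=> d0; have [r [a [b [r0 a0 b0 rV Hb]]]] := tnorm_bounds g d0.
exists r, (b * 2); split=> //; first by rewrite mulr_gt0.
move=> x y dx dy xr yr; set q := chart X c x; set q' := chart X c y.
have H (s : R) : 0 <= s <= 1 -> (chart X c @` dom X c) (q + s *: (q' - q)).
  by move=> s01; apply: rV; exact: ball_convex.
have C1 := segment_C1 H.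
have S0 := segment0 q' dx; have S1 := segment1 q dy.
split; first by exists (segment c q q').
have := C1_path C1; rewrite S0 S1 => p; apply: le_trans (dist_le_length p) _.
apply: C1_curve_length_le => // t.
have /H/image_param[dc cE] := theta_itv t.
rewrite (speed_chart (C1.1 t) dc (is_derive_segment H dc)) cE.
have DE : Dd (chart X c \o param X c) (q + theta t *: (q' - q)) (q' - q) = q' - q.
  by rewrite -[X in Dd _ X _]cE -tcdE tc_id.
rewrite DE.
have h1 : `|q + theta t *: (q' - q) - chart X c x0| < r.
  by apply: ball_convex => //; exact: theta_itv.
have /andP[_ h] := Hb _ ((pi / 2 * sin (pi * t)) *: (q' - q)) h1.
apply: (le_trans h); rewrite normrZ -[leRHS]mulrA ler_wpM2l ?(ltW b0)//.
by rewrite ler_wpM2r// dtheta_le.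
Qed.

End Speed.

Lemma integral_itv_split (R : realType) (k : R -> R) (a x b : R) :
  a < x -> x <= b -> (forall r, 0 <= k r) ->
  measurable_fun `]a, x[ k -> measurable_fun `]x, b[ k ->
  measurable_fun `]a, b[ k /\
  (\int[@lebesgue_measure R]_(r in `]a, b[) (k r)%:E =
    \int[@lebesgue_measure R]_(r in `]a, x[) (k r)%:E +
    \int[@lebesgue_measure R]_(r in `]x, b[) (k r)%:E)%E.
Proof.
move=> ax xb k0 ma mx.
have mab : `]a, b[%classic = `]a, x[ `|` `[x, b[ :> set R.
  by rewrite -itv_bndbnd_setU// bnd_simp.
have mx' : measurable_fun `[x, b[ k by apply/measurable_fun_itv_obnd_cbndP.
have m : measurable_fun `]a, b[ k by rewrite mab; apply/measurable_funU.
split=> //; rewrite mab ge0_integral_setU//=.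
- congr (_ + _)%E; apply: (integral_itv_bndoo true true (f := fun r => (k r)%:E)).
  exact/measurable_EFinP.
- by rewrite -mab; exact/measurable_EFinP.
- by move=> r _; rewrite lee_fin.
- apply/disj_setPS => r [/=]; rewrite !in_itv/= => /andP[_ h1] /andP[h2 _].
  by rewrite leNgt h1 in h2.
Qed.

(** * Variation of a function along curves of given length *)

Section LengthBound.
Variables (R : realType) (n : nat) (M : topologicalType).
Variables (X : smooth_structure R n M) (g : riemannian_metric X).
Local Notation E := 'rV[R]_n.
Local Notation mu := (@lebesgue_measure R).
Implicit Types (c x y : M) (v w : E) (q : E) (t : R).

Lemma near_eq_speed (eta gamma : R -> M) t :
  (\forall s \near t, eta s = gamma s) -> speed g eta t = speed g gamma t.
Proof.
move=> nE; have E0 : eta t = gamma t by exact: nbhs_singleton nE.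
have V0 : velocity X eta t = velocity X gamma t.
  rewrite /velocity E0 !derive1E; apply: near_eq_derive.
  by apply: filterS nE => s /= ->.
by rewrite !speedE E0 V0.
Qed.

(** A first-order Lipschitz bound along C^1 curves that does not ask [f] to be differentiable; [f]
    will be a cutoff distance. The section integrates it to a bound by the length. *)
Definition speed_lipschitz (C : R) (f : M -> R) := forall eta, C1_curve X eta ->
  forall t (e : R), 0 < e -> exists2 d : R, 0 < d & forall h : R, 0 < h < d ->
    `|f (eta (t + h)) - f (eta t)| <= (C * speed g eta t + e) * h.

Variables (C : R) (f : M -> R).
Hypotheses (cf : continuous f) (Lf : speed_lipschitz C f) (C0 : 0 <= C).

Lemma C1_curve_variation eta (a b : R) : C1_curve X eta -> a < b ->
  ((`|f (eta b) - f (eta a)|)%:E <= C%:E * \int[mu]_(s in `]a, b[) (speed g eta s)%:E)%E.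
Proof.
move=> C1 ab; have cs := C1_curve_speed_continuous (g := g) C1.
have ci (u v : R) : mu.-integrable `[u, v] (EFin \o speed g eta).
  apply: continuous_compact_integrable; first exact: segment_compact.
  exact: continuous_subspaceT.
(* Starting the primitive of the speed at [a - 1] makes [a] an interior point, so that [K] has a
   two-sided derivative there. *)
pose K (x : R) := (\int[mu]_(t in `[a - 1, x]) speed g eta t)%R.
have dK t : a <= t -> is_derive t 1 K (speed g eta t).
  move=> at_; have h1 : a - 1 < t by lra.
  have h2 : t < t + 1 by lra.
  have [dK KE] := continuous_FTC1_closed h2 (ci _ _) h1 (cs t).
  by apply: (DeriveDef dK); rewrite -derive1E; exact: KE.
have cfe : continuous (fun t => f (eta t)).
  by move=> t; apply: (@continuous_comp _ _ _ eta f); [exact: C1.1|exact: cf].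
have KB : C * K a + `|f (eta b) - f (eta a)| <= C * K b.
  suff H (F : R -> R) : continuous F -> (forall t (e : R), 0 < e -> exists2 d : R, 0 < d &
      forall h : R, 0 < h < d -> `|F (t + h) - F t| <= (C * speed g eta t + e) * h) ->
      C * K a - F a <= C * K b - F b.
    have [h|h] := leP 0 (f (eta b) - f (eta a)).
      by have := H _ cfe (Lf C1); rewrite ger0_norm//; lra.
    have cN : continuous (fun t => - f (eta t)).
      by move=> t; apply: continuousN; exact: cfe.
    have := H _ cN; rewrite ltr0_norm// => H1 {H}.
    suff : C * K a - - f (eta a) <= C * K b - - f (eta b) by lra.
    apply: H1 => t e e0; have [d d0 Hd] := Lf C1 t e0; exists d => // k k0.
    by rewrite -opprD normrN; exact: Hd.
  move=> cF LF; apply: (@dini_le _ (fun t => C * K t - F t)); first exact: ltW.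
    move=> t /andP[at_ tb] e e0.
    have [dKt _] := dK t (ltW at_).
    have cc : {for t, continuous (fun s => C * K s - F s)}.
      apply: continuousB; last exact: cF.
      apply: continuousM; first exact: cst_continuous.
      by apply: differentiable_continuous; apply/derivable1_diffP.
    have /cvgrPdist_le/(_ _ e0)/nbhs_ballP[d /= d0 Hd] := cc.
    exists d => // s /andP[s1 s2] _; have := Hd s; rewrite -ball_normE/= => /(_ _).
    rewrite gtr0_norm ?subr_gt0// => /(_ (ltac:(lra))).
    by rewrite ler_norml => /andP[]; lra.
  move=> t /andP[at_ tb] e e0.
  have e2 : 0 < e / 2 by lra.
  have C1' : 0 < C + 1 by rewrite ltr_wpDl.
  have [d d0 Hd] := (is_deriveP _ _ _).1 (dK t at_) _ (divr_gt0 e2 C1').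
  have [d' d'0 Hd'] := LF t _ e2.
  exists (Num.min d d'); first by rewrite lt_min d0.
  move=> h /andP[h0]; rewrite lt_min => /andP[h1 h2].
  have := Hd h; rewrite gtr0_norm// => /(_ h1) H1.
  have := Hd' h; rewrite h0 h2 => /(_ isT) H2.
  have H3 : C * `|K (t + h) - K t - h *: speed g eta t| <= e / 2 * h.
    apply: le_trans (ler_wpM2l C0 H1) _; rewrite mulrA ler_wpM2r ?(ltW h0)//.
    by rewrite mulrCA ler_piMr ?(ltW e2)// ler_pdivrMr// mul1r; lra.
  have H4 : - (C * `|K (t + h) - K t - h *: speed g eta t|) <=
      C * (K (t + h) - K t - h * speed g eta t).
    by rewrite -mulrN ler_wpM2l// lerNnormlW.
  move: H2; rewrite ler_norml => /andP[H5 H6].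
  have H7 : C * (K (t + h) - K t - h * speed g eta t) =
     C * K (t + h) - C * K t - C * speed g eta t * h by ring.
  have H8 : (C * speed g eta t + e / 2) * h = C * speed g eta t * h + e / 2 * h by ring.
  move: H3 H4 H5 H6; rewrite H7 H8.
  have : e * h = e / 2 * h + e / 2 * h by field.
  move: (C * `| _ |) (C * speed g eta t * h) (e / 2 * h) (e * h) => A B D G; lra.
have KBA : K b - K a = (\int[mu]_(s in `]a, b[) speed g eta s)%R.
  rewrite /K Rintegral_itvB ?bnd_simp//; [|lra|exact: ltW].
  rewrite -Rintegral_itv_bndo_bndc//.
  by apply: integrableS (ci a b) => //; exact: subset_itv_oo_cc.
have fin : (\int[mu]_(s in `]a, b[) (speed g eta s)%:E)%E \is a fin_num.
  apply: integrable_fin_num => //.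
  by apply: integrableS (ci a b) => //; exact: subset_itv_oo_cc.
rewrite -(fineK fin) -EFinM lee_fin -/(Rintegral _ _ _) -KBA mulrBr; lra.
Qed.

(** Induction on the partition. The integrals run over open intervals, because [gamma] coincides
    with a C^1 curve on a whole neighbourhood of a time only inside a cell; at a node its velocity
    may have no meaning. *)
Lemma piecewise_variation gamma (s : seq R) (a : R) : path <%O a s ->
  (forall u, u \in zip (a :: s) s -> exists eta, C1_curve X eta /\
     forall r, u.1 <= r <= u.2 -> gamma r = eta r) ->
  let b := last a s in
  [/\ a <= b, measurable_fun `]a, b[ (speed g gamma),
     (\int[mu]_(r in `]a, b[) (speed g gamma r)%:E < +oo)%E &
     ((`|f (gamma b) - f (gamma a)|)%:E <=
      C%:E * \int[mu]_(r in `]a, b[) (speed g gamma r)%:E)%E].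
Proof.
elim: s a => [|x s IH] a /=.
  move=> _ _; split => //.
  - rewrite set_itv_ge ?bnd_simp ?ltxx//; exact: measurable_fun_set0.
  - by rewrite set_itv_ge ?bnd_simp ?ltxx// integral_set0 ltry.
  - by rewrite set_itv_ge ?bnd_simp ?ltxx// integral_set0 mule0 subrr normr0.
move=> /andP[ax ps] H.
have [|eta [C1 gE]] := H (a, x); first by rewrite inE eqxx.
have [|xb mx fx vx] := IH x ps; first by move=> u us; apply: H; rewrite inE us orbT.
set b := last x s in xb mx fx vx *.
have cs := C1_curve_speed_continuous (g := g) C1.
have mse : measurable_fun setT (speed g eta) by exact: continuous_measurable_fun.
have sE r : r \in `]a, x[ -> speed g eta r = speed g gamma r.
  rewrite in_itv/= => /andP[ar rx].
  have nE : \forall s \near r, eta s = gamma s.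
    near=> s0; rewrite gE//=; apply/andP; split.
      by apply/ltW; near: s0; exact: lt_nbhsr.
    by apply/ltW; near: s0; exact: lt_nbhsl.
  exact: near_eq_speed.
have ma : measurable_fun `]a, x[ (speed g gamma).
  apply: (@eq_measurable_fun _ _ _ _ _ (speed g eta)).
    by move=> r /set_mem /sE.
  exact: measurable_funTS.
have [m iE0] := integral_itv_split ax xb (fun r => speed_ge0 g gamma r) ma mx.
have iE : (\int[mu]_(r in `]a, b[) (speed g gamma r)%:E =
    \int[mu]_(r in `]a, x[) (speed g eta r)%:E + \int[mu]_(r in `]x, b[) (speed g gamma r)%:E)%E.
  rewrite iE0; congr (_ + _)%E.
  by apply: eq_integral => r /set_mem/sE ->.
have finx : (\int[mu]_(r in `]a, x[) (speed g eta r)%:E < +oo)%E.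
  have : mu.-integrable `[a, x] (EFin \o speed g eta).
    apply: continuous_compact_integrable; first exact: segment_compact.
    exact: continuous_subspaceT.
  move=> ci; have : mu.-integrable `]a, x[ (EFin \o speed g eta).
    by apply: integrableS ci => //; exact: subset_itv_oo_cc.
  move=> /integrableP[_]; congr (_ < _)%E; apply: eq_integral => r _ /=.
  by rewrite ger0_norm// speed_ge0.
split=> //.
- by rewrite (le_trans (ltW ax)).
- by rewrite iE lte_add_pinfty.
rewrite iE ge0_muleDr; [|by apply: integral_ge0 => r _; rewrite lee_fin speed_ge0..].
apply: (@le_trans _ _ ((`|f (gamma x) - f (gamma a)|)%:E + (`|f (gamma b) - f (gamma x)|)%:E)%E).
  rewrite -EFinD lee_fin; apply: le_trans (ler_normD _ _).
  by rewrite le_eqVlt; apply/orP; left; apply/eqP; congr `|_|; ring.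
apply: leeD => //.
have := C1_curve_variation C1 ax; rewrite -!gE//= ?lexx ?(ltW ax)//.
Unshelve. all: by end_near.
Qed.

Lemma path_variation gamma x y : path_of X gamma x y ->
  `|f y - f x| <= C * curve_length g gamma.
Proof.
move=> [[s [[ps /eqP ls] H]] <- <-].
have [_ m fin v] := piecewise_variation ps H; rewrite ls in m fin v.
have -> : curve_length g gamma = fine (\int[mu]_(r in `]0%R, 1%R[) (speed g gamma r)%:E)%E.
  rewrite curve_lengthE /Rintegral; congr fine.
  apply: (integral_itv_bndoo true false (f := fun r => (speed g gamma r)%:E)).
  exact/measurable_EFinP.
rewrite -lee_fin EFinM fineK// ge0_fin_numE//.
by apply: integral_ge0 => r _; rewrite lee_fin speed_ge0.
Qed.

End LengthBound.

(** * Joining points by piecewise C^1 curves *)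

Section PathConnected.
Variables (R : realType) (n : nat) (M : topologicalType).
Variables (X : smooth_structure R n M) (g : riemannian_metric X).
Local Notation E := 'rV[R]_n.
Implicit Types (c x y z : M).

Lemma zip_rcons_mem (a z : R) s u : u \in zip (a :: rcons s z) (rcons s z) ->
  u \in zip (a :: s) s \/ u = (last a s, z).
Proof.
elim: s a => [|x s IH] a /=; first by rewrite inE => /eqP ->; right.
rewrite !inE => /orP[/eqP ->|/IH[us|->]]; [|by left; rewrite us orbT|by right].
by left; rewrite eqxx.
Qed.

Lemma zip_le_last (a : R) s u : path <%O a s -> u \in zip (a :: s) s -> u.2 <= last a s.
Proof.
elim: s a => [|x s IH] a //= /andP[ax ps]; rewrite inE => /orP[/eqP -> /=|]; last exact: IH.
exact: (@itv_partition_le _ _ x (last x s) s).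
Qed.

Lemma zip_map2 (f : R -> R) a s :
  zip (f a :: map f s) (map f s) = map (fun u => (f u.1, f u.2)) (zip (a :: s) s).
Proof. by elim: s a => [|x s IH] a //=; rewrite IH. Qed.

Lemma C1_curve_affine (sigma : R -> M) (k m : R) : C1_curve X sigma ->
  C1_curve X (fun t => sigma (k * t + m)).
Proof.
move=> [cs C1]; have ca : continuous (fun t : R => k * t + m).
  move=> t; apply: continuousD; last exact: cst_continuous.
  by apply: continuousM; [exact: cst_continuous|move=> ?; exact].
have da (t : R) : is_derive t 1 (fun t : R => k * t + m) k.
  apply/is_deriveP => e e0; exists 1 => // h _.
  rewrite (_ : _ - h *: k = 0) ?normr0 ?mulr_ge0 ?(ltW e0)//.
  by rewrite /GRing.scale/=; ring.
split; first by move=> t; apply: continuous_comp; [exact: ca|exact: cs].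
move=> c; have [d1 d2] := Ck_diffE (C1 c).
have H (t : R) : dom X c (sigma (k * t + m)) ->
    differentiable (fun t => chart X c (sigma (k * t + m))) t /\
    forall v, Dd (fun t => chart X c (sigma (k * t + m))) t v =
      (v * k) *: Dd (chart X c \o sigma) (k * t + m) 1.
  move=> dt; have da' : differentiable (fun t : R => k * t + m) t.
    by apply/derivable1_diffP; case: (da t).
  have ds := d1 _ dt.
  split; first exact: (differentiable_comp da' ds).
  move=> v; rewrite (Dd_comp _ da' ds).
  have -> : Dd (fun t : R => k * t + m) t v = (v * k) *: (1 : R).
    transitivity (Dd (fun t : R => k * t + m) t (v *: (1 : R))).
      by rewrite /GRing.scale/= mulr1.
    have [dk kE] := da t; rewrite DdZ -DdE -deriveE// kE.
    by rewrite /GRing.scale/= mulr1.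
  by rewrite DdZ.
apply: Ck1_intro => [t /H[]//|v t dt].
have nd : \forall s \near t, dom X c (sigma (k * s + m)).
  have cc : {for t, continuous (fun s => sigma (k * s + m))}.
    by apply: continuous_comp; [exact: ca|exact: cs].
  by apply: cc; exact: dom_nbhs.
have : {for t, continuous (fun s => (v * k) *: Dd (chart X c \o sigma) (k * s + m) 1)}.
  apply: continuousZr.
  apply: (@continuous_comp _ _ _ (fun s : R => k * s + m)
    (fun z : R => Dd (chart X c \o sigma) z (1 : R))); first exact: ca.
  by have /= := d2 1; apply.
rewrite /prop_for /continuous_at (H t dt).2.
by apply: cvg_trans; apply: near_eq_cvg; apply: filterS nd => s ds; rewrite (H s ds).2.
Qed.

(** The parameter interval is arbitrary, possibly a point: reflexivity is then trivial and
    concatenation needs no rescaling. *)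
Definition reach x y := exists a b gamma,
  [/\ a <= b, piecewise_C1 X a b gamma, gamma a = x & gamma b = y].

Lemma reach_step x y sigma : reach x y -> C1_curve X sigma -> sigma 0 = y ->
  exists a b gamma, [/\ a < b, piecewise_C1 X a b gamma, gamma a = x & gamma b = sigma 1].
Proof.
move=> [a [b [gamma [ab [s [[ps /eqP ls] H]] ga gb]]]] C1 s0.
pose delta t := if t <= b then gamma t else sigma (t - b).
exists a, (b + 1), delta; split.
- by lra.
- exists (rcons s (b + 1)); split.
    by split; rewrite ?rcons_path ?last_rcons// ps ls/=; lra.
  move=> u /zip_rcons_mem[us|->]; last first.
    exists (fun t => sigma (1 * t + (- b))); split; first exact: C1_curve_affine.
    rewrite /= ls => r /andP[br rb]; rewrite mul1r /delta; case: ifPn => // rb'.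
    have -> : r = b by apply/le_anti; rewrite rb' br.
    by rewrite subrr s0.
  have [eta [C1' Heta]] := H u us; exists eta; split=> // r /andP[h1 h2].
  have := zip_le_last ps us; rewrite ls => h3.
  by rewrite /delta (le_trans h2 h3); apply: Heta; rewrite h1.
- by rewrite /delta ab.
- by rewrite /delta leNgt ltrDl ltr01/= addrC addKr.
Qed.

Lemma reach_path x y : reach x y -> exists gamma, path_of X gamma x y.
Proof.
move=> rxy.
(* A last step from [y] to itself makes the parameter interval nondegenerate, as the rescaling to
   [[0, 1]] divides by its length. *)
have [r [C [r0 C0 rV Hr]]] := dist_upper g (mem_dom X y).
have yr : `|chart X y y - chart X y y| < r by rewrite subrr normr0.
have [[sigma C1 [s0 s1]] _] := Hr y y (mem_dom X y) (mem_dom X y) yr yr.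
have [a [b [gamma [ab [s [[ps /eqP ls] H]] ga gb]]]] := reach_step rxy C1 s0.
pose k := b - a; have k0 : 0 < k by rewrite subr_gt0.
pose f u := (u - a) / k.
exists (fun t => gamma (k * t + a)); split; last 2 first.
- by rewrite mulr0 add0r.
- by rewrite mulr1 subrK gb s1.
have f0 : f a = 0 by rewrite /f subrr mul0r.
exists (map f s); split.
  split; last by rewrite -f0 last_map ls /f -/k divff// gt_eqF.
  rewrite -f0 path_map; apply: sub_path ps => u v uv /=.
  by rewrite /f ltr_pM2r ?invr_gt0// ltrD2r.
move=> u; rewrite -{1}f0 zip_map2 => /mapP[w ws ->].
have [eta [C1' Heta]] := H w ws.
exists (fun t => eta (k * t + a)); split; first exact: C1_curve_affine.
move=> t /=; rewrite /f ler_pdivrMr// ler_pdivlMr// => /andP[h1 h2].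
by apply: Heta; apply/andP; split; lra.
Qed.

(** The set of points reachable from [x] is open and closed, by the curves of [dist_upper]. Hence
    the infimum in [dist] runs over a nonempty set and can be bounded from below; over the empty set
    it would be 0 by convention. *)
Lemma path_exists (M_connected : connected [set: M]) x y : exists gamma, path_of X gamma x y.
Proof.
apply: reach_path.
have step z : \forall w \near z, (reach x z -> reach x w) /\ (reach x w -> reach x z).
  have [r [C [r0 C0 rV Hr]]] := dist_upper g (mem_dom X z).
  near=> w.
  have dw : dom X z w by near: w; apply: dom_nbhs; exact: mem_dom.
  have wr : `|chart X z w - chart X z z| < r.
    near: w; apply: (@chart_nbhs _ _ _ X z z (fun q => `|q - chart X z z| < r) (mem_dom X z)).
    apply/nbhs_ballP; exists r => // q; rewrite -ball_normE/= => qr.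
    by rewrite distrC.
  have zr : `|chart X z z - chart X z z| < r by rewrite subrr normr0.
  split=> rx.
    have [[sigma C1 [s0 s1]] _] := Hr z w (mem_dom X z) dw zr wr.
    have [a [b [gamma [/ltW ab p ga gb]]]] := reach_step rx C1 s0.
    by exists a, b, gamma; rewrite -s1.
  have [[sigma C1 [s0 s1]] _] := Hr w z dw (mem_dom X z) wr zr.
  have [a [b [gamma [/ltW ab p ga gb]]]] := reach_step rx C1 s0.
  by exists a, b, gamma; rewrite -s1.
have oA : open [set z | reach x z].
  rewrite openE => z /= xz; rewrite /interior; apply: filterS (step z) => w [h _]; exact: h.
have cA : closed [set z | reach x z].
  rewrite -openC openE => z /= xz; rewrite /interior.
  by apply: filterS (step z) => w [_ h] /= /h.
have E1 : [set z | reach x z] = [set: M].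
  apply: M_connected.
  - exists x; exists 0, 0, (fun=> x); split=> //; exists [::]; split=> //.
  - by exists [set z | reach x z] => //; rewrite setTI.
  - by exists [set z | reach x z] => //; rewrite setTI.
have : [set z | reach x z] y by rewrite E1.
by [].
Unshelve. all: by end_near.
Qed.

End PathConnected.

(** * Lower bounds for the distance *)

Section DistLower.
Variables (R : realType) (n : nat) (M : topologicalType).
Variables (X : smooth_structure R n M) (g : riemannian_metric X).
Hypotheses (M_hausdorff : hausdorff_space M) (M_connected : connected [set: M]).
Local Notation E := 'rV[R]_n.
Implicit Types (c x y z : M) (q : E).

Definition in_ball c q (r : R) : set M := [set y | dom X c y /\ `|chart X c y - q| <= r].

(* The chart distance to q, truncated at r and extended by r outside the chart, is Lipschitz
   for [dist] on the whole of M: a short curve starting near q cannot leave the chart. *)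
Definition cutdist c q (r : R) (y : M) : R :=
  if `[< in_ball c q r y >] then `|chart X c y - q| else r.

Lemma closed_ball_compact q (r : R) : compact [set z : E | `|z - q| <= r].
Proof.
apply: bounded_closed_compact.
  exists (`|q| + r); split; first exact: num_real.
  move=> s rs z /= zq; apply: le_trans (ltW rs).
  by rewrite -[z](subrK q); apply: le_trans (ler_normD _ _) _; rewrite addrC lerD2l.
have -> : [set z : E | `|z - q| <= r] = (fun z : E => `|z - q|) @^-1` [set s | s <= r] by [].
apply: closed_comp; last exact: closed_le.
move=> z _; apply: continuous_comp; last exact: norm_continuous.
by apply: continuousB; [move=> ?; exact|exact: cst_continuous].
Qed.

(** The image under [param] of a compact ball is compact, hence closed in a Hausdorff space. So a
    point outside has a neighbourhood where [cutdist] is constant. *)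
Lemma in_ball_closed c q (r : R) :
  (forall z : E, `|z - q| <= r -> (chart X c @` dom X c) z) -> closed (in_ball c q r).
Proof.
move=> H; apply: compact_closed => //.
have -> : in_ball c q r = param X c @` [set z : E | `|z - q| <= r].
  apply/seteqP; split=> [y [dy yr]|y [z zr <-]].
    by exists (chart X c y) => //; rewrite chartK.
  by have [h1 h2] := image_param (H _ zr); split=> //; rewrite h2.
apply: continuous_compact; last exact: closed_ball_compact.
apply: continuous_in_subspaceT => z /set_mem zr.
by apply: param_continuous; exact: H.
Qed.

Lemma cutdist_dom c q r y : dom X c y -> cutdist c q r y = Num.min r `|chart X c y - q|.
Proof.
move=> dy; rewrite /cutdist; case: asboolP => [[_ h]|h]; first by rewrite min_r.
by rewrite min_l// leNgt; apply/negP => h1; apply: h; split=> //; exact: ltW.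
Qed.

Lemma min_dist (r s t : R) : `|Num.min r s - Num.min r t| <= `|s - t|.
Proof.
rewrite /Num.min; case: (ltP r s) => h1; case: (ltP r t) => h2.
- by rewrite subrr normr0.
- by rewrite !ger0_norm ?subr_ge0 ?(ltW h1)//; lra.
- by rewrite [in leLHS]distrC [in leRHS]distrC !ger0_norm ?subr_ge0//; lra.
- by [].
Qed.

Lemma cutdist_near_out c q r y : closed (in_ball c q r) -> ~ in_ball c q r y ->
  \forall z \near y, cutdist c q r z = r.
Proof.
rewrite -openC => oA nA.
have : nbhs y (~` in_ball c q r) by apply: open_nbhs_nbhs.
by apply: filterS => z /= hz; rewrite /cutdist; case: asboolP.
Qed.

Lemma cutdist_out c q r y : ~ in_ball c q r y -> cutdist c q r y = r.
Proof. by move=> h; rewrite /cutdist; case: asboolP. Qed.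

Lemma cutdist_continuous c q (r : R) :
  (forall z : E, `|z - q| <= r -> (chart X c @` dom X c) z) -> continuous (cutdist c q r).
Proof.
move=> H y; have cA := in_ball_closed H.
have [[dy yr]|nA] := pselect (in_ball c q r y); last first.
  apply/cvgrPdist_le => e e0; apply: filterS (cutdist_near_out cA nA) => z ->.
  by rewrite cutdist_out// subrr normr0 ltW.
apply/cvgrPdist_le => e e0.
have h1 : \forall z \near y, `|chart X c y - chart X c z| <= e.
  apply: (@chart_nbhs _ _ _ X c y (fun p => `|chart X c y - p| <= e) dy).
  apply/nbhs_ballP; exists e => // p; rewrite -ball_normE/= => h; exact: ltW.
apply: filterS2 (dom_nbhs dy) h1 => z dz hz.
rewrite !cutdist_dom//; apply: le_trans (min_dist _ _ _) _.
apply: le_trans (ler_dist_dist _ _) _; apply: le_trans hz.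
by rewrite opprB addrA subrK.
Qed.

(** Outside the chart ball [cutdist] is locally constant. Inside, it varies at most as fast as the
    coordinates, whose velocity is at most [a^-1] times the speed. *)
Lemma cutdist_speed_lipschitz c q (r a : R) : 0 < a ->
  (forall z : E, `|z - q| <= r -> (chart X c @` dom X c) z) ->
  (forall z w : E, `|z - q| <= r -> a * `|w| <= Num.sqrt (qform (metric_coef g c z) w)) ->
  speed_lipschitz g a^-1 (cutdist c q r).
Proof.
move=> a0 H Ha eta C1 t e e0; have cA := in_ball_closed H.
have ai : 0 <= a^-1 by rewrite invr_ge0 ltW.
have [[dt tr]|nA] := pselect (in_ball c q r (eta t)); last first.
  have /nbhs_ballP[d /= d0 Hd] : \forall s \near t, cutdist c q r (eta s) = r.
    exact: (C1.1 t _ (cutdist_near_out cA nA)).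
  exists d => // h /andP[h0 hd]; rewrite Hd; last first.
    by rewrite -ball_normE/= opprD addNKr normrN gtr0_norm.
  rewrite cutdist_out// subrr normr0 mulr_ge0 ?(ltW h0)// addr_ge0 ?(ltW e0)//.
  by rewrite mulr_ge0// speed_ge0.
have dg := C1_curve_derive C1 dt.
have [d d0 Hd] := (is_deriveP _ _ _).1 dg _ e0.
have /nbhs_ballP[d' /= d'0 Hd'] : \forall s \near t, dom X c (eta s).
  exact: (C1.1 t _ (dom_nbhs dt)).
exists (Num.min d d'); first by rewrite lt_min d0.
move=> h /andP[h0]; rewrite lt_min => /andP[h1 h2].
have dth : dom X c (eta (t + h)).
  by apply: Hd'; rewrite -ball_normE/= opprD addNKr normrN gtr0_norm.
rewrite !cutdist_dom//; apply: le_trans (min_dist _ _ _) _.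
apply: le_trans (ler_dist_dist _ _) _; rewrite opprB addrA subrK.
have := Hd h; rewrite gtr0_norm// => /(_ h1) H1.
have sE := speed_chart g (C1.1 t) dt dg.
have := Ha _ (Dd (chart X c \o eta) t 1) tr; rewrite -sE => H2.
rewrite -[X in `|X|](subrK (h *: Dd (chart X c \o eta) t 1)).
apply: le_trans (ler_normD _ _) _; rewrite [leRHS]mulrDl [leRHS]addrC; apply: lerD => //.
by rewrite normrZ gtr0_norm// mulrC ler_wpM2r ?(ltW h0)// ler_pdivlMl.
Qed.

Lemma cutdist_dist c q (r a : R) : 0 < a ->
  (forall z : E, `|z - q| <= r -> (chart X c @` dom X c) z) ->
  (forall z w : E, `|z - q| <= r -> a * `|w| <= Num.sqrt (qform (metric_coef g c z) w)) ->
  forall y z, `|cutdist c q r z - cutdist c q r y| <= a^-1 * dist g y z.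
Proof.
move=> a0 H Ha y z; rewrite -ler_pdivrMl ?invr_gt0// invrK.
have [ga p] := path_exists g M_connected y z.
apply: lb_le_inf; first by exists (curve_length g ga), ga.
move=> _ [ga' p' <-]; rewrite -ler_pdivlMl//.
apply: (path_variation (g := g) (C := a^-1) (f := cutdist c q r)) => //.
- exact: cutdist_continuous.
- exact: cutdist_speed_lipschitz.
- by rewrite invr_ge0 ltW.
Qed.

(** If [D] is small, the cutoff distance of [z] from [y] is below the cutoff value, so that [z] lies
    in the chart. The bound of [cutdist_dist] is in absolute value and serves both orders of the
    arguments of [dist]. *)
Lemma dist_chart c x0 : dom X c x0 -> exists r C : R, [/\ 0 < r, 0 < C,
  (forall q, `|q - chart X c x0| < r -> (chart X c @` dom X c) q) &
  forall y z (D : R), dom X c y -> `|chart X c y - chart X c x0| < r ->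
    dist g y z <= D \/ dist g z y <= D -> D < r ->
    dom X c z /\ `|chart X c z - chart X c y| <= C * D].
Proof.
move=> d0; have [r0 [a [b [r00 a0 b0 rV Hab]]]] := tnorm_bounds g d0.
(* A ball of radius [r1] centred within [r <= r1] of [x0] stays in the ball of radius [r0]; the
   condition [r <= r1 * a] gives [a^-1 * D < r1]. *)
pose r1 := r0 / 3; have r10 : 0 < r1 by rewrite divr_gt0.
pose r := Num.min r1 (r1 * a).
have rr1 : r <= r1 by rewrite /r ge_min lexx.
have rra : r <= r1 * a by rewrite /r ge_min lexx orbT.
exists r, a^-1; split.
- by rewrite /r lt_min r10 mulr_gt0.
- by rewrite invr_gt0.
- by move=> q qr; apply: rV; apply: lt_le_trans qr _; rewrite /r1 in rr1; lra.
move=> y z D dy yr hD Dr.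
have Hz (p : E) : `|p - chart X c y| <= r1 -> `|p - chart X c x0| < r0.
  move=> h; rewrite -[p](subrK (chart X c y)) -addrA.
  apply: le_lt_trans (ler_normD _ _) _; rewrite /r1 in h rr1; lra.
have h1 (p : E) : `|p - chart X c y| <= r1 -> (chart X c @` dom X c) p by move=> /Hz/rV.
have h2 (p w : E) : `|p - chart X c y| <= r1 -> a * `|w| <= Num.sqrt (qform (metric_coef g c p) w).
  by move=> /Hz h; have /andP[] := Hab p w h.
have fy : cutdist c (chart X c y) r1 y = 0.
  by rewrite cutdist_dom// subrr normr0 min_r// ltW.
have h3 : cutdist c (chart X c y) r1 z <= a^-1 * D.
  have ai : 0 <= a^-1 by rewrite invr_ge0 ltW.
  case: hD => h; apply: le_trans (ler_wpM2l ai h).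
    by have := cutdist_dist a0 h1 h2 y z; rewrite fy subr0; apply: le_trans; exact: ler_norm.
  have := cutdist_dist a0 h1 h2 z y; rewrite fy sub0r normrN; apply: le_trans; exact: ler_norm.
have h4 : a^-1 * D < r1.
  by rewrite mulrC ltr_pdivrMr//; apply: lt_le_trans Dr rra.
have [[dz zr]|nz] := pselect (in_ball c (chart X c y) r1 z); last first.
  by move: h3; rewrite cutdist_out// leNgt h4.
by split=> //; move: h3; rewrite cutdist_dom// min_r.
Qed.

End DistLower.

(** * Calculus of vector-valued maps *)

Section VectorValuedCalculus.
Variable R : realType.

Lemma differentiable_idfun (V : normedModType R) (x : V) : differentiable (fun y : V => y) x.
Proof. by have [] := is_diff_id x. Qed.

Lemma Dd_pair (U V W : normedModType R) (f : U -> V) (h : U -> W) x v :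
  differentiable f x -> differentiable h x ->
  Dd (fun y => (f y, h y)) x v = (Dd f x v, Dd h x v).
Proof. by move=> df dh; rewrite -!DdE (diff_pair df dh). Qed.

(** Linearity is given by two equations, since the maps concerned, [pairing p] and [cc c c' x], are
    plain functions. *)
Lemma lin_diff n (W : normedModType R) (L : 'rV[R]_n -> W) x :
  (forall v w, L (v + w) = L v + L w) -> (forall (a : R) v, L (a *: v) = a *: L v) ->
  differentiable L x /\ forall v, Dd L x v = L v.
Proof.
move=> LD LZ.
have L0 : L 0 = 0 by have := LZ 0 0; rewrite !scale0r.
have Lsum v : L v = \sum_i v 0 i *: L (delta_mx 0 i).
  rewrite {1}[v]rv_sum_delta; elim/big_ind2 : _ => //; first by move=> a b c d <- <-.
have dL : differentiable L x.
  have -> : L = \sum_(i < n) (fun v : 'rV[R]_n => v 0 i *: L (delta_mx 0 i)).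
    by apply/funext => v; rewrite fct_sumE Lsum.
  apply: differentiable_sum => i; apply: differentiableZl.
  by have [] := diff_coord i (differentiable_idfun x).
split=> // v; rewrite -DdE -deriveE//.
have dL' : differentiable L (x + (0 : R) *: v) by rewrite scale0r addr0.
have h1 := is_derive_line dL'.
have : is_derive (0 : R) 1 (fun s : R => L (x + s *: v)) (L v).
  apply/is_deriveP => e e0; exists 1 => // h _.
  by rewrite add0r scale0r addr0 LD LZ [L x + _]addrC addrK subrr normr0 mulr_ge0// ltW.
case=> _; case: h1 => _ -> <-; rewrite scale0r addr0 deriveE//.
Qed.

Lemma differentiable_rV n (V : normedModType R) (f : V -> 'rV[R]_n) x :
  (forall i, differentiable (fun y => f y 0 i) x) -> differentiable f x.
Proof.
move=> H; have -> : f = \sum_(i < n) (fun y => f y 0 i *: (delta_mx 0 i : 'rV[R]_n)).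
  apply/funext => y; rewrite fct_sumE [LHS]rv_sum_delta.
  by apply: eq_bigr.
by apply: differentiable_sum => i; apply: differentiableZl; exact: H.
Qed.

Lemma Ck_congr (V W : normedModType R) k (U : set V) (f g : V -> W) : open U ->
  (forall x, U x -> f x = g x) -> Ck k U f -> Ck k U g.
Proof.
move=> oU; elim: k f g => [|k IH] f g fg.
  move=> cf x Ux; have nU : nbhs x U by apply: open_nbhs_nbhs.
  rewrite /prop_for /continuous_at -fg//; have := cf x Ux.
  by apply: cvg_trans; apply: near_eq_cvg; apply: filterS nU => y /fg.
move=> /=[d1 d2].
have H x : U x -> differentiable g x /\ forall v, 'd g x v = 'd f x v.
  move=> Ux; apply: near_eq_diff; last exact: d1.
  have nU : nbhs x U by apply: open_nbhs_nbhs.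
  by apply: filterS nU => y /fg.
split=> [x /H[]//|v]; apply: IH (d2 v) => x Ux.
by rewrite (H x Ux).2.
Qed.

Lemma Ck_coord n (V : normedModType R) k (U : set V) (f : V -> 'rV[R]_n) i : open U ->
  Ck k U f -> Ck k U (fun y => f y 0 i).
Proof.
move=> oU; elim: k f => [|k IH] f.
  move=> cf x Ux; apply: (@continuous_comp _ _ _ f (fun z : 'rV[R]_n => z 0 i)).
    exact: cf.
  exact: coord_continuous.
move=> /=[d1 d2]; split=> [x Ux|v]; first by have [] := diff_coord i (d1 x Ux).
apply: (Ck_congr oU _ (IH _ (d2 v))) => x Ux.
by have [_ ->] := diff_coord i (d1 x Ux).
Qed.

Lemma Dd_sym_vec n (V : normedModType R) (f : V -> 'rV[R]_n) (U : set V) x v w :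
  open U -> U x -> Ck 2 U f ->
  Dd (fun y => Dd f y v) x w = Dd (fun y => Dd f y w) x v.
Proof.
move=> oU Ux c2; have nU : nbhs x U by apply: open_nbhs_nbhs.
have [d1 d2] := Ck_diffE c2.
apply/rowP => i.
have H u z : Dd (fun y => Dd f y u) x z 0 i = Dd (fun y => Dd (fun y => f y 0 i) y u) x z.
  have [du _] := Ck_diffE (d2 u).
  have [h1 <-] := Dd_coord i (du x Ux).
  have [_ h2] : differentiable (fun y => Dd (fun y => f y 0 i) y u) x /\
     forall v, Dd (fun y => Dd (fun y => f y 0 i) y u) x v = Dd (fun y => Dd f y u 0 i) x v.
    apply: near_eq_Dd h1; apply: filterS nU => y Uy.
    by have [_ ->] := Dd_coord i (d1 y Uy).
  by rewrite h2.
by rewrite !H (Dd_sym v w nU (Ck_coord i oU c2)).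
Qed.

Lemma is_derive_pairing n (f h : R -> 'rV[R]_n) (t : R) v w :
  is_derive t 1 f v -> is_derive t 1 h w ->
  is_derive t 1 (fun s => pairing (f s) (h s)) (pairing v (h t) + pairing (f t) w).
Proof.
move=> /is_derive_coord df /is_derive_coord dh.
have -> : (fun s => pairing (f s) (h s)) = \sum_(i < n) (fun s => f s 0 i * h s 0 i).
  by apply/funext => s; rewrite fct_sumE.
rewrite /pairing -big_split/=; apply: is_derive_sum => i.
apply: is_derive_eq (is_deriveM (df i) (dh i)) _.
by rewrite addrC; congr (_ + _); exact: mulrC.
Qed.

Lemma Dd_pairing n (V : normedModType R) (p : 'rV[R]_n) (f : V -> 'rV[R]_n) x :
  differentiable f x -> differentiable (fun y => pairing p (f y)) x /\
  forall v, Dd (fun y => pairing p (f y)) x v = pairing p (Dd f x v).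
Proof.
move=> df; have [d1 d2] := lin_diff (L := pairing p) (f x) (pairingDr p) (pairingZr p).
split=> [|v]; first exact: (differentiable_comp df d1).
by rewrite -d2; exact: (Dd_comp v df d1).
Qed.

End VectorValuedCalculus.

(** * The Hamiltonian flow in charts *)

Section Flow.
Variables (R : realType) (n : nat) (M : topologicalType).
Variables (X : smooth_structure R n M) (g : riemannian_metric X).
Local Notation E := 'rV[R]_n.
Variable H : M -> E -> R.
Hypothesis H_tonelli : tonelli g H.
Variable Phi : R -> M * E -> M * E.
Hypothesis Phi_flow : hamiltonian_flow X H Phi.
Implicit Types (c x : M) (q p : E) (s t : R).

Lemma ccD c c' x p p' : cc X c c' x (p + p') = cc X c c' x p + cc X c c' x p'.
Proof. by apply: pairing_inj => v; rewrite pairing_cc !pairingDl !pairing_cc. Qed.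

Lemma ccZ c c' x (a : R) p : cc X c c' x (a *: p) = a *: cc X c c' x p.
Proof. by apply: pairing_inj => v; rewrite pairing_cc !pairingZl pairing_cc. Qed.

Fact Hl_sig : {f : M -> E * E -> R | f = localH X H}.
Proof. by exists (localH X H). Qed.
Definition Hl c (z : E * E) : R := sval Hl_sig c z.

Lemma HlE c z : localH X H c z = Hl c z.
Proof. by rewrite /Hl (svalP Hl_sig). Qed.

Lemma Hl_chart c x p : dom X c x -> Hl c (chart X c x, p) = H x (cc X c x x p).
Proof. by move=> d; rewrite -HlE /localH/= chartK// ccE. Qed.

Lemma H_chart c x p : dom X c x -> H x p = Hl c (chart X c x, cc X x c x p).
Proof.
by move=> d; rewrite Hl_chart// cc_comp ?cc_id//; exact: mem_dom.
Qed.

Lemma Hl_change c c' x p : dom X c x -> dom X c' x ->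
  Hl c (chart X c x, p) = Hl c' (chart X c' x, cc X c c' x p).
Proof.
by move=> d d'; rewrite !Hl_chart// cc_comp//; exact: mem_dom.
Qed.

Lemma Hl_Ck c : Ck 2 ((chart X c @` dom X c) `*` [set: E]) (Hl c).
Proof.
have [h _ _] := H_tonelli; have := h c.
by rewrite (_ : localH X H c = Hl c)//; apply/funext => z; rewrite HlE.
Qed.

Lemma Hl_diff c q p : (chart X c @` dom X c) q -> differentiable (Hl c) (q, p).
Proof. by move=> Vq; have [h _] := Hl_Ck c; apply: h. Qed.

Definition Hdp c (z : E * E) : E := gr (fun p' => Hl c (z.1, p')) z.2.
Definition Hdq c (z : E * E) : E := gr (fun q' => Hl c (q', z.2)) z.1.

Lemma pairing_Hdp c q p v : (chart X c @` dom X c) q ->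
  pairing (Hdp c (q, p)) v = Dd (Hl c) (q, p) (0, v).
Proof. by move=> Vq; rewrite pairing_gr; have [_ ->] := Dd_partial_snd (Hl_diff p Vq). Qed.

Lemma pairing_Hdq c q p v : (chart X c @` dom X c) q ->
  pairing (Hdq c (q, p)) v = Dd (Hl c) (q, p) (v, 0).
Proof. by move=> Vq; rewrite pairing_gr; have [_ ->] := Dd_partial_fst (Hl_diff p Vq). Qed.

Lemma Dd_Hl c q p v w : (chart X c @` dom X c) q ->
  Dd (Hl c) (q, p) (v, w) = pairing (Hdq c (q, p)) v + pairing (Hdp c (q, p)) w.
Proof. by move=> Vq; rewrite (Dd_prod _ _ (Hl_diff p Vq)) !pairing_gr. Qed.

(** The identity [Hl_change] differentiated in the momentum: [H_p] transforms as a tangent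
    vector. *)
Lemma Hdp_change c c' x p : dom X c x -> dom X c' x ->
  tc X c c' x (Hdp c (chart X c x, p)) = Hdp c' (chart X c' x, cc X c c' x p).
Proof.
move=> d d'.
have Vq : (chart X c @` dom X c) (chart X c x) by exists x.
have Vq' : (chart X c' @` dom X c') (chart X c' x) by exists x.
apply: pairing_inj => e; rewrite pairingC.
have [lp1 lp2] := lin_diff (L := cc X c' c x) (cc X c c' x p) (ccD c' c x) (ccZ c' c x).
have E1 : (fun p' => Hl c' (chart X c' x, p')) =
          (fun p' => Hl c (chart X c x, cc X c' c x p')).
  by apply/funext => p'; rewrite (Hl_change p' d' d).
have [dp _] := Dd_partial_snd (Hl_diff p Vq).
have Ep : cc X c' c x (cc X c c' x p) = p by rewrite cc_comp// cc_id.
rewrite [RHS]pairing_gr/= E1.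
have dp' : differentiable (fun p0 => Hl c (chart X c x, p0)) (cc X c' c x (cc X c c' x p)).
  by rewrite Ep.
rewrite (Dd_comp e lp1 dp') lp2 Ep -pairing_gr -/(Hdp c (_, _)).
by rewrite [RHS]pairingC pairing_cc.
Qed.

(** The canonical coordinates of the cotangent bundle over the chart [c]; [z.2] itself refers to the
    chart centred at [z.1]. *)
Definition loc c (z : M * E) : E * E := (chart X c z.1, cc X z.1 c z.1 z.2).

Lemma loc_energy c z : dom X c z.1 -> H z.1 z.2 = Hl c (loc c z).
Proof. by move=> d; rewrite (H_chart z.2 d). Qed.

(** Unlike [H_p], the derivative [H_q] is not a tensor: the canonical change of coordinates contains
    the differential of the transition [S], so a term with the second derivative of [S] appears. *)
Lemma Hdq_change c b x p v : dom X c x -> dom X b x ->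
  pairing (Hdq b (chart X b x, cc X c b x p)) (tc X c b x v) =
  pairing (Hdq c (chart X c x, p)) v +
  pairing (cc X c b x p)
    (Dd (fun y => Dd (chart X b \o param X c) y v) (chart X c x) (Hdp c (chart X c x, p))).
Proof.
move=> d d'; set S := chart X b \o param X c; set q := chart X c x; set pb := cc X c b x p.
have Vq : (chart X c @` dom X c) q by exists x.
have Vq' : (chart X b @` dom X b) (S q) by exists x => //; rewrite /S/= chartK.
have Sq : S q = chart X b x by rewrite /S/= chartK.
have dS := transition_diff d d' : differentiable S q.
pose U := chart X c @` (dom X c `&` dom X b).
have oU : open U.
  rewrite openE => _ [y [dy dy'] <-]; exact: (image_nbhs dy (dom_nbhs dy')).
have Uq : U q by exists x.
have C2 : Ck 2 U S := smooth_transition X c b 2.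
have [_ C1] := Ck_diffE C2.
(* The covector field in the chart [c] that is constantly [pb] in the chart [b]. Differentiating the
   equality of [Hl b (S y, pb)] and [Hl c (y, N y)] gives the formula, after exchanging the order of
   the two derivatives of [S]. *)
pose N y : E := \row_i pairing pb (Dd S y (delta_mx 0 i)).
have NE y w : U y -> pairing (N y) w = pairing pb (Dd S y w).
  move=> Uy; rewrite [Dd S y w]Dd_delta pairing_sumr; apply: eq_bigr => i _.
  by rewrite mxE pairingZr mulrC.
have dD w : differentiable (fun y => Dd S y w) q.
  by have [h _] := Ck_diffE (C1 w); exact: h.
have dN : differentiable N q.
  apply: differentiable_rV => i.
  rewrite (_ : (fun y => N y 0 i) = fun y => pairing pb (Dd S y (delta_mx 0 i))).
    by have [] := Dd_pairing pb (dD (delta_mx 0 i)).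
  by apply/funext => y; rewrite mxE.
have DN u w : pairing (Dd N q u) w = pairing pb (Dd (fun y => Dd S y w) q u).
  rewrite -(Dd_pairing pb (dD w)).2 pairingC -(Dd_pairing w dN).2.
  have nU : nbhs q U by apply: open_nbhs_nbhs.
  have h : \forall y \near q, pairing w (N y) = pairing pb (Dd S y w).
    by apply: filterS nU => y Uy; rewrite pairingC NE.
  by rewrite (near_eq_Dd h (Dd_pairing w dN).1).2.
have Nq : N q = p.
  apply: pairing_inj => w; rewrite NE// -tcdE pairing_cc tc_comp// tc_id//.
pose F y := Hl b (S y, pb); pose G y := Hl c (y, N y).
have dHb : differentiable (fun y => Hl b (y, pb)) (S q).
  by have [] := Dd_partial_fst (Hl_diff pb Vq').
have dF : differentiable F q by exact: (differentiable_comp dS dHb).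
have DF : Dd F q v = pairing (Hdq b (chart X b x, pb)) (tc X c b x v).
  by rewrite (Dd_comp v dS dHb) /Hdq pairing_gr/= -Sq tcdE.
have FG : \forall y \near q, F y = G y.
  have nU : nbhs q U by apply: open_nbhs_nbhs.
  apply: filterS nU => y Uy; have [m [dm dm'] my] := Uy.
  rewrite /F /G -my {1}/S/= chartK// (Hl_change _ dm' dm); congr (Hl c (_, _)).
  apply: pairing_inj => w; rewrite my NE// pairing_cc tcdE -my//.
have := (near_eq_Dd FG dF).2 v; rewrite DF => <-.
have dI : differentiable (fun y : E => y) q by exact: differentiable_idfun.
have dP : differentiable (fun y => (y, N y)) q by exact: (differentiable_pair dI dN).
have dHc : differentiable (Hl c) ((fun y => (y, N y)) q) by exact: Hl_diff.
rewrite (Dd_comp v dP dHc) (Dd_pair v dI dN) (Dd_id q v) Dd_Hl// Nq; congr (_ + _).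
rewrite pairingC DN; congr (pairing _ _); exact: Dd_sym_vec C2.
Qed.

(** Hamilton's equations are given only in the chart centred at the current point. In a fixed chart,
    the term of [Hdq_change] with second derivatives cancels against the derivative of the
    differential of [S] along the curve: canonical changes of coordinates preserve the form of the
    equations. *)
Lemma flow_chart z s c : dom X c (Phi s z).1 ->
  is_derive s 1 (fun r => (loc c (Phi r z)).1) (Hdp c (loc c (Phi s z))) /\
  is_derive s 1 (fun r => (loc c (Phi r z)).2) (- Hdq c (loc c (Phi s z))).
Proof.
move=> d; have [_ /(_ s)/= [cx dq dp]] := Phi_flow z.
set b := (Phi s z).1 in d cx dq dp *.
have db : dom X b b := mem_dom X b.
have E1 : grad (fun p' => localH X H b (chart X b b, p')) (Phi s z).2 =
    Hdp b (chart X b b, (Phi s z).2).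
  rewrite grE /Hdp/=; congr (gr _ _); by apply/funext => p'; rewrite HlE.
have E2 : grad (fun q' => localH X H b (q', (Phi s z).2)) (chart X b b) =
    Hdq b (chart X b b, (Phi s z).2).
  rewrite grE /Hdq/=; congr (gr _ _); by apply/funext => p'; rewrite HlE.
rewrite E1 in dq; rewrite E2 in dp.
have D1 : is_derive s 1 (fun r => (loc c (Phi r z)).1) (Hdp c (loc c (Phi s z))).
  have := is_derive_change_chart (gamma := fun r => (Phi r z).1) cx db d dq.
  by rewrite -/b (Hdp_change _ db d).
split=> //; apply/is_derive_coord => i.
set S := chart X b \o param X c; set e := delta_mx 0 i : E.
have nd : \forall r \near s, dom X c (Phi r z).1 /\ dom X b (Phi r z).1.
  have nU : nbhs b [set y | dom X c y /\ dom X b y].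
    by apply: filterS2 (dom_nbhs d) (dom_nbhs db) => y.
  exact: (cx _ nU).
have nE : \forall r \near s,
    pairing (cc X (Phi r z).1 b (Phi r z).1 (Phi r z).2) (Dd S (loc c (Phi r z)).1 e) =
    (loc c (Phi r z)).2 0 i.
  apply: filterS nd => r [d1 d2]; rewrite -[RHS]pairing_delta -/e /loc/=.
  rewrite -tcdE -pairing_cc cc_comp//; exact: mem_dom.
apply: (near_eq_is_derive nE).
have C2 : Ck 2 (chart X c @` (dom X c `&` dom X b)) S := smooth_transition X c b 2.
have [_ C1] := Ck_diffE C2.
have dD : differentiable (fun y => Dd S y e) (loc c (Phi s z)).1.
  by have [h _] := Ck_diffE (C1 e); apply: h; exists b.
have D2 := is_derive_Dd_comp (g := fun r => (loc c (Phi r z)).1) dD D1.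
have dp' : is_derive s 1 (fun r => cc X (Phi r z).1 b (Phi r z).1 (Phi r z).2)
  (- Hdq b (chart X b b, (Phi s z).2)).
  have := dp; rewrite (_ : (fun r => cotangent_change _ _ _ _ _) =
    (fun r => cc X (Phi r z).1 b (Phi r z).1 (Phi r z).2))//.
  by apply/funext => r; rewrite ccE.
apply: is_derive_eq (is_derive_pairing dp' D2) _.
have := Hdq_change (cc X b c b (Phi s z).2) e d db.
rewrite cc_comp// cc_id// -/S => h.
have L : loc c (Phi s z) = (chart X c b, cc X b c b (Phi s z).2) by [].
rewrite L/= pairingNl -[Dd S (chart X c b) e]tcdE h.
by rewrite opprD subrK -[RHS]pairing_delta pairingNl.
Qed.

Lemma flow_energy z s : H (Phi s z).1 (Phi s z).2 = H z.1 z.2.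
Proof.
have D t : is_derive t 1 (fun r => H (Phi r z).1 (Phi r z).2) 0.
  set c := (Phi t z).1; have d : dom X c (Phi t z).1 := mem_dom X c.
  have [d1 d2] := flow_chart d.
  have [_ /(_ t)/= [cx _ _]] := Phi_flow z.
  have nE : \forall r \near t, Hl c ((loc c (Phi r z)).1, (loc c (Phi r z)).2) =
      H (Phi r z).1 (Phi r z).2.
    have : \forall r \near t, dom X c (Phi r z).1 by apply: cx; exact: dom_nbhs.
    by apply: filterS => r dr; rewrite (loc_energy dr); case: (loc _ _).
  apply: (near_eq_is_derive nE).
  have Vq : (chart X c @` dom X c) (loc c (Phi t z)).1 by exists c.
  apply: is_derive_eq (is_derive_Dd_comp (F := Hl c)
    (g := fun r => ((loc c (Phi r z)).1, (loc c (Phi r z)).2)) (Hl_diff _ Vq) (is_derive_pair d1 d2)) _.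
  rewrite Dd_Hl//; move: (loc c (Phi t z)) => -[q p]/=.
  by rewrite pairingNr pairingC subrr.
have := is_derive_0_is_cst s 0 D.
by have [-> _] := Phi_flow z.
Qed.

End Flow.

(** * Uniform constants on compact boxes of the cotangent bundle *)

Section BoxLipschitz.
Variables (R : realType) (n : nat).
Local Notation E := 'rV[R]_n.

Definition box (q : E) (r B : R) : set (E * E) := [set z | `|z.1 - q| <= r /\ `|z.2| <= B].

Lemma coordB (v w : E) i : (v - w) 0 i = v 0 i - w 0 i.
Proof. by rewrite !mxE. Qed.

Lemma prod_norm_le (V W : normedModType R) (v : V) (w : W) (C : R) :
  (`|(v, w)| <= C) = (`|v| <= C) && (`|w| <= C).
Proof. by rewrite prod_normE ge_max. Qed.

Lemma fst_norm_le (V W : normedModType R) (z : V * W) : `|z.1| <= `|z|.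
Proof. by case: z => v w; have := lexx `|(v, w)|; rewrite prod_norm_le => /andP[]. Qed.

Lemma snd_norm_le (V W : normedModType R) (z : V * W) : `|z.2| <= `|z|.
Proof. by case: z => v w; have := lexx `|(v, w)|; rewrite prod_norm_le => /andP[]. Qed.

Lemma closed_ball_convex (V : normedModType R) (q x y : V) (r s : R) :
  `|x - q| <= r -> `|y - q| <= r -> 0 <= s <= 1 -> `|x + s *: (y - x) - q| <= r.
Proof.
move=> xr yr /andP[s0 s1].
have -> : x + s *: (y - x) - q = (1 - s) *: (x - q) + s *: (y - q).
  have -> : y - x = (y - q) - (x - q) by rewrite opprB addrA subrK.
  by rewrite scalerBl scale1r scalerBr [LHS]addrAC -[RHS]addrA [- _ + _]addrC.
apply: le_trans (ler_normD _ _) _; rewrite !normrZ ger0_norm ?subr_ge0// ger0_norm//.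
have h1 : (1 - s) * `|x - q| <= (1 - s) * r by rewrite ler_wpM2l// subr_ge0.
have h2 : s * `|y - q| <= s * r by rewrite ler_wpM2l.
by apply: le_trans (lerD h1 h2) _; rewrite -mulrDl subrK mul1r.
Qed.

Definition finite_basis (V : normedModType R) m (e : 'I_m -> V) (l : 'I_m -> V -> R) :=
  (forall v, v = \sum_i l i v *: e i) /\ (forall i v, `|l i v| <= `|v|).

Lemma rv_basis m : finite_basis (fun i : 'I_m => delta_mx 0 i) (fun i (v : 'rV[R]_m) => v 0 i).
Proof. by split=> [v|i v]; [exact: rv_sum_delta|exact: coord_norm_le]. Qed.

Lemma line_basis : finite_basis (fun i : 'I_1 => 1 : R) (fun i (v : R) => v).
Proof. by split=> // v; rewrite big_ord1 /GRing.scale/= mulr1. Qed.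

Lemma prod_basis (V W : normedModType R) m1 m2 (e1 : 'I_m1 -> V) l1 (e2 : 'I_m2 -> W) l2 :
  finite_basis e1 l1 -> finite_basis e2 l2 ->
  exists (e : 'I_(m1 + m2) -> V * W) l, finite_basis e l.
Proof.
move=> [s1 b1] [s2 b2].
pose e (i : 'I_(m1 + m2)) : V * W :=
  match fintype.split i with inl j => (e1 j, 0) | inr j => (0, e2 j) end.
pose l (i : 'I_(m1 + m2)) (z : V * W) : R :=
  match fintype.split i with inl j => l1 j z.1 | inr j => l2 j z.2 end.
exists e, l; split=> [v|i v]; last first.
  rewrite /l; case: (fintype.split i) => j.
    by apply: le_trans (b1 _ _) _; exact: fst_norm_le.
  by apply: le_trans (b2 _ _) _; exact: snd_norm_le.
rewrite big_split_ord/=.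
have E1 j : l (lshift m2 j) v *: e (lshift m2 j) = (l1 j v.1 *: e1 j, 0).
  have := unsplitK (inl j : 'I_m1 + 'I_m2)%type => /= h.
  by rewrite /l /e h; congr (_, _); rewrite scaler0.
have E2 j : l (rshift m1 j) v *: e (rshift m1 j) = (0, l2 j v.2 *: e2 j).
  have := unsplitK (inr j : 'I_m1 + 'I_m2)%type => /= h.
  by rewrite /l /e h; congr (_, _); rewrite scaler0.
rewrite (eq_bigr _ (fun j _ => E1 j)) (eq_bigr _ (fun j _ => E2 j)).
have S1 (F : 'I_m1 -> V) : \sum_i ((F i, 0) : V * W) = (\sum_i F i, 0).
  by elim/big_rec2 : _ => // i x y _ ->; congr (_, _); rewrite addr0.
have S2 (F : 'I_m2 -> W) : \sum_i ((0, F i) : V * W) = (0, \sum_i F i).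
  by elim/big_rec2 : _ => // i x y _ ->; congr (_, _); rewrite addr0.
rewrite S1 S2 -s1 -s2; case: v {E1 E2} => v w; congr (_, _); first by rewrite addr0.
by rewrite add0r.
Qed.

Lemma box_lipschitz (f : E * E -> R) (U : set E) q (r B : R) :
  Ck 1 (U `*` [set: E]) f -> (forall z, `|z - q| <= r -> U z) ->
  exists C : R, [/\ 0 <= C,
    forall z z', box q r B z -> box q r B z' -> `|f z' - f z| <= C * `|z' - z| &
    forall z, box q r B z -> `|f z| <= C].
Proof.
move=> fC qU.
have [e [l [lE lle]]] := prod_basis (rv_basis n) (rv_basis n).
have cK : compact (box q r B).
  have -> : box q r B = [set z : E | `|z - q| <= r] `*` [set z : E | `|z - 0| <= B].
    by apply/seteqP; split=> -[z z'] [/= h1 h2]; split=> //=; move: h2; rewrite subr0.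
  by apply: compact_setX; exact: closed_ball_compact.
have KU : box q r B `<=` U `*` [set: E] by move=> z [h _]; split=> //; exact: qU.
have cv x y (s : R) : box q r B x -> box q r B y -> 0 <= s <= 1 -> box q r B (x + s *: (y - x)).
  move=> [x1 x2] [y1 y2] s01; split=> /=; first exact: closed_ball_convex.
  rewrite -[X in `|X|]subr0; apply: closed_ball_convex => //; by rewrite subr0.
have [C1 C10 H1] := Ck1_lipschitz lE lle fC KU cK cv.
have fc z : box q r B z -> {for z, continuous f}.
  by move=> /KU; exact: (Ck_lower fC).
have [C2 C20 H2] := continuous_compact_bounded cK fc.
exists (C1 + C2); split; first by rewrite addr_ge0.
  move=> z z' hz hz'; apply: le_trans (H1 _ _ hz hz') _.
  by rewrite ler_wpM2r// lerDl.
by move=> z hz; apply: le_trans (H2 _ hz) _; rewrite lerDr.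
Qed.

End BoxLipschitz.

Section LocalData.
Variables (R : realType) (n : nat) (M : topologicalType).
Variables (X : smooth_structure R n M) (g : riemannian_metric X).
Local Notation E := 'rV[R]_n.
Variable H : M -> E -> R.
Hypothesis H_tonelli : tonelli g H.
Implicit Types (c x y : M) (q p v w : E).

(** The growth of [H] is expressed with the dual norm [conorm], the estimates with coordinates. The
    lower bound of [tnorm_bounds] makes the supremum in [conorm] finite; the upper one provides test
    vectors of norm at most 1. *)
Lemma conorm_bound c x0 : dom X c x0 -> exists r b : R, [/\ 0 < r, 0 < b,
  (forall q, `|q - chart X c x0| < r -> (chart X c @` dom X c) q) &
  forall x p, dom X c x -> `|chart X c x - chart X c x0| < r ->
    `|cc X x c x p| <= b * conorm g x p].
Proof.
move=> d0; have [r [a [b [r0 a0 b0 rV Hb]]]] := tnorm_bounds g d0.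
exists r, b; split=> // x p dx xr.
have dxx := mem_dom X x.
have ub v : tnorm g x v <= 1 -> pairing p v <= conorm g x p.
  move=> v1; apply: ub_le_sup; last by exists v.
  exists (n%:R * `|cc X x c x p| * a^-1) => _ [w w1 <-].
  have wE : w = tc X c x x (tc X x c x w) by rewrite tc_comp// tc_id.
  move: w1; rewrite /= {1}wE tnorm_chart// => w1.
  have /andP[h1 _] := Hb _ (tc X x c x w) xr.
  rewrite wE -pairing_cc; apply: le_trans (ler_norm _) _.
  apply: le_trans (pairing_norm _ _) _; rewrite ler_wpM2l ?mulr_ge0//.
  by rewrite -div1r ler_pdivlMr// mulrC; exact: le_trans h1 w1.
have c0 : 0 <= conorm g x p.
  have := ub 0; rewrite tnorm0 => /(_ ler01); apply: le_trans.
  by rewrite -(scale0r (0 : E)) pairingZr mul0r.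
apply: rv_norm_le; first by rewrite mulr_ge0// ltW.
move=> i; rewrite -pairing_delta; set e := delta_mx 0 i : E.
have e1 : `|e| <= 1.
  apply: rv_norm_le => // j; rewrite !mxE eqxx/=; case: (j == i) => //=.
    by rewrite normr1.
  by rewrite normr0.
(* Used with [k = 1] and [k = -1]: the vector [(k / b) *: e] of the chart has Riemannian norm at
   most 1. *)
have key (k : R) : `|k| <= 1 -> k * pairing (cc X x c x p) e <= b * conorm g x p.
  move=> k1; have -> : k * pairing (cc X x c x p) e =
      b * pairing p (tc X c x x ((k / b) *: e)).
    by rewrite tcZ pairingZr pairing_cc mulrA; congr (_ * _); rewrite mulrCA mulfV ?gt_eqF// mulr1.
  rewrite ler_wpM2l ?(ltW b0)//; apply: ub; rewrite tnorm_chart//.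
  have /andP[_ h] := Hb _ ((k / b) *: e) xr; apply: le_trans h _.
  rewrite normrZ normrM normfV (gtr0_norm b0) mulrA mulrCA mulfV ?gt_eqF// mulr1.
  by rewrite -[leRHS]mulr1 ler_pM.
rewrite ler_norml; have := key 1; have := key (-1).
rewrite normrN normr1 => /(_ (lexx _)) h1 /(_ (lexx _)) h2.
by rewrite mul1r in h2; rewrite mulN1r in h1; rewrite h2 andbT lerNl.
Qed.

(** Superlinear growth with slope 1: beyond the conorm [k], the conorm is at most the energy. Energy
    at most [E0] thus forces a conorm of at most [|k| + |E0|]. *)
Lemma momentum_bound c x0 (E0 : R) : dom X c x0 -> exists r B : R, [/\ 0 < r, 0 <= B,
  (forall q, `|q - chart X c x0| < r -> (chart X c @` dom X c) q) &
  forall x p, dom X c x -> `|chart X c x - chart X c x0| < r -> H x p <= E0 ->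
    `|cc X x c x p| <= B].
Proof.
move=> d0; have [r [b [r0 b0 rV Hb]]] := conorm_bound d0.
have [_ _ /(_ 1)[k Hk]] := H_tonelli.
exists r, (b * (`|k| + `|E0|)); split=> //.
  by rewrite mulr_ge0 ?addr_ge0// ltW.
move=> x p dx xr He; apply: le_trans (Hb _ _ dx xr) _.
rewrite ler_wpM2l ?(ltW b0)//; have [h|h] := leP k (conorm g x p).
  have := Hk _ _ h; rewrite mul1r => h1; apply: le_trans h1 _; apply: le_trans He _.
  by apply: le_trans (ler_norm _) _; rewrite lerDr.
by apply: le_trans (ltW h) _; apply: le_trans (ler_norm _) _; rewrite lerDl.
Qed.

(* Momenta of energy at most E0 are bounded by B - 1; the margin leaves room for the
   covectors p^# + l e_i. *)
Definition local_data c q0 (E0 r B K : R) : Prop :=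
  [/\ 0 < r, 0 < B, 0 < K,
    (forall q, `|q - q0| <= r -> (chart X c @` dom X c) q) &
    [/\ (forall x p, dom X c x -> `|chart X c x - q0| <= r -> H x p <= E0 ->
        `|cc X x c x p| <= B - 1),
      (forall z z', box q0 r B z -> box q0 r B z' ->
        [/\ `|Hl X H c z' - Hl X H c z| <= K * `|z' - z|,
            `|Hdp X H c z' - Hdp X H c z| <= K * `|z' - z| &
            `|Hdq X H c z' - Hdq X H c z| <= K * `|z' - z|]) &
      (forall z, box q0 r B z -> `|Hdp X H c z| <= K /\ `|Hdq X H c z| <= K)]].

Lemma local_data_exists c x0 (E0 : R) : dom X c x0 ->
  exists r B K : R, local_data c (chart X c x0) E0 r B K.
Proof.
move=> d0; have [r0 [B0 [r00 B00 rV Hm]]] := momentum_bound E0 d0.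
pose r := r0 / 2; have rp : 0 < r by rewrite divr_gt0.
have rr0 : r < r0 by rewrite /r; lra.
pose B := B0 + 1; have Bp : 0 < B by rewrite ltr_wpDl.
set q0 := chart X c x0 in rV Hm *.
pose V := chart X c @` dom X c.
have rV' q : `|q - q0| <= r -> V q by move=> h; apply: rV; exact: le_lt_trans rr0.
have oV : open V by exact: open_image_chart.
have oU : open (V `*` [set: E]).
  have -> : V `*` [set: E] = fst @^-1` V by apply/seteqP; split=> z; [case|].
  by apply: open_comp => // z _; exact: cvg_fst.
have C2 := Hl_Ck H_tonelli c.
have [_ C1] := Ck_diffE C2.
have [K1 [K10 L1 _]] := box_lipschitz B (Ck_lower C2) rV'.
have Cp i : Ck 1 (V `*` [set: E]) (fun z => Hdp X H c z 0 i).
  apply: (Ck_congr oU _ (C1 (0, delta_mx 0 i))) => -[q p] [/= Vq _].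
  by rewrite -(pairing_Hdp H_tonelli)// pairing_delta.
have Cq i : Ck 1 (V `*` [set: E]) (fun z => Hdq X H c z 0 i).
  apply: (Ck_congr oU _ (C1 (delta_mx 0 i, 0))) => -[q p] [/= Vq _].
  by rewrite -(pairing_Hdq H_tonelli)// pairing_delta.
have /choice[Kp HKp] := fun i => box_lipschitz B (Cp i) rV'.
have /choice[Kq HKq] := fun i => box_lipschitz B (Cq i) rV'.
pose K := K1 + \sum_i Kp i + \sum_i Kq i + 1.
have sp0 : 0 <= \sum_i Kp i by apply: sumr_ge0 => i _; case: (HKp i).
have sq0 : 0 <= \sum_i Kq i by apply: sumr_ge0 => i _; case: (HKq i).
have K0 : 0 < K by rewrite /K; lra.
have pK i : Kp i <= K.
  apply: (@le_trans _ _ (\sum_i Kp i)); last by rewrite /K; lra.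
  by rewrite (bigD1 i)//= lerDl sumr_ge0// => j _; case: (HKp j).
have qK i : Kq i <= K.
  apply: (@le_trans _ _ (\sum_i Kq i)); last by rewrite /K; lra.
  by rewrite (bigD1 i)//= lerDl sumr_ge0// => j _; case: (HKq j).
exists r, B, K; split=> //; split.
- move=> x p dx xr He; rewrite /B addrK; apply: Hm => //; exact: le_lt_trans rr0.
- move=> z z' hz hz'; split.
  + by apply: le_trans (L1 _ _ hz hz') _; rewrite ler_wpM2r// /K; lra.
  + apply: rv_norm_le; first by rewrite mulr_ge0// ltW.
    move=> i; have [_ h _] := HKp i; rewrite coordB; apply: (le_trans (h _ _ hz hz')).
    by rewrite ler_wpM2r.
  + apply: rv_norm_le; first by rewrite mulr_ge0// ltW.
    move=> i; have [_ h _] := HKq i; rewrite coordB; apply: (le_trans (h _ _ hz hz')).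
    by rewrite ler_wpM2r.
- move=> z hz; split; (apply: rv_norm_le; first by rewrite ltW) => i.
    by have [_ _ h] := HKp i; apply: le_trans (h _ hz) _.
  by have [_ _ h] := HKq i; apply: le_trans (h _ hz) _.
Qed.

End LocalData.

Lemma pairB (R : realType) (V W : normedModType R) (v v' : V) (w w' : W) :
  (v, w) - (v', w') = (v - v', w - w').
Proof. by []. Qed.

Lemma ae_imp (R : realType) (P Q : R -> Prop) : (forall t, P t -> Q t) ->
  {ae (@lebesgue_measure R), forall t, P t} -> {ae (@lebesgue_measure R), forall t, Q t}.
Proof. by move=> PQ; apply: negligibleS => t /= nQ /PQ. Qed.

(** Let [s0] maximize the norm on [[0, T]]. As [K * T <= 1/2], the pair moves by at most half of
    that maximum, so the maximum is at most twice the value at any other time. The statement treats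
    [t] and [t'] alike and serves forward and backward in time. *)
Lemma gronwall_short (R : realType) n (f1 f2 df1 df2 : R -> 'rV[R]_n) (K T : R) : 0 <= T ->
  K * T <= 2^-1 ->
  (forall t, 0 <= t <= T -> is_derive t 1 f1 (df1 t) /\ is_derive t 1 f2 (df2 t)) ->
  (forall t, 0 <= t <= T -> `|df1 t| <= K * `|(f1 t, f2 t)| /\ `|df2 t| <= K * `|(f1 t, f2 t)|) ->
  forall t t', 0 <= t <= T -> 0 <= t' <= T -> `|(f1 t, f2 t)| <= 2 * `|(f1 t', f2 t')|.
Proof.
move=> T0 KT Hd Hb; pose N t := `|(f1 t, f2 t)|.
have cN : {within `[0, T], continuous N}.
  apply: continuous_in_subspaceT => t; rewrite inE/= in_itv/= => /Hd[d1 d2].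
  have h : {for t, continuous (fun s => (f1 s, f2 s))}.
    apply: differentiable_continuous; apply/derivable1_diffP.
    by case: (is_derive_pair d1 d2).
  by apply: continuous_comp h _; exact: norm_continuous.
have [s0 + mx] := EVT_max T0 cN; rewrite in_itv/= => s0T.
have step t t' : 0 <= t <= T -> 0 <= t' <= T -> t <= t' ->
    `|(f1 t', f2 t') - (f1 t, f2 t)| <= 2^-1 * N s0.
  move=> /andP[t0 tT] /andP[t'0 t'T] tt'.
  have sub s : t <= s <= t' -> 0 <= s <= T.
    by move=> /andP[h1 h2]; rewrite (le_trans t0 h1) (le_trans h2 t'T).
  have B1 s : t <= s <= t' -> `|df1 s - 0| <= K * N s0 /\ `|df2 s - 0| <= K * N s0.
    move=> /sub sT; have [h1 h2] := Hb s sT; rewrite !subr0.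
    have K0 : 0 <= K * N s0.
      have [h3 _] := Hb s0 s0T; exact: le_trans h3.
    have hN : N s <= N s0 by apply: mx; rewrite in_itv.
    have hK : K * N s <= K * N s0.
      have [k0|k0] := leP 0 K; first by rewrite ler_wpM2l.
      have n0 : N s0 = 0.
        apply/le_anti; rewrite normr_ge0 andbT leNgt; apply/negP => h.
        by move: K0; rewrite pmulr_lge0// leNgt k0.
      by rewrite n0 in hN *; have -> : N s = 0 by apply/le_anti; rewrite hN normr_ge0.
    by split; [exact: le_trans h1 hK|exact: le_trans h2 hK].
  have K0 : 0 <= K * N s0.
    by have [h3 _] := Hb s0 s0T; exact: le_trans h3.
  have bd : K * N s0 * (t' - t) <= 2^-1 * N s0.
    have h : K * N s0 * (t' - t) <= K * N s0 * T by rewrite ler_wpM2l//; lra.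
    apply: le_trans h _; rewrite mulrAC ler_wpM2r//; exact: normr_ge0.
  have e1 := is_derive_near_incr tt' (fun s h => (Hd s (sub s h)).1) (fun s h => (B1 s h).1).
  have e2 := is_derive_near_incr tt' (fun s h => (Hd s (sub s h)).2) (fun s h => (B1 s h).2).
  rewrite scaler0 subr0 in e1; rewrite scaler0 subr0 in e2.
  by rewrite pairB prod_norm_le (le_trans e1 bd) (le_trans e2 bd).
move=> t t' tT t'T; have h1 : N t <= N s0 by apply: mx; rewrite in_itv.
suff : N s0 <= N t' + 2^-1 * N s0 by rewrite -/(N t) -/(N t'); lra.
rewrite /N -[X in `|X| <= _](subrK (f1 t', f2 t')) addrC.
apply: le_trans (ler_normD _ _) _; apply: lerD => //.
case: (leP s0 t') => h; last by apply: step => //; exact: ltW.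
by rewrite distrC; exact: step.
Qed.

(** * Short curves stay in a chart *)

Section ShortTime.
Variables (R : realType) (n : nat) (M : topologicalType).
Variables (X : smooth_structure R n M) (g : riemannian_metric X).
Hypotheses (M_hausdorff : hausdorff_space M).
Local Notation E := 'rV[R]_n.
Implicit Types (c x y : M) (q p v w : E).

Lemma cutdist_right_dini c q (r K : R) (gamma : R -> M) t : 0 <= K ->
  (forall z : E, `|z - q| <= r -> (chart X c @` dom X c) z) ->
  {for t, continuous gamma} ->
  (dom X c (gamma t) -> `|chart X c (gamma t) - q| <= r ->
     exists2 w, `|w| <= K & is_derive t 1 (fun s => chart X c (gamma s)) w) ->
  right_dini_ge0 (fun s => K * s - cutdist X c q r (gamma s)) t.
Proof.
move=> K0 H cg Hw e e0; have cA := in_ball_closed M_hausdorff H.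
have [[dt tr]|nA] := pselect (in_ball X c q r (gamma t)); last first.
  have /nbhs_ballP[d /= d0 Hd] : \forall s \near t, cutdist X c q r (gamma s) = r.
    exact: (cg _ (cutdist_near_out cA nA)).
  exists d => // h /andP[h0 hd]; rewrite Hd; last first.
    by rewrite -ball_normE/= opprD addNKr normrN gtr0_norm.
  rewrite cutdist_out//.
  have : 0 <= K * h by rewrite mulr_ge0// ltW.
  have : 0 <= e * h by rewrite mulr_ge0// ltW.
  lra.
have [w wK /is_deriveP/(_ e e0)[d d0 Hd]] := Hw dt tr.
have /nbhs_ballP[d' /= d'0 Hd'] : \forall s \near t, dom X c (gamma s).
  exact: (cg _ (dom_nbhs dt)).
exists (Num.min d d'); first by rewrite lt_min d0.
move=> h /andP[h0]; rewrite lt_min => /andP[h1 h2].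
have dth : dom X c (gamma (t + h)).
  by apply: Hd'; rewrite -ball_normE/= opprD addNKr normrN gtr0_norm.
have := Hd h; rewrite gtr0_norm// => /(_ h1) H1.
have : `|cutdist X c q r (gamma (t + h)) - cutdist X c q r (gamma t)| <= (K + e) * h.
  rewrite !cutdist_dom//; apply: le_trans (min_dist _ _ _) _.
  apply: le_trans (ler_dist_dist _ _) _; rewrite opprB addrA subrK.
  rewrite -[X in `|X|](subrK (h *: w)).
  apply: le_trans (ler_normD _ _) _; rewrite [leRHS]mulrDl [leRHS]addrC; apply: lerD => //.
  by rewrite normrZ gtr0_norm// mulrC ler_wpM2r ?(ltW h0).
rewrite ler_norml => /andP[_]; move: (cutdist _ _ _ _ _) (cutdist _ _ _ _ _) => u v.
by rewrite mulrDr mulrDl => huv; lra.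
Qed.

Lemma cutdist_small c q (r D : R) y : cutdist X c q r y <= D -> D < r ->
  dom X c y /\ `|chart X c y - q| <= D.
Proof.
move=> h Dr; have [[dy yr]|nA] := pselect (in_ball X c q r y); last first.
  by move: h; rewrite cutdist_out// leNgt Dr.
by split=> //; move: h; rewrite cutdist_dom// min_r.
Qed.

(** The speed bound is assumed only while the curve is in the chart ball. This is not circular:
    outside the ball [cutdist] is constant, so [K * s - cutdist] has nonnegative Dini derivative in
    all cases. *)
Lemma curve_stays c (r K a b : R) (gamma : R -> M) : 0 <= K -> a <= b -> dom X c (gamma a) ->
  (forall z : E, `|z - chart X c (gamma a)| <= r -> (chart X c @` dom X c) z) ->
  (forall t, a <= t <= b -> {for t, continuous gamma}) ->
  (forall t, a <= t < b -> dom X c (gamma t) ->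
    `|chart X c (gamma t) - chart X c (gamma a)| <= r ->
     exists2 w, `|w| <= K & is_derive t 1 (fun s => chart X c (gamma s)) w) ->
  K * (b - a) < r ->
  dom X c (gamma b) /\ `|chart X c (gamma b) - chart X c (gamma a)| <= K * (b - a).
Proof.
move=> K0 ab da H cg Hw Kr; set q := chart X c (gamma a) in H Hw *.
apply: (@cutdist_small _ _ r) => //.
have fa : cutdist X c q r (gamma a) = 0.
  rewrite cutdist_dom// subrr normr0 min_r//; apply: ltW; apply: le_lt_trans Kr.
  by rewrite mulr_ge0// subr_ge0.
have := @dini_le R (fun s => K * s - cutdist X c q r (gamma s)) a b ab.
rewrite fa subr0 => h; suff : K * a <= K * b - cutdist X c q r (gamma b) by lra.
apply: h; last first.
  by move=> t tab; have /andP[h1 h2] := tab; apply: cutdist_right_dini => //;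
    [apply: cg; rewrite h1 ltW|exact: Hw].
move=> t /andP[t1 t2] e e0.
have cF : {for t, continuous (fun s => K * s - cutdist X c q r (gamma s))}.
  apply: continuousB; first by apply: continuousM; [exact: cst_continuous|].
  apply: (@continuous_comp _ _ _ gamma (cutdist X c q r)).
    by apply: cg; rewrite (ltW t1).
  exact: cutdist_continuous.
have /cvgrPdist_le/(_ _ e0)/nbhs_ballP[d /= d0 Hd] := cF.
exists d => // s /andP[s1 s2] _; have := Hd s.
rewrite -ball_normE/= gtr0_norm ?subr_gt0// => /(_ ltac:(lra)).
by rewrite ler_norml => /andP[h1 _]; move: h1; rewrite lerBrDr; lra.
Qed.

Lemma cutdist_lip (M_connected : connected [set: M]) c x0 : dom X c x0 ->
  exists r0 C : R, [/\ 0 < r0, 0 < C &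
    forall q (r : R), `|q - chart X c x0| + r < r0 ->
    (forall z : E, `|z - q| <= r -> (chart X c @` dom X c) z) /\
    forall y z, `|cutdist X c q r z - cutdist X c q r y| <= C * dist g y z].
Proof.
move=> d0; have [r0 [a [b [r00 a0 b0 rV Hab]]]] := tnorm_bounds g d0.
exists r0, a^-1; split=> //; first by rewrite invr_gt0.
move=> q r qr; have Hz (z : E) : `|z - q| <= r -> `|z - chart X c x0| < r0.
  move=> h; rewrite -[z](subrK q) -addrA; apply: le_lt_trans (ler_normD _ _) _; lra.
have rV' (z : E) : `|z - q| <= r -> (chart X c @` dom X c) z by move=> /Hz/rV.
split=> // y z; apply: cutdist_dist => // p w /Hz h.
by have /andP[] := Hab p w h.
Qed.

(** The version for solutions in the almost everywhere sense. The Lipschitz bound on [cutdist] turns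
    absolute continuity for [dist] into that of a real function, to which [ac_dini_le] applies. *)
Lemma curve_stays_ac c (r K a b C : R) (gamma : R -> M) : 0 <= K -> 0 < C ->
  a <= b -> dom X c (gamma a) ->
  (forall z : E, `|z - chart X c (gamma a)| <= r -> (chart X c @` dom X c) z) ->
  (forall y z, `|cutdist X c (chart X c (gamma a)) r z -
     cutdist X c (chart X c (gamma a)) r y| <= C * dist g y z) ->
  absolutely_continuous g a b gamma ->
  {ae (@lebesgue_measure R), forall t, a < t < b -> {for t, continuous gamma} /\
    (dom X c (gamma t) -> `|chart X c (gamma t) - chart X c (gamma a)| <= r ->
     exists2 w, `|w| <= K & is_derive t 1 (fun s => chart X c (gamma s)) w)} ->
  K * (b - a) < r ->
  dom X c (gamma b) /\ `|chart X c (gamma b) - chart X c (gamma a)| <= K * (b - a).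
Proof.
move=> K0 C0 ab da H HC acg Hw Kr; set q := chart X c (gamma a) in H HC Hw *.
apply: (@cutdist_small _ _ r) => //.
have fa : cutdist X c q r (gamma a) = 0.
  rewrite cutdist_dom// subrr normr0 min_r//; apply: ltW; apply: le_lt_trans Kr.
  by rewrite mulr_ge0// subr_ge0.
have := @ac_dini_le R (fun s => K * s + - cutdist X c q r (gamma s)) a b ab.
rewrite fa subr0 => h; suff : K * a <= K * b - cutdist X c q r (gamma b) by lra.
apply: h; last first.
  apply: ae_imp Hw => t h tab; have [h1 h2] := h tab.
  exact: cutdist_right_dini.
apply: acD.
  apply: (@lipschitz_ac _ _ _ K) => s t _ _.
  by rewrite -mulrBr normrM ger0_norm.
move=> e e0; have eC : 0 < e / C by rewrite divr_gt0.
have [d d0 Hd] := acg _ eC; exists d => // m u v h1 h2 h3.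
have := Hd m u v h1 h2 h3; rewrite ltr_pdivlMr// => h4; apply: le_lt_trans h4.
rewrite mulr_suml; apply: ler_sum => i _; rewrite -opprD normrN mulrC; exact: HC.
Qed.

Section FlowShort.
Variable H : M -> E -> R.
Hypothesis H_tonelli : tonelli g H.
Variable Phi : R -> M * E -> M * E.
Hypothesis Phi_flow : hamiltonian_flow X H Phi.
Variables (c : M) (q0 : E) (E0 r B K : R).
Hypothesis LD : local_data X H c q0 E0 r B K.

Lemma in_box z : H z.1 z.2 <= E0 -> dom X c z.1 -> `|chart X c z.1 - q0| <= r ->
  box q0 r B (loc X c z).
Proof.
move: LD => [_ _ _ _ [h _ _]] Hz dz zr; split=> //.
by apply: le_trans (h _ _ dz zr Hz) _; lra.
Qed.

(** The orbit of [z] from time [s0] on, forward for [sg = 1] and backward for [sg = -1], so that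
    each estimate is proved once for both directions. *)
Definition run (sg s0 : R) (z : M * E) (t : R) := Phi (s0 + sg * t) z.

Lemma run_continuous sg s0 z t : {for t, continuous (fun t => (run sg s0 z t).1)}.
Proof.
have [_ /(_ (s0 + sg * t))/= [h _ _]] := Phi_flow z.
apply: (@continuous_comp _ _ _ (fun t => s0 + sg * t) (fun s => (Phi s z).1)) => //.
apply: continuousD; first exact: cst_continuous.
by apply: continuousM; [exact: cst_continuous|].
Qed.

Lemma run_derive sg s0 z t : dom X c (run sg s0 z t).1 ->
  is_derive t 1 (fun s => (loc X c (run sg s0 z s)).1) (sg *: Hdp X H c (loc X c (run sg s0 z t))) /\
  is_derive t 1 (fun s => (loc X c (run sg s0 z s)).2) (sg *: - Hdq X H c (loc X c (run sg s0 z t))).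
Proof.
move=> /(flow_chart H_tonelli Phi_flow)[d1 d2].
have da : is_derive t (1 : R) (fun s : R => s0 + sg * s) sg.
  apply/is_deriveP => e e0; exists 1 => // h _.
  rewrite (_ : _ - _ - _ = 0) ?normr0 ?mulr_ge0// ?ltW//.
  by rewrite /GRing.scale/=; ring.
have comp (f : R -> E) l : is_derive (s0 + sg * t) 1 f l ->
    is_derive t 1 (fun s => f (s0 + sg * s)) (sg *: l).
  move=> /is_deriveP df; apply/is_deriveP => e e0.
  have e1 : 0 < e / (`|sg| + 1) by rewrite divr_gt0// ltr_wpDl.
  have [d d0 Hd] := df _ e1; exists (d / (`|sg| + 1)); first by rewrite divr_gt0// ltr_wpDl.
  move=> h; rewrite ltr_pdivlMr ?ltr_wpDl// => hd.
  have sh : `|sg * h| <= `|h| * (`|sg| + 1) by rewrite normrM mulrC ler_wpM2l// lerDl.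
  have := Hd (sg * h) (le_lt_trans sh hd).
  rewrite mulrDr addrA scalerA [h * sg]mulrC => h1; apply: le_trans h1 _.
  rewrite mulrAC ler_pdivrMr ?ltr_wpDl// -mulrA; apply: ler_wpM2l => //; exact: ltW.
by split; [exact: (comp _ _ d1)|exact: (comp _ _ d2)].
Qed.

(** Conservation of energy bounds the momentum as long as the base point is in the chart ball, and
    this bounds the speed by [K]; [curve_stays] then keeps the base point there. *)
Lemma run_short sg s0 z t : `|sg| = 1 -> H z.1 z.2 <= E0 -> dom X c (run sg s0 z 0).1 ->
  `|(loc X c (run sg s0 z 0)).1 - q0| <= r / 2 -> 0 <= t -> K * t < r / 2 ->
  [/\ dom X c (run sg s0 z t).1, box q0 r B (loc X c (run sg s0 z t)) &
      `|loc X c (run sg s0 z t) - loc X c (run sg s0 z 0)| <= K * t].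
Proof.
move: (LD) => [r0 B0 K0 rV [_ _ hK]] sg1 Hz d0 hr.
have Ht s : H (run sg s0 z s).1 (run sg s0 z s).2 <= E0.
  by rewrite /run (flow_energy H_tonelli Phi_flow).
have near (q : E) : `|q - (loc X c (run sg s0 z 0)).1| <= r / 2 -> `|q - q0| <= r.
  move=> h; rewrite -[q](subrK (loc X c (run sg s0 z 0)).1) -addrA.
  by apply: le_trans (ler_normD _ _) _; lra.
have pos s : 0 <= s -> K * s < r / 2 -> dom X c (run sg s0 z s).1 /\
    `|(loc X c (run sg s0 z s)).1 - (loc X c (run sg s0 z 0)).1| <= K * s.
  move=> s_ge0 Ks; rewrite -[s in K * s]subr0.
  apply: (@curve_stays c (r / 2) K 0 s (fun s => (run sg s0 z s).1)) => //.
  - exact: ltW.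
  - by move=> q /near/rV.
  - by move=> s' _; exact: run_continuous.
  - move=> s' _ ds' /near hs'; have [d1 _] := run_derive ds'.
    exists (sg *: Hdp X H c (loc X c (run sg s0 z s'))) => //.
    rewrite normrZ sg1 mul1r.
    by have [] := hK _ (in_box (Ht s') ds' hs').
  - by rewrite subr0.
move=> t0 Kt; have [dt ht] := pos t t0 Kt.
have bx s : 0 <= s <= t -> dom X c (run sg s0 z s).1 /\ box q0 r B (loc X c (run sg s0 z s)).
  move=> /andP[h1 h2]; have Ks : K * s < r / 2.
    by apply: le_lt_trans Kt; rewrite ler_wpM2l// ltW.
  have [ds hs] := pos s h1 Ks; split=> //; apply: in_box => //; apply: near.
  exact: le_trans hs (ltW Ks).
split=> //; first by apply: (bx t _).2; rewrite t0 lexx.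
have := is_derive_near_incr (w := 0) (C := K) t0
  (fun s h => (run_derive (bx s h).1).2) _.
rewrite scaler0 !subr0 => mom.
have {}mom : `|(loc X c (run sg s0 z t)).2 - (loc X c (run sg s0 z 0)).2| <= K * t.
  apply: mom => s /bx[_ /hK[_ h]].
  by rewrite subr0 normrZ sg1 mul1r normrN.
move: ht mom; move: (loc X c (run sg s0 z t)) (loc X c (run sg s0 z 0)) => [a1 a2] [b1 b2]/= h1 h2.
by rewrite pairB prod_norm_le h1.
Qed.

Lemma run_gronwall sg s0 s0' z z' T : `|sg| = 1 -> 0 <= T -> K * T <= 2^-1 ->
  (forall t, 0 <= t <= T -> dom X c (run sg s0 z t).1 /\ box q0 r B (loc X c (run sg s0 z t))) ->
  (forall t, 0 <= t <= T -> dom X c (run sg s0' z' t).1 /\ box q0 r B (loc X c (run sg s0' z' t))) ->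
  forall t t', 0 <= t <= T -> 0 <= t' <= T ->
  `|loc X c (run sg s0 z t) - loc X c (run sg s0' z' t)| <=
  2 * `|loc X c (run sg s0 z t') - loc X c (run sg s0' z' t')|.
Proof.
move: (LD) => [r0 B0 K0 rV [_ hL _]] sg1 T0 KT bz bz' t t' tT t'T.
have := @gronwall_short R n
  (fun t => (loc X c (run sg s0 z t)).1 - (loc X c (run sg s0' z' t)).1)
  (fun t => (loc X c (run sg s0 z t)).2 - (loc X c (run sg s0' z' t)).2)
  (fun t => sg *: Hdp X H c (loc X c (run sg s0 z t)) - sg *: Hdp X H c (loc X c (run sg s0' z' t)))
  (fun t => (sg *: - Hdq X H c (loc X c (run sg s0 z t))) - (sg *: - Hdq X H c (loc X c (run sg s0' z' t))))
  K T T0 KT _ _ t t' tT t'T.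
have pE (u v : E * E) : (u.1 - v.1, u.2 - v.2) = u - v by case: u v => ? ? [? ?].
rewrite !pE; apply => s sT; have [d1 b1] := bz s sT; have [d2 b2] := bz' s sT.
  have [h1 h2] := run_derive d1; have [h3 h4] := run_derive d2.
  by split; apply: is_deriveB.
have [_ h1 h2] := hL _ _ b2 b1.
by rewrite pE -!scalerBr !normrZ sg1 !mul1r -opprD normrN; split.
Qed.

End FlowShort.
End ShortTime.

Lemma bounded_seq_cluster (R : realType) n (P : nat -> 'rV[R]_n) (B : R) N0 :
  (forall k, (N0 <= k)%N -> `|P k| <= B) ->
  exists Q, forall e : R, 0 < e -> forall N, exists2 k, (N <= k)%N & `|P k - Q| < e.
Proof.
move=> H; have cA := @closed_ball_compact R n 0 B.
have [|Q [_ HQ]] := cA (P @ \oo) _.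
  by exists N0 => // k /= h; rewrite subr0; exact: H.
exists Q => e e0 N; have [|_ [[k Nk <-] Hk]] := HQ (P @` [set k | (N <= k)%N]) (ball Q e) _ (nbhsx_ballx Q e e0).
  by exists N => // k /= h; exists k.
by exists k => //; move: Hk; rewrite -ball_normE/= distrC.
Qed.

Lemma pair_cst_continuous (R : realType) (V W : normedModType R) (v : V) (w : W) :
  {for w, continuous (fun w : W => (v, w))}.
Proof. by rewrite /prop_for /continuous_at; apply: cvg_pair; [exact: cvg_cst|exact: cvg_id]. Qed.

Lemma slice_continuous (R : realType) (V W Z : normedModType R) (f : V * W -> Z) v w :
  {for (v, w), continuous f} -> {for w, continuous (fun w' => f (v, w'))}.
Proof.
by move=> cf; apply: (@continuous_comp _ _ _ (fun w' : W => (v, w')) f _ _ cf);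
  exact: pair_cst_continuous.
Qed.

Lemma near_forall_ord (T : topologicalType) (q : T) m (P : 'I_m -> T -> Prop) :
  (forall i, \forall x \near q, P i x) -> \forall x \near q, forall i, P i x.
Proof. by move=> h; apply: filter_forall. Qed.

(** * Superdifferential and backward flow *)

Section Propagation.
Variables (R : realType) (n : nat) (M : topologicalType).
Variables (X : smooth_structure R n M) (g : riemannian_metric X).
Hypotheses (M_hausdorff : hausdorff_space M) (M_compact : compact [set: M]).
Local Notation E := 'rV[R]_n.
Variable H : M -> E -> R.
Hypothesis H_tonelli : tonelli g H.
Variable Phi : R -> M * E -> M * E.
Hypothesis Phi_flow : hamiltonian_flow X H Phi.
Variables (u : R -> M -> R) (G : set (M * E)) (tau : R).
Hypothesis tau_gt0 : 0 < tau.
Hypothesis graphE : forall t, 0 < t < tau ->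
  [set (x, DM X (u t) x) | x in [set: M]] = Phi (- t) @` G.
(** Here [u t] stands for T^+_t phi and [G] for the graph of D^+phi. They are linked only by the
    graph identity [graphE], for times in the open interval []0, tau[]. *)
Definition U c (z : R * E) : R := u z.1 (param X c z.2).
Hypothesis U_C1 : forall c, Ck 1 (`]0, tau[ `*` (chart X c @` dom X c)) (U c).
Implicit Types (c x y : M) (q p v w : E) (z : M * E).

Lemma graph_from x t : 0 < t < tau -> exists2 z, G z & Phi (- t) z = (x, DM X (u t) x).
Proof.
move=> tt; have : [set (x, DM X (u t) x) | x in [set: M]] (x, DM X (u t) x) by exists x.
by rewrite (graphE tt) => -[z Gz <-]; exists z.
Qed.

Lemma graph_to z t : 0 < t < tau -> G z ->
  Phi (- t) z = ((Phi (- t) z).1, DM X (u t) (Phi (- t) z).1).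
Proof.
move=> tt Gz; have : (Phi (- t) @` G) (Phi (- t) z) by exists z.
by rewrite -(graphE tt) => -[x _ <-].
Qed.

Definition Du c t q : E := gr (fun q' => U c (t, q')) q.

Lemma U_diff c t q : 0 < t < tau -> (chart X c @` dom X c) q -> differentiable (U c) (t, q).
Proof. by move=> tt Vq; have [h _] := U_C1 c; apply: h; split=> //=; rewrite in_itv. Qed.

Lemma pairing_Du c t q v : 0 < t < tau -> (chart X c @` dom X c) q ->
  pairing (Du c t q) v = Dd (U c) (t, q) (0, v).
Proof. by move=> tt Vq; rewrite pairing_gr; have [_ ->] := Dd_partial_snd (U_diff tt Vq). Qed.

Lemma loc_graph c x t : dom X c x -> 0 < t < tau ->
  loc X c (x, DM X (u t) x) = (chart X c x, Du c t (chart X c x)).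
Proof.
move=> d tt; rewrite /loc/=; congr (_, _).
have d1 : differentiable (u t \o param X x) (chart X x x).
  have [h _] := Dd_partial_snd (U_diff tt (ex_intro2 _ _ x (mem_dom X x) erefl)).
  exact: h.
have -> : DM X (u t) x = gr (u t \o param X x) (chart X x x) by rewrite /DM grE.
by rewrite -gr_change_chart//; exact: mem_dom.
Qed.

Lemma Du_continuous c t q : 0 < t < tau -> (chart X c @` dom X c) q ->
  forall e : R, 0 < e -> exists2 d : R, 0 < d & forall q', `|q' - q| < d ->
    (chart X c @` dom X c) q' /\ `|Du c t q' - Du c t q| <= e.
Proof.
move=> tt Vq e e0; set V := chart X c @` dom X c.
have nV : nbhs q V by apply: open_nbhs_nbhs; split=> //; exact: open_image_chart.
have H1 : \forall q' \near q, V q' /\ forall i, `|Du c t q 0 i - Du c t q' 0 i| <= e.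
  have : \forall q' \near q, forall i, V q' -> `|Du c t q 0 i - Du c t q' 0 i| <= e.
    apply: near_forall_ord => i.
    have [_ C1] := Ck_diffE (U_C1 c).
    have ci : {for q, continuous (fun q' => Dd (U c) (t, q') (0, delta_mx 0 i))}.
      have ctq : {for (t, q), continuous (fun a : R * E => Dd (U c) a (0, delta_mx 0 i))}.
        by apply: C1; split=> //=; rewrite in_itv.
      exact: (slice_continuous (V := R) (W := E) (Z := R) ctq).
    have /cvgrPdist_le/(_ _ e0) := ci; apply: filterS => q' /= h Vq'.
    by rewrite -!pairing_delta !pairing_Du.
  by apply: filterS2 nV => q' Vq' h; split=> // i; exact: h.
have /nbhs_ballP[d /= d0 Hd] := H1; exists d => // q' qd.
have [|Vq' h] := Hd q'; first by rewrite -ball_normE/= distrC.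
split=> //; apply: rv_norm_le; first exact: ltW.
by move=> i; rewrite coordB distrC.
Qed.

Lemma loc_inj c z z' : dom X c z.1 -> dom X c z'.1 -> loc X c z = loc X c z' -> z = z'.
Proof.
case: z z' => [x p] [x' p'] /= d d' [h1 h2].
have xx : x = x' by rewrite -(chartK d) h1 chartK.
subst x'; congr (_, _); rewrite -[p](cc_id _ (mem_dom X x)) -[p'](cc_id _ (mem_dom X x)).
by rewrite -(cc_comp p (mem_dom X x) d (mem_dom X x)) h2 cc_comp//; exact: mem_dom.
Qed.

Lemma loc_cc c x p : dom X c x -> loc X c (x, cc X c x x p) = (chart X c x, p).
Proof. by move=> d; rewrite /loc/= cc_comp ?cc_id//; exact: mem_dom. Qed.

Lemma cc_loc c x p : dom X c x -> cc X c x x (cc X x c x p) = p.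
Proof. by move=> d; rewrite cc_comp ?cc_id//; exact: mem_dom. Qed.

(** At the single time [tau / 2] the energy is continuous along the graph of Du, hence bounded on
    the compact [M]. Its conservation extends the bound to [G], and from [G] to all times. *)
Lemma energy_bound : exists E0 : R, (forall z, G z -> H z.1 z.2 <= E0) /\
  forall t x, 0 < t < tau -> H x (DM X (u t) x) <= E0.
Proof.
have tau_pos := tau_gt0; pose t0 := tau / 2; have tt : 0 < t0 < tau by rewrite /t0; apply/andP; split; lra.
pose F x := H x (DM X (u t0) x).
have cF x : [set: M] x -> {for x, continuous F}.
  move=> _; have d := mem_dom X x; have Vq : (chart X x @` dom X x) (chart X x x) by exists x.
  apply/cvgrPdist_le => e e0.
  have cH := differentiable_continuous (Hl_diff H_tonelli (Du x t0 (chart X x x)) Vq).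
  have /cvgrPdist_le/(_ _ e0)/nbhs_ballP[d1 /= d10 Hd1] := cH.
  have d12 : 0 < d1 / 2 by rewrite divr_gt0.
  have [d2 d20 Hd2] := Du_continuous tt Vq d12.
  have : \forall y \near x, dom X x y /\ `|chart X x y - chart X x x| < Num.min (d1 / 2) d2.
    have h : \forall y \near x, `|chart X x y - chart X x x| < Num.min (d1 / 2) d2.
      apply: (@chart_nbhs _ _ _ X x x (fun q => `|q - chart X x x| < Num.min (d1 / 2) d2) d).
      apply/nbhs_ballP; exists (Num.min (d1 / 2) d2) => /=; first by rewrite lt_min d12.
      by move=> q; rewrite -ball_normE/= distrC.
    by apply: filterS2 (dom_nbhs d) h.
  apply: filterS => y [dy]; rewrite lt_min => /andP[y1 y2].
  have EF x' : dom X x x' -> F x' = Hl X H x (chart X x x', Du x t0 (chart X x x')).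
    by move=> d'; rewrite -(loc_graph d' tt) -loc_energy.
  rewrite !EF//; apply: Hd1; rewrite -ball_normE/= pairB.
  have [_ h2] := Hd2 _ y2.
  have : `|(chart X x x - chart X x y, Du x t0 (chart X x x) - Du x t0 (chart X x y))| <= d1 / 2.
    by rewrite prod_norm_le [X in X <= _]distrC (ltW y1) distrC.
  by move=> /le_lt_trans; apply; lra.
have [E0 _ HE] := continuous_compact_bounded M_compact cF.
have HG z : G z -> H z.1 z.2 <= E0.
  move=> Gz; rewrite -(flow_energy H_tonelli Phi_flow z (- t0)) (graph_to tt Gz)/=.
  by apply: le_trans (ler_norm _) _; exact: (HE _ I).
exists E0; split=> // t x ht; have [z Gz hz] := graph_from x ht.
have := flow_energy H_tonelli Phi_flow z (- t); rewrite hz/= => ->; exact: HG.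
Qed.

Lemma run_start sg s0 z : run Phi sg s0 z 0 = Phi s0 z.
Proof. by rewrite /run mulr0 addr0. Qed.

Lemma run_end s z : run Phi 1 (- s) z s = z.
Proof. by rewrite /run mul1r addNr; have [-> _] := Phi_flow z. Qed.

(* For small s0 the map Phi^(-s0) is bi-Lipschitz in the chart, and it sends G to the graph
   of Du(s0), which is closed. *)
Lemma G_closed c x p : dom X c x ->
  (forall e : R, 0 < e -> exists z, [/\ G z, dom X c z.1 &
     `|loc X c z - (chart X c x, p)| < e]) ->
  G (x, cc X c x x p).
Proof.
move=> d Hp; have [E0 [HG _]] := energy_bound.
have [r [B [K LD]]] := local_data_exists H_tonelli (E0 + 1) d.
have [r0 B0 K0 rV _] := LD.
have Vq : (chart X c @` dom X c) (chart X c x) by exists x.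
set zb := (x, cc X c x x p).
have lzb : loc X c zb = (chart X c x, p) by exact: loc_cc.
have GE z : G z -> H z.1 z.2 <= E0 + 1 by move=> /HG; lra.
(* The limit point is not yet known to belong to [G]: its energy is compared with that of a nearby
   point of [G], at the price of the slack 1. *)
have Hzb : H zb.1 zb.2 <= E0 + 1.
  have cH := differentiable_continuous (Hl_diff H_tonelli p Vq).
  have /cvgrPdist_le/(_ _ ltr01)/nbhs_ballP[d1 /= d10 Hd1] := cH.
  have [z [Gz dz hz]] := Hp _ d10.
  have := Hd1 (loc X c z); rewrite -ball_normE/= distrC => /(_ hz).
  rewrite -loc_energy// -lzb -loc_energy// => h.
  have := HG _ Gz; move: h; rewrite ler_norml => /andP[_]; lra.
(* A time at which [graphE] applies, [gronwall_short] holds, and orbits stay in the chart ball in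
   both directions. *)
pose s0 := Num.min (tau / 2) (Num.min (2^-1 / K) (r / 8 / K)).
have s00 : 0 < s0 by rewrite /s0 !lt_min !divr_gt0// invr_gt0.
have tt : 0 < s0 < tau.
  have tau_pos := tau_gt0; rewrite s00 /=; apply: (@le_lt_trans _ _ (tau / 2)); last by lra.
  by rewrite /s0 ge_min lexx.
have Ks0 : K * s0 <= 2^-1.
  by rewrite mulrC -ler_pdivlMr// /s0 !ge_min lexx orbT.
have Kr : K * s0 <= r / 8.
  by rewrite mulrC -ler_pdivlMr// /s0 !ge_min lexx !orbT.
have Ks s : 0 <= s <= s0 -> K * s < r / 2.
  move=> /andP[_ h]; apply: (@le_lt_trans _ _ (K * s0)); first by rewrite ler_wpM2l// ltW.
  by apply: le_lt_trans Kr _; lra.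
have N1 : `|- 1 : R| = 1 by rewrite normrN normr1.
have P0 z : Phi 0 z = z by have [-> _] := Phi_flow z.
have back z : H z.1 z.2 <= E0 + 1 -> dom X c z.1 -> `|chart X c z.1 - chart X c x| <= r / 2 ->
    forall t, 0 <= t <= s0 ->
    [/\ dom X c (run Phi (-1) 0 z t).1, box (chart X c x) r B (loc X c (run Phi (-1) 0 z t)) &
      `|loc X c (run Phi (-1) 0 z t) - loc X c z| <= K * t].
  move=> Hz dz zr t tT; have := run_short M_hausdorff H_tonelli Phi_flow LD (t := t) N1 Hz (s0 := 0).
  rewrite !run_start !P0; apply => //; [by case/andP: tT|exact: Ks].
have r2 : 0 <= r / 2 by rewrite divr_ge0// ltW.
have zb2 : `|chart X c zb.1 - chart X c x| <= r / 2 by rewrite subrr normr0.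
have bzb := back zb Hzb d zb2.
have s0s0 : 0 <= s0 <= s0 by rewrite (ltW s00) lexx.
have z0s0 : 0 <= (0 : R) <= s0 by rewrite lexx ltW.
have runN z : run Phi (-1) 0 z s0 = Phi (- s0) z by rewrite /run add0r mulN1r.
have [dy by_ hy] := bzb s0 s0s0; rewrite runN in dy by_ hy.
have chy : `|chart X c (Phi (- s0) zb).1 - chart X c x| <= r / 8.
  have := le_trans (fst_norm_le _) hy; rewrite lzb /= => h; exact: le_trans h Kr.
have VY : (chart X c @` dom X c) (chart X c (Phi (- s0) zb).1) by exists (Phi (- s0) zb).1.
(* The image of the limit point lies on the graph of Du(s0): nearby points of [G] have images on
   this graph that are at most twice as far, and Du(s0) is continuous. *)
have Y : (loc X c (Phi (- s0) zb)).2 = Du c s0 (chart X c (Phi (- s0) zb).1).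
  apply/eqP; rewrite -subr_eq0 -normr_le0; apply/ler_addgt0Pr => e e0; rewrite add0r.
  have e3 : 0 < e / 3 by rewrite divr_gt0.
  have [d1 d10 Hd1] := Du_continuous tt VY e3.
  pose e' := Num.min (r / 2) (Num.min (d1 / 3) (e / 3)).
  have e'0 : 0 < e' by rewrite /e' !lt_min !divr_gt0.
  have [z [Gz dz hz]] := Hp _ e'0.
  have zr : `|chart X c z.1 - chart X c x| <= r / 2.
    have := le_lt_trans (fst_norm_le _) hz; rewrite /= => /ltW/le_trans; apply.
    by rewrite /e' ge_min lexx.
  have bz := back z (GE _ Gz) dz zr.
  have gr := run_gronwall H_tonelli Phi_flow LD N1 (ltW s00) Ks0
    (fun t h => let: And3 a b _ := bz t h in conj a b)
    (fun t h => let: And3 a b _ := bzb t h in conj a b) s0s0 z0s0.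
  rewrite !runN !run_start !P0 lzb in gr.
  have [dz1 _ _] := bz s0 s0s0; rewrite runN in dz1.
  have lz : loc X c (Phi (- s0) z) =
      (chart X c (Phi (- s0) z).1, Du c s0 (chart X c (Phi (- s0) z).1)).
    by rewrite (graph_to tt Gz) loc_graph//.
  have c1 : `|chart X c (Phi (- s0) z).1 - chart X c (Phi (- s0) zb).1| < d1.
    apply: le_lt_trans (le_trans (fst_norm_le _) gr) _.
    have := hz; rewrite /e' !lt_min => /and3P[_ h _]; lra.
  have [_ h1] := Hd1 _ c1.
  have h2 := le_trans (snd_norm_le _) gr; rewrite lz/= in h2.
  have h3 : `|loc X c z - (chart X c x, p)| < e / 3.
    by have := hz; rewrite /e' !lt_min => /and3P[].
  rewrite -(subrK (Du c s0 (chart X c (Phi (- s0) z).1)) (loc X c _).2) -addrA.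
  apply: le_trans (ler_normD _ _) _; rewrite distrC; lra.
(* A point of [G] with the same image as the limit point. The forward estimate, with initial
   distance 0, identifies the two. *)
have [w Gw hw] := graph_from (Phi (- s0) zb).1 tt.
have hw' : Phi (- s0) w = Phi (- s0) zb.
  rewrite hw; apply: (@loc_inj c) => //=.
  by rewrite loc_graph// -Y.
have forth z : H z.1 z.2 <= E0 + 1 -> Phi (- s0) z = Phi (- s0) zb ->
    forall t, 0 <= t <= s0 ->
    dom X c (run Phi 1 (- s0) z t).1 /\ box (chart X c x) r B (loc X c (run Phi 1 (- s0) z t)).
  move=> Hz zE t tT; have := run_short M_hausdorff H_tonelli Phi_flow LD (t := t) (normr1 _) Hz (s0 := - s0).
  rewrite !run_start zE => /(_ dy)[]//; last by exact: Ks.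
    by apply: le_trans chy _; lra.
  by case/andP: tT.
have := run_gronwall H_tonelli Phi_flow LD (normr1 _) (ltW s00) Ks0
  (forth w (GE _ Gw) hw') (forth zb Hzb erefl) s0s0 z0s0.
rewrite !run_end !run_start hw' subrr normr0 mulr0 normr_le0 subr_eq0 => /eqP lw.
have [dw _] := forth w (GE _ Gw) hw' s0 s0s0; rewrite run_end in dw.
by rewrite -/zb -(loc_inj dw _ lw).
Qed.

(** Following the flow forward for the small time [s] brings [Phi (- s) z] back to [z] and moves it
    by at most [K * s]. So [z] itself is close to the limit, and [G_closed] applies. *)
Lemma G_limit c x p : dom X c x ->
  (forall e : R, 0 < e -> exists s z, [/\ 0 <= s < e, G z, dom X c (Phi (- s) z).1 &
     `|loc X c (Phi (- s) z) - (chart X c x, p)| < e]) ->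
  G (x, cc X c x x p).
Proof.
move=> d Hp; have [E0 [HG _]] := energy_bound.
have [r [B [K LD]]] := local_data_exists H_tonelli E0 d.
have [r0 B0 K0 rV _] := LD.
apply: G_closed => // e e0.
pose e' := Num.min (Num.min (r / 2) (r / 2 / K)) (Num.min (e / 2) (e / 2 / K)).
have e'0 : 0 < e' by rewrite /e' !lt_min !divr_gt0.
have [s [z [/andP[s0 se] Gz dz hz]]] := Hp _ e'0.
have [e1 e2 e3 e4] : [/\ e' <= r / 2, K * e' <= r / 2, e' <= e / 2 & K * e' <= e / 2].
  by split; rewrite ?[K * _]mulrC -?ler_pdivlMr// /e' !ge_min lexx ?orbT.
have Ks : K * s < K * e' by rewrite ltr_pM2l.
have := run_short M_hausdorff H_tonelli Phi_flow LD (t := s) (normr1 _) (HG _ Gz) (s0 := - s).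
rewrite run_start run_end => /(_ dz)[]//.
- apply: le_trans (le_trans (ltW (le_lt_trans (fst_norm_le _) hz)) e1) _.
  by [].
- exact: lt_le_trans Ks e2.
move=> dz' _ h; exists z; split=> //.
rewrite -(subrK (loc X c (Phi (- s) z)) (loc X c z)) -addrA.
apply: le_lt_trans (ler_normD _ _) _; lra.
Qed.

(** Upper semicontinuity of D^+phi at [x], jointly with small times. Otherwise a sequence of
    counterexamples, whose momenta are bounded by the energy, would have a cluster point; by
    [G_limit] it lies in [G] over [x]. *)
Lemma G_near c x : dom X c x -> forall e : R, 0 < e -> exists2 d : R, 0 < d &
  forall s z, 0 <= s < d -> G z -> dom X c (Phi (- s) z).1 ->
    `|chart X c (Phi (- s) z).1 - chart X c x| < d ->
  exists2 p, G (x, p) & `|(loc X c (Phi (- s) z)).2 - cc X x c x p| < e.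
Proof.
move=> d e e0; have [E0 [HG _]] := energy_bound.
have [r [B [K LD]]] := local_data_exists H_tonelli E0 d.
have [r0 B0 K0 rV _] := LD.
apply: contrapT => Hn.
have /choice[F HF] : forall k : nat, exists sz : R * (M * E),
  [/\ 0 <= sz.1 < k.+1%:R^-1, G sz.2, dom X c (Phi (- sz.1) sz.2).1,
    `|chart X c (Phi (- sz.1) sz.2).1 - chart X c x| < k.+1%:R^-1 &
    ~ exists2 p, G (x, p) & `|(loc X c (Phi (- sz.1) sz.2)).2 - cc X x c x p| < e].
  move=> k; apply: contrapT => Hk; apply: Hn; exists k.+1%:R^-1; first by rewrite invr_gt0.
  move=> s z h1 h2 h3 h4; apply: contrapT => h5; apply: Hk.
  by exists (s, z).
pose P k := (loc X c (Phi (- (F k).1) (F k).2)).2.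
have small (e' : R) : 0 < e' -> exists N, forall k, (N <= k)%N -> k.+1%:R^-1 < e'.
  move=> e'0; have [N _ HN] := near_infty_natSinv_lt (PosNum e'0).
  by exists N => k Nk; exact: HN.
have [N0 HN0] := small _ r0.
have PB k : (N0 <= k)%N -> `|P k| <= B.
  move=> /HN0 kr; have [_ Gk dk ck _] := HF k.
  have [] // := in_box LD (z := Phi (- (F k).1) (F k).2) _ dk (ltW (lt_trans ck kr)).
  by rewrite (flow_energy H_tonelli Phi_flow); exact: HG.
have [Q HQ] := bounded_seq_cluster PB.
have GQ : G (x, cc X c x x Q).
  apply: G_limit => // e' e'0; have [N HN] := small _ e'0.
  have [k Nk hk] := HQ _ e'0 N; have [/andP[s1 s2] Gk dk ck _] := HF k.
  exists (F k).1, (F k).2; split=> //; first by rewrite s1 (lt_trans s2 (HN _ Nk)).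
  rewrite [loc _ _ _]surjective_pairing pairB prod_normE gt_max hk andbT.
  exact: lt_trans ck (HN _ Nk).
have [k _ hk] := HQ _ e0 0%N; have [_ _ _ _ hn] := HF k.
by apply: hn; exists (cc X c x x Q) => //; rewrite cc_comp ?cc_id//; exact: mem_dom.
Qed.

(** The graph of Du(s) has a point over [x]; for small [s], [G_near] provides a point of [G] over
    [x] close to it. *)
Lemma G_nonempty x : exists p, G (x, p).
Proof.
have [d d0 Hd] := G_near (mem_dom X x) ltr01.
pose s := Num.min (tau / 2) (d / 2).
have s0 : 0 < s by rewrite /s lt_min !divr_gt0.
have st : s <= tau / 2 by rewrite /s ge_min lexx.
have sd : s <= d / 2 by rewrite /s ge_min lexx orbT.
have tt : 0 < s < tau by have := tau_gt0; rewrite s0 /=; lra.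
have [z Gz hz] := graph_from x tt.
have := Hd s z; rewrite hz/= subrr normr0 => -[]//; last by move=> p; exists p.
  by rewrite (ltW s0)/=; lra.
exact: mem_dom.
Qed.

(** The fibre of [G] over [x] is bounded by the energy bound and closed by [G_closed], hence
    compact. *)
Lemma G_minimizer x : exists2 p, G (x, p) & forall p', G (x, p') -> H x p <= H x p'.
Proof.
have d := mem_dom X x; have [E0 [HG _]] := energy_bound.
have [r [B [K LD]]] := local_data_exists H_tonelli E0 d.
have [r0 B0 K0 rV [hB _ _]] := LD.
pose A := [set p | G (x, p)].
have A0 : A !=set0 by exact: G_nonempty.
have Vq : (chart X x @` dom X x) (chart X x x) by exists x.
have cA : compact A.
  apply: bounded_closed_compact.
    exists B; split; first exact: num_real.
    move=> s Bs p /= /HG/= hp; have := hB x p d _ hp.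
    by rewrite subrr normr0 cc_id// => /(_ (ltW r0)) h; apply: le_trans h _; lra.
  move=> p clp; rewrite /A/= -[p](cc_id _ d).
  apply: G_closed => // e e0; have [p' [Gp']] := clp (ball p e) (nbhsx_ballx p e e0).
  rewrite -ball_normE/= => hp'; exists (x, p'); split=> //.
  rewrite /loc/= cc_id// pairB prod_normE gt_max subrr normr0 e0/= distrC//.
have cH : {within A, continuous (H x)}.
  apply: continuous_subspaceT => p.
  have -> : H x = Hl X H x \o (fun p => (chart X x x, p)).
    by apply/funext => p'; rewrite /= Hl_chart// cc_id.
  apply: (@continuous_comp _ _ _ (fun p : E => (chart X x x, p)) (Hl X H x)).
    exact: pair_cst_continuous.
  exact: differentiable_continuous (Hl_diff H_tonelli p Vq).
have [p /set_mem Ap Hp] := compact_EVT_min A0 cA cH.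
by exists p => // p' Gp'; apply: Hp; exact/mem_set.
Qed.

(** The point of the graph of Du(s) over [y] is within [e / K] of some point of [G] over [x], where
    the energy is at least [m]; [K] is a Lipschitz constant of the local Hamiltonian. *)
Lemma energy_liminf c x (m : R) : dom X c x -> (forall p, G (x, p) -> m <= H x p) ->
  forall e : R, 0 < e -> exists2 d : R, 0 < d & forall s y, 0 < s < d -> dom X c y ->
    `|chart X c y - chart X c x| < d -> s < tau -> m - e <= H y (DM X (u s) y).
Proof.
move=> d Hm e e0; have [E0 [HG HU]] := energy_bound.
have [r [B [K LD]]] := local_data_exists H_tonelli E0 d.
have [r0 B0 K0 rV [hB hL _]] := LD.
have e1 : 0 < e / K by rewrite divr_gt0.
have [d1 d10 Hd1] := G_near d e1.
pose d2 := Num.min r (Num.min d1 (e / K)).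
have d20 : 0 < d2 by rewrite /d2 !lt_min r0 d10.
exists d2 => // s y /andP[s0]; rewrite /d2 !lt_min => /and3P[s1 s2 s3] dy /and3P[y1 y2 y3] st.
have tt : 0 < s < tau by rewrite s0.
have [z Gz hz] := graph_from y tt.
have [|||p Gp hp] := Hd1 s z _ Gz; rewrite ?hz//; first by rewrite ltW.
rewrite hz in hp; have Hx := Hm _ Gp.
have b1 : box (chart X c x) r B (loc X c (y, DM X (u s) y)).
  by apply: (in_box LD) => //=; [exact: HU|exact: ltW].
have b2 : box (chart X c x) r B (loc X c (x, p)).
  by apply: (in_box LD) => //=; [exact: (HG _ Gp)|rewrite subrr normr0 ltW].
have [h _ _] := hL _ _ b1 b2; rewrite -!loc_energy//= in h.
have : `|loc X c (x, p) - loc X c (y, DM X (u s) y)| <= e / K.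
  rewrite distrC [loc X c (y, _)]surjective_pairing pairB prod_norm_le.
  by rewrite (ltW hp) andbT ltW.
move=> h'; have : `|H x p - H y (DM X (u s) y)| <= e.
  by apply: le_trans h _; rewrite mulrC -ler_pdivlMr.
by rewrite ler_norml => /andP[]; lra.
Qed.

End Propagation.

(** * Short-time behaviour of the Lax-Oleinik operator *)

Section LowerIntegral.
Variable R : realType.
Local Notation mu := (@lebesgue_measure R).
Local Open Scope ereal_scope.

(* The library version asks for measurability. *)
Lemma ge0_le_integral_nonmeasurable d (T : measurableType d)
    (nu : {measure set T -> \bar R}) (D : set T) (f1 f2 : T -> \bar R) :
  (forall x, 0 <= f1 x) -> (forall x, f1 x <= f2 x) ->
  \int[nu]_(x in D) f1 x <= \int[nu]_(x in D) f2 x.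
Proof.
move=> f10 f12; have f20 x : 0 <= f2 x := le_trans (f10 x) (f12 x).
rewrite !(integral_mkcond D) !ge0_integralTE; last 2 first.
  by move=> x; exact: erestrict_ge0.
  by move=> x; exact: erestrict_ge0.
apply: ereal_sup_le => _ [h hf <-]; exists h => // x; apply: le_trans (hf x) _.
by apply: lee_restrict => y _.
Qed.

(** The positive part has a nonnegative integral and the negative part one of at most [C * t], for
    an arbitrary function [f]. *)
Lemma integral_lower_bound (f : R -> R) (C t : R) : (0 <= t)%R -> (0 <= C)%R ->
  (forall s, - C <= f s)%R ->
  (- (C * t))%:E <= \int[mu]_(s in `[0%R, t]) (f s)%:E.
Proof.
move=> t0 C0 Hf; rewrite integralE.
have h1 : \int[mu]_(s in `[0%R, t]) ((fun s => (f s)%:E)^\- s) <= (C * t)%:E.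
  apply: (@le_trans _ _ (\int[mu]_(s in `[0%R, t]) cst C%:E s)).
    apply: ge0_le_integral_nonmeasurable => s; first exact: funeneg_ge0.
    by rewrite funenegE/= ge_max !lee_fin C0 andbT lerNl Hf.
  rewrite integral_cst//= lebesgue_measure_itv/= lte_fin.
  case: ifP => _; first by rewrite -EFinD subr0.
  by rewrite mule0 lee_fin mulr_ge0.
have h2 : 0 <= \int[mu]_(s in `[0%R, t]) ((fun s => (f s)%:E)^\+ s).
  by apply: integral_ge0 => s _; exact: funepos_ge0.
by rewrite EFinN -[X in X <= _]add0e; apply: leeB.
Qed.

End LowerIntegral.

Section Action.
Variables (R : realType) (n : nat) (M : topologicalType).
Variables (X : smooth_structure R n M) (g : riemannian_metric X).
Hypotheses (M_hausdorff : hausdorff_space M) (M_compact : compact [set: M]).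
Hypothesis M_connected : connected [set: M].
Local Notation E := 'rV[R]_n.
Local Notation mu := (@lebesgue_measure R).
Variable H : M -> E -> R.
Hypothesis H_tonelli : tonelli g H.
Implicit Types (c x y z : M) (t s : R).

Lemma dist_refl x : dist g x x = 0.
Proof.
have [r [C [r0 C0 _ h]]] := dist_upper g (mem_dom X x).
have xx : `|chart X x x - chart X x x| < r by rewrite subrr normr0.
have [_] := h x x (mem_dom X x) (mem_dom X x) xx xx; rewrite subrr normr0.
by rewrite mulr0 => h0; apply/le_anti; rewrite h0 dist_ge0.
Qed.

(* The supremum of an unbounded set is 0. *)
Lemma lagrangian_lower_bound : exists2 C : R, 0 <= C & forall x v, - C <= lagrangian H x v.
Proof.
have cH x : [set: M] x -> {for x, continuous (fun x => H x 0)}.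
  move=> _; have d := mem_dom X x; have Vq : (chart X x @` dom X x) (chart X x x) by exists x.
  have cHl := differentiable_continuous (Hl_diff H_tonelli 0 Vq).
  apply/cvgrPdist_le => e e0.
  have /cvgrPdist_le/(_ _ e0)/nbhs_ballP[d1 /= d10 Hd1] := cHl.
  have h : \forall y \near x, `|chart X x y - chart X x x| < d1.
    apply: (@chart_nbhs _ _ _ X x x (fun q => `|q - chart X x x| < d1) d).
    by apply/nbhs_ballP; exists d1 => //= q; rewrite -ball_normE/= distrC.
  apply: filterS2 (dom_nbhs d) h => y dy hy.
  have EH z : dom X x z -> H z 0 = Hl X H x (chart X x z, 0).
    move=> dz; rewrite Hl_chart//; congr (H z _).
    by have := ccZ X x z z 0 0; rewrite !scale0r => ->.
  rewrite !EH//; apply: Hd1; rewrite -ball_normE/= pairB subrr prod_normE gt_max normr0 d10 andbT.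
  by rewrite distrC.
have [C C0 HC] := continuous_compact_bounded M_compact cH.
exists C => // x v; rewrite /lagrangian; set S := (X in sup X).
have [hs|hs] := pselect (has_sup S); last by rewrite sup_out// oppr_le0.
apply: (@le_trans _ _ (- H x 0)).
  by rewrite lerN2; apply: le_trans (ler_norm _) _; exact: HC.
case: hs => _ hub; apply: ub_le_sup => //; exists 0 => //.
by rewrite -(scale0r (0 : E)) pairingZl mul0r add0r.
Qed.

(* [fine] sends an infinite action to 0, which is not below the bound. *)
Lemma action_ge : exists2 C : R, 0 <= C & forall t x y, 0 < t -> - (C * t) <= action g H t x y.
Proof.
have [C C0 HC] := lagrangian_lower_bound; exists C => // t x y t0.
rewrite /action; set I := ereal_inf _.
have : ((- (C * t))%:E <= I)%E.
  apply: le_ereal_inf_tmp => _ [xi _ <-].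
  by apply: (@integral_lower_bound R (fun s => lagrangian H (xi s) (velocity X xi s))) => //; exact: ltW.
by case: I => [r||] //= _; rewrite oppr_le0 mulr_ge0// ltW.
Qed.

Lemma velocity_cst x s : velocity X (cst x) s = 0.
Proof.
rewrite /velocity (_ : chart X (cst x s) \o cst x = cst (chart X x x))//.
exact: derive1_cst.
Qed.

(** The constant curve is a competitor. The absolute value also covers an infimum equal to -oo,
    which [fine] sends to 0. *)
Lemma action_const_le t x : 0 < t ->
  action g H t x x <= t * `|lagrangian H x 0|.
Proof.
move=> t0; rewrite /action; set I := ereal_inf _.
have : (I <= (t * lagrangian H x 0)%:E)%E.
  apply: ge_ereal_inf; exists (t * lagrangian H x 0)%:E => //.
  exists (cst x).
    split=> // e e0; exists 1 => // m u v _ _ _.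
    by rewrite big1// => i _; rewrite dist_refl.
  rewrite (eq_integral (cst (lagrangian H x 0)%:E)).
    rewrite integral_cst//= lebesgue_measure_itv/= lte_fin t0 -EFinD subr0 -EFinM.
    by rewrite mulrC.
  by move=> s _; rewrite /= velocity_cst.
case: I => [r||] //=.
  rewrite lee_fin => h; apply: le_trans h _; rewrite ler_wpM2l ?(ltW t0)//.
  exact: ler_norm.
by move=> _; rewrite mulr_ge0// ltW.
Qed.

Variables (phi : M -> R) (tau : R).
Hypothesis tau_phi : tau_local g H phi tau.

Lemma Tplus_attained t x : 0 < t <= tau ->
  exists2 y, Tplus_maximizer g H phi t x y & Tplus g H t phi x = phi y - action g H t x y.
Proof.
move=> tt; have [l0 _ /(_ t x tt)[_ _ _ [y [my _]]]] := tau_phi.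
have /andP[t0 _] := tt.
exists y => //; rewrite /Tplus (gt_eqF t0); apply/le_anti/andP; split.
  apply: ge_sup; first by exists (phi y - action g H t x y), y.
  by move=> _ [z _ <-]; exact: my.
apply: ub_le_sup; last by exists y.
by exists (phi y - action g H t x y) => _ [z _ <-]; exact: my.
Qed.

(** The point [x] itself is a competitor in the supremum. *)
Lemma Tplus_lower x : forall e : R, 0 < e -> exists2 d : R, 0 < d & forall s, 0 < s < d ->
  s <= tau -> phi x - e <= Tplus g H s phi x.
Proof.
move=> e e0; have L0 : 0 < `|lagrangian H x 0| + 1 by rewrite ltr_wpDl.
exists (e / (`|lagrangian H x 0| + 1)); first by rewrite divr_gt0.
move=> s /andP[s0 sd] st; have [|y my ->] := @Tplus_attained s x; first by rewrite s0.
apply: le_trans (my x); rewrite lerB//; apply: le_trans (action_const_le _ s0) _.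
rewrite ltr_pdivlMr// in sd; apply: le_trans (ltW sd).
by rewrite ler_wpM2l ?(ltW s0)// lerDl.
Qed.

(** The maximizer [z] lies within [l0 * s] of [x], hence close to [y]. There [phi] is below a C^1
    function that equals it at [y], and the action is at least [- C * s]. *)
Lemma Tplus_upper c y : (exists p, superdifferential g phi y p) -> dom X c y ->
  forall e : R, 0 < e -> exists2 d : R, 0 < d & forall s x, 0 < s < d -> s <= tau ->
    dom X c x -> `|chart X c x - chart X c y| < d -> Tplus g H s phi x <= phi y + e.
Proof.
move=> [p [r [psi [r0 Cpsi hpsi psiy _]]]] dy e e0.
have [C C0 HC] := action_ge; have [l0 l00 Hl0] := tau_phi.
have e2 : 0 < e / 2 by rewrite divr_gt0.
have cpsi : {for chart X c y, continuous (psi \o param X c)}.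
  apply: (Ck_lower (Cpsi c)); exists y => //; split=> //.
  by rewrite /dball/= dist_refl.
have /cvgrPdist_le/(_ _ e2)/nbhs_ballP[d1 /= d10 Hd1] := cpsi.
have [r2 [C2 [r20 C20 _ H2]]] := dist_upper g dy.
have [r3 [C3 [r30 C30 _ H3]]] := dist_chart g M_hausdorff M_connected dy.
pose m := Num.min d1 (Num.min r2 (r / C2)).
have m0 : 0 < m by rewrite /m !lt_min d10 r20 divr_gt0.
(* For [s] and |x - y| below [m / K], the coordinate distance of [z] from [y] is less than |x - y| +
   C3 l0 s, hence less than [m]. *)
pose K := 1 + C3 * l0; have K0 : 0 < K by rewrite ltr_wpDr// mulr_ge0// ltW.
pose d := Num.min (Num.min (m / K) r3) (Num.min (r3 / l0) (e / 2 / (C + 1))).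
have C1 : 0 < C + 1 by rewrite ltr_wpDl.
have d0 : 0 < d by rewrite /d !lt_min r30 !divr_gt0.
exists d => // s x /andP[s0]; rewrite /d !lt_min => /andP[/andP[s1 s2] /andP[s3 s4]] st dx
  /andP[/andP[x1 x2] /andP[x3 x4]].
have tt : 0 < s <= tau by rewrite s0.
have [z mz ->] := @Tplus_attained s x tt.
have [/(_ z mz) zb _ _ _] := Hl0 s x tt; rewrite /dball/= in zb.
have D3 : l0 * s < r3 by rewrite mulrC -ltr_pdivlMr.
have [dz hz] := H3 x z (l0 * s) dx x2 (or_introl (ltW zb)) D3.
have zm : `|chart X c z - chart X c y| < m.
  rewrite -[chart X c z](subrK (chart X c x)) -addrA; apply: le_lt_trans (ler_normD _ _) _.
  apply: (@le_lt_trans _ _ (C3 * (l0 * s) + `|chart X c x - chart X c y|)).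
    by rewrite lerD2r.
  apply: (@lt_le_trans _ _ (C3 * (l0 * (m / K)) + m / K)).
    apply: ler_ltD => //; apply: ler_wpM2l; first exact: ltW.
    by apply: ler_wpM2l; [exact: ltW|exact: ltW].
  have -> : C3 * (l0 * (m / K)) + m / K = K * (m / K) by rewrite mulrA /K mulrDl mul1r addrC.
  by rewrite mulrC divfK// gt_eqF.
have [z1 z2 z3] : [/\ `|chart X c z - chart X c y| < d1, `|chart X c z - chart X c y| < r2
   & `|chart X c z - chart X c y| < r / C2].
  by move: zm; rewrite /m !lt_min => /and3P[].
have [_ hyz] := H2 y z dy dz ltac:(by rewrite subrr normr0) z2.
have yz : dball g y r z.
  by rewrite /dball/=; apply: le_lt_trans hyz _; rewrite mulrC -ltr_pdivlMr.
have h1 := hpsi z yz.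
have := Hd1 (chart X c z); rewrite -ball_normE/= distrC => /(_ z1).
rewrite /= !chartK// psiy ler_norml => /andP[h2 _].
have h3 := HC s x z s0.
have h4 : C * s <= e / 2.
  apply: (@le_trans _ _ (s * (C + 1))); first by rewrite mulrC ler_wpM2l ?(ltW s0)// lerDl.
  by rewrite -ler_pdivlMr// ltW.
lra.
Qed.

End Action.

Lemma strip_lipschitz (R : realType) n (f : R * 'rV[R]_n -> R) (I : set R) (V : set 'rV[R]_n)
    (a b : R) q (r : R) : Ck 1 (I `*` V) f ->
  (forall t : R, a <= t <= b -> I t) -> (forall z : 'rV[R]_n, `|z - q| <= r -> V z) ->
  exists2 C : R, 0 <= C & forall t t' z z', a <= t <= b -> a <= t' <= b ->
    `|z - q| <= r -> `|z' - q| <= r -> `|f (t', z') - f (t, z)| <= C * `|(t' - t, z' - z)|.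
Proof.
move=> fC It Vz; have [e [l [lE lle]]] := prod_basis (line_basis R) (rv_basis R n).
pose K := [set y : R * 'rV[R]_n | a <= y.1 <= b /\ `|y.2 - q| <= r].
have cK : compact K.
  have -> : K = [set` `[a, b]] `*` [set z : 'rV[R]_n | `|z - q| <= r].
    by apply/seteqP; split=> -[t z] /= []; rewrite in_itv.
  by apply: compact_setX; [exact: segment_compact|exact: closed_ball_compact].
have KU : K `<=` I `*` V by move=> -[t z] [/= h1 h2]; split; [exact: It|exact: Vz].
have cv x y (s : R) : K x -> K y -> 0 <= s <= 1 -> K (x + s *: (y - x)).
  move=> [/andP[x1 x1'] x2] [/andP[y1 y1'] y2] s01; split=> /=; last exact: closed_ball_convex.
  have /andP[s0 s1] := s01; rewrite /GRing.scale/=.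
  have -> : x.1 + s * (y.1 - x.1) = (1 - s) * x.1 + s * y.1 by ring.
  have s1' : 0 <= 1 - s by rewrite subr_ge0.
  apply/andP; split.
    have -> : a = (1 - s) * a + s * a by ring.
    by apply: lerD; apply: ler_wpM2l.
  have -> : b = (1 - s) * b + s * b by ring.
  by apply: lerD; apply: ler_wpM2l.
have [C C0 HC] := Ck1_lipschitz lE lle fC KU cK cv.
by exists C => // t t' z z' ht ht' hz hz'; apply: (HC (t, z) (t', z')).
Qed.

(** * The energy inequality along a cell *)

Section Convexity.
Variables (R : realType) (n : nat) (M : topologicalType).
Variables (X : smooth_structure R n M) (g : riemannian_metric X).
Local Notation E := 'rV[R]_n.
Variable H : M -> E -> R.
Hypothesis H_tonelli : tonelli g H.
Implicit Types (c x y : M) (q p v w : E).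

Lemma H_C2 x : Ck 2 [set: E] (H x).
Proof.
have d := mem_dom X x; have Vq : (chart X x @` dom X x) (chart X x x) by exists x.
have E1 : H x = fun p => Hl X H x (chart X x x, p).
  by apply/funext => p; rewrite Hl_chart// cc_id.
have [D1 C1] := Ck_diffE (Hl_Ck H_tonelli x).
rewrite E1; split=> [p _|v].
  by have [h _] := Dd_partial_snd (Hl_diff H_tonelli p Vq).
have E2 : (fun p => 'd (fun p => Hl X H x (chart X x x, p)) p v) =
    fun p => Dd (Hl X H x) (chart X x x, p) (0, v).
  apply/funext => p; rewrite DdE.
  by have [_ ->] := Dd_partial_snd (Hl_diff H_tonelli p Vq).
rewrite E2; have [D2 C2] := Ck_diffE (C1 (0, v)).
have D2' p := D2 (chart X x x, p) (conj Vq I : (_ `*` _) (chart X x x, p)).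
split=> [p _|w].
  by have [h _] := Dd_partial_snd (D2' p).
have E3 : (fun p => 'd (fun p => Dd (Hl X H x) (chart X x x, p) (0, v)) p w) =
    fun p => Dd (fun z => Dd (Hl X H x) z (0, v)) (chart X x x, p) (0, w).
  apply/funext => p; rewrite DdE.
  by have [_ ->] := Dd_partial_snd (D2' p).
rewrite E3 => p _.
exact: (slice_continuous (V := E) (W := E) (Z := R) (C2 (0, w) _ (conj Vq I : (_ `*` _) (chart X x x, p)))).
Qed.

Lemma H_convex x p p' : H x p + Dd (H x) p (p' - p) <= H x p'.
Proof.
have [D1 C1] := Ck_diffE (H_C2 x); set w := p' - p.
have [w0|wn0] := eqVneq w 0.
  have -> : p' = p by apply/eqP; rewrite -subr_eq0; exact/eqP.
  have := DdZ (H x) p 0 w; by rewrite scale0r w0 scale0r => ->; rewrite addr0.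
have [D2 _] := Ck_diffE (C1 w).
have d1 (s : R) : is_derive s 1 (fun s : R => H x (p + s *: w)) (Dd (H x) (p + s *: w) w).
  by rewrite -DdE; apply: is_derive_line; exact: D1.
have d2 (s : R) : is_derive s 1 (fun s : R => Dd (H x) (p + s *: w) w)
    (Dd (fun p => Dd (H x) p w) (p + s *: w) w).
  by rewrite -DdE; apply: (is_derive_line (f := fun p => Dd (H x) p w)); exact: D2.
have pos q : 0 <= Dd (fun p => Dd (H x) p w) q w.
  have [_ /(_ x q w wn0) h _] := H_tonelli; rewrite -DdE; apply: ltW.
  rewrite (_ : (fun p => Dd (H x) p w) = fun p => 'd (H x) p w)//.
  by apply/funext => p0; rewrite DdE.
have mono (s : R) : 0 <= s <= 1 -> Dd (H x) p w <= Dd (H x) (p + s *: w) w.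
  move=> /andP[s0 s1].
  have := is_derive_ge_incr s0 (fun t _ => d2 t) (fun t _ => pos _).
  by rewrite mul0r scale0r addr0 subr_ge0.
have := is_derive_ge_incr ler01 (fun t _ => d1 t) mono.
by rewrite subr0 mulr1 scale0r addr0 scale1r /w [p + _]addrC subrK lerBrDl.
Qed.

Lemma Hl_convex c q p p' : (chart X c @` dom X c) q ->
  Hl X H c (q, p) + pairing (Hdp X H c (q, p)) (p' - p) <= Hl X H c (q, p').
Proof.
move=> [x d <-]; rewrite !Hl_chart//.
have [D1 _] := Ck_diffE (H_C2 x).
have [l1 l2] := lin_diff (L := cc X c x x) p (ccD X c x x) (ccZ X c x x).
have -> : pairing (Hdp X H c (chart X c x, p)) (p' - p) =
    Dd (H x) (cc X c x x p) (cc X c x x (p' - p)).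
  have e1 := Dd_comp (p' - p) l1 (D1 _ I); rewrite l2 in e1; rewrite -e1 /Hdp pairing_gr/=.
  congr (Dd _ _ _); apply/funext => p0 /=; by rewrite Hl_chart.
have -> : cc X c x x (p' - p) = cc X c x x p' - cc X c x x p.
  by rewrite ccD -scaleN1r ccZ scaleN1r.
exact: H_convex.
Qed.

End Convexity.

Lemma half_lt (R : realType) (d : R) : 0 < d -> d / 2 < d.
Proof. lra. Qed.

Lemma half_shift (R : realType) (a b h : R) : 0 < h -> h <= (b - a) / 2 -> a < b - h < b.
Proof. by move=> h0 h1; apply/andP; split; lra. Qed.

Lemma sum4_le (R : realType) (L N K : R) : 0 <= L -> 0 <= N -> 0 <= K ->
  L <= L + N + K + 1 /\ N + K <= L + N + K + 1.
Proof. by move=> L0 N0 K0; split; lra. Qed.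

Lemma slope_arith (R : realType) (h h' k P Q : R) : h' <= k -> h + (Q - P) <= h' ->
  0 <= - h + P - Q + k.
Proof. lra. Qed.

(** The closing computation of [cell]: [pa], [pb] are the values of [phi] at the ends of the curve,
    [ua], [ub] those of [u] at the start and at the shortened end, [qa], [qb], [qb'] pairings with
    [Q], and [kk] is the part of the linear term lost by the shortening. *)
Lemma cell_arith (R : realType) (e pa pb ua ub N qa qb qb' kh hc kk ak bk me : R) :
  - kh <= kk -> N + kh <= hc -> hc <= e / 2 -> pa + me <= ua -> ub <= pb + e / 2 ->
  ua - qa + ak <= ub - qb' + (bk - kk) -> qb - qb' <= N ->
  qb - qa - (bk - ak - me) <= pb - pa + e.
Proof. lra. Qed.

Section Cell.
Variables (R : realType) (n : nat) (M : topologicalType).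
Variables (X : smooth_structure R n M) (g : riemannian_metric X).
Hypotheses (M_hausdorff : hausdorff_space M) (M_compact : compact [set: M]).
Local Notation E := 'rV[R]_n.
Variable H : M -> E -> R.
Hypothesis H_tonelli : tonelli g H.
Variable Phi : R -> M * E -> M * E.
Hypothesis Phi_flow : hamiltonian_flow X H Phi.
Variables (u : R -> M -> R) (G : set (M * E)) (tau : R).
Hypothesis tau_gt0 : 0 < tau.
Hypothesis graphE : forall t, 0 < t < tau ->
  [set (x, DM X (u t) x) | x in [set: M]] = Phi (- t) @` G.
Hypothesis U_C1 : forall c, Ck 1 (`]0, tau[ `*` (chart X c @` dom X c)) (U X u c).
Hypothesis u_t : forall t x, 0 < t < tau ->
  derive1 (fun s => u s x) t = H x (DM X (u t) x).
Variable phi : M -> R.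
Hypothesis u_lower : forall x (e : R), 0 < e -> exists2 d : R, 0 < d &
  forall s : R, 0 < s < d -> s < tau -> phi x - e <= u s x.
Hypothesis u_upper : forall c y, dom X c y -> forall e : R, 0 < e -> exists2 d : R, 0 < d &
  forall (s : R) x, 0 < s < d -> s < tau -> dom X c x -> `|chart X c x - chart X c y| < d ->
  u s x <= phi y + e.
Implicit Types (c x y : M) (q p v w : E).

Lemma u_derive t x : 0 < t < tau -> is_derive t 1 (fun s => u s x) (H x (DM X (u t) x)).
Proof.
move=> tt; have Vq : (chart X x @` dom X x) (chart X x x) by exists x => //; exact: mem_dom.
have [h _] := Dd_partial_fst (U_diff U_C1 tt Vq).
have E1 : (fun s => U X u x (s, chart X x x)) = fun s => u s x.
  by apply/funext => s; rewrite /U/= chartK//; exact: mem_dom.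
rewrite E1 in h; rewrite -u_t// derive1E; apply: DeriveDef => //.
exact/derivable1_diffP.
Qed.

Lemma Dd_U c t q (a : R) v : 0 < t < tau -> (chart X c @` dom X c) q ->
  Dd (U X u c) (t, q) (a, v) = a * Hl X H c (q, Du X u c t q) + pairing (Du X u c t q) v.
Proof.
move=> tt Vq; have [x d xq] := Vq.
rewrite (Dd_prod _ _ (U_diff U_C1 tt Vq)) -pairing_gr -/(Du X u c t q); congr (_ + _).
have [h _] := Dd_partial_fst (U_diff U_C1 tt Vq).
have E1 : (fun s => U X u c (s, q)) = fun s => u s x.
  by apply/funext => s; rewrite /U/= -xq chartK.
rewrite E1 in h *; have -> : a = a *: (1 : R) by rewrite /GRing.scale/= mulr1.
rewrite DdZ [in RHS]/GRing.scale/= mulr1; congr (_ * _).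
rewrite -DdE -deriveE// -derive1E u_t// -xq -(loc_graph U_C1 d tt) -loc_energy//.
Qed.

Lemma u_time_ge x (lo : R) (s t : R) : 0 < s -> s <= t -> t < tau ->
  (forall r, s <= r <= t -> lo <= H x (DM X (u r) x)) -> lo * (t - s) <= u t x - u s x.
Proof.
move=> s0 st tt h.
have D r : s <= r <= t -> is_derive r 1 (fun s => u s x) (H x (DM X (u r) x)).
  by move=> /andP[r1 r2]; apply: u_derive; rewrite (lt_le_trans s0 r1) (le_lt_trans r2 tt).
exact: is_derive_ge_incr st D h.
Qed.

(** As [u] is differentiable only at positive times, the estimate starts at a small [s > 0], and
    [u_lower] compares [u s] with [phi]. *)
Lemma u_phi_ge x (lo t : R) : 0 < t < tau ->
  (forall r, 0 < r <= t -> lo <= H x (DM X (u r) x)) -> phi x + lo * t <= u t x.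
Proof.
move=> /andP[t0 tt] h; apply/ler_addgt0Pr => e e0.
have e2 : 0 < e / 2 by rewrite divr_gt0.
have [d d0 Hd] := u_lower x e2.
pose s := Num.min (t / 2) (Num.min (d / 2) (e / 2 / (`|lo| + 1))).
have lo1 : 0 < `|lo| + 1 by rewrite ltr_wpDl.
have s0 : 0 < s by rewrite /s !lt_min !divr_gt0.
have s1 : s <= t / 2 by rewrite /s ge_min lexx.
have s2 : s <= d / 2 by rewrite /s !ge_min lexx orbT.
have s3 : s <= e / 2 / (`|lo| + 1) by rewrite /s !ge_min lexx !orbT.
have st : s <= t by lra.
have h1 := u_time_ge (x := x) (lo := lo) s0 st tt.
have {}h1 : lo * (t - s) <= u t x - u s x.
  by apply: h1 => r /andP[r1 r2]; apply: h; rewrite (lt_le_trans s0 r1).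
have h2 : phi x - e / 2 <= u s x by apply: Hd; rewrite ?s0 /=; lra.
have h3 : lo * s <= e / 2.
  apply: (@le_trans _ _ ((`|lo| + 1) * s)).
    by rewrite ler_wpM2r ?(ltW s0)//; apply: le_trans (ler_norm _) _; rewrite lerDl.
  by rewrite mulrC -ler_pdivlMr.
rewrite mulrBr in h1; lra.
Qed.

(** The momenta Du(t) are bounded by the energy, so the functions [u t] are Lipschitz in the chart
    with one constant; [u_lower] and [u_upper] pass this to [phi] as t -> 0. *)
Lemma phi_lipschitz c x : dom X c x -> exists r C : R, [/\ 0 < r, 0 <= C,
  (forall q, `|q - chart X c x| <= r -> (chart X c @` dom X c) q) &
  forall y z, dom X c y -> dom X c z -> `|chart X c y - chart X c x| <= r ->
    `|chart X c z - chart X c x| <= r -> `|phi y - phi z| <= C * `|chart X c y - chart X c z|].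
Proof.
move=> d; have [E0 [_ HU]] := energy_bound M_compact H_tonelli Phi_flow tau_gt0 graphE U_C1.
have [r [B [K LD]]] := local_data_exists H_tonelli E0 d.
have [r0 B0 K0 rV [hB _ _]] := LD.
have nB : 0 <= n%:R * B :> R by rewrite mulr_ge0// ltW.
exists r, (n%:R * B); split=> //.
suff H0 y z : dom X c y -> dom X c z -> `|chart X c y - chart X c x| <= r ->
    `|chart X c z - chart X c x| <= r -> phi y - phi z <= n%:R * B * `|chart X c y - chart X c z|.
  move=> y z dy dz yr zr; rewrite ler_norml H0// andbT lerNl opprB distrC.
  exact: H0.
move=> dy dz yr zr.
have lip (t : R) : 0 < t < tau -> u t y - u t z <= n%:R * B * `|chart X c y - chart X c z|.
  move=> tt; apply: le_trans (ler_norm _) _.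
  have -> : u t y = U X u c (t, chart X c y) by rewrite /U/= chartK.
  have -> : u t z = U X u c (t, chart X c z) by rewrite /U/= chartK.
  apply: (diff_le_lipschitz (f := fun q => U X u c (t, q))) => s s01.
  set q := _ + _; have qr : `|q - chart X c x| <= r by exact: closed_ball_convex.
  have [y' dy' yq] := rV _ qr.
  have [dU _] := Dd_partial_snd (U_diff U_C1 tt (rV _ qr)).
  split=> //; rewrite DdE -pairing_gr -/(Du X u c t q).
  apply: le_trans (pairing_norm _ _) _; rewrite ler_wpM2r// ler_wpM2l//.
  have := loc_graph U_C1 dy' tt; rewrite yq /loc/= => -[_ <-].
  apply: le_trans (hB _ _ dy' _ (HU _ _ tt)) _; first by rewrite yq.
  by lra.
apply/ler_addgt0Pr => e e0; have e2 : 0 < e / 2 by rewrite divr_gt0.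
have [d1 d10 H1] := u_lower y e2; have [d2 d20 H2] := u_upper dz e2.
pose s := Num.min (tau / 2) (Num.min (d1 / 2) (d2 / 2)).
have s0 : 0 < s by rewrite /s !lt_min !divr_gt0.
have s1 : s <= tau / 2 by rewrite /s ge_min lexx.
have s2 : s <= d1 / 2 by rewrite /s !ge_min lexx orbT.
have s3 : s <= d2 / 2 by rewrite /s !ge_min lexx !orbT.
have tp := tau_gt0; have st : s < tau by lra.
have h1 : phi y - e / 2 <= u s y by apply: H1 => //; rewrite s0 /=; lra.
have h2 : u s z <= phi z + e / 2.
  by apply: H2 => //; rewrite ?subrr ?normr0// s0 /=; lra.
have := lip s ltac:(by rewrite s0); lra.
Qed.

(** The time argument of [u] along the curve is [b - s], the time left before the end of the cell.
    Half of [e] pays for replacing the energy of [Q] along the curve by its value at [x], half for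
    the lower bound on u_t. *)
Lemma cell c x (E0 r B K m : R) : dom X c x ->
  local_data X H c (chart X c x) E0 r B K ->
  (forall p, G (x, p) -> m <= H x p) ->
  forall e : R, 0 < e -> exists2 d : R, 0 < d &
  forall (ga : R -> M) (a b L : R), a < b -> b - a < d -> b - a < tau -> 0 <= L ->
    (forall s, a <= s <= b -> dom X c (ga s) /\ `|chart X c (ga s) - chart X c x| < d) ->
    (forall s t, a <= s <= b -> a <= t <= b ->
       `|chart X c (ga t) - chart X c (ga s)| <= L * `|t - s|) ->
    {ae (@lebesgue_measure R), forall s, a < s < b ->
      is_derive s 1 (fun s => chart X c (ga s))
        (Hdp X H c (chart X c (ga s), Du X u c (b - s) (chart X c (ga s))))} ->
    forall Q, `|Q| <= B ->
    pairing Q (chart X c (ga b) - chart X c (ga a)) -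
      (b - a) * (Hl X H c (chart X c x, Q) - m + e) <= phi (ga b) - phi (ga a).
Proof.
move=> dx LD Hm e e0; have [r0 B0 K0 rV [_ hL _]] := LD.
have e2 : 0 < e / 2 by rewrite divr_gt0.
have [d1 d10 Hd1] := energy_liminf M_hausdorff M_compact H_tonelli Phi_flow tau_gt0 graphE U_C1 dx Hm e2.
set q0 := chart X c x in LD rV hL Hd1 *.
pose d := Num.min d1 (Num.min r (e / 2 / K)).
have d0 : 0 < d by rewrite /d !lt_min d10 r0 !divr_gt0.
have [dd1 ddr ddK] : [/\ d <= d1, d <= r & d <= e / 2 / K].
  by rewrite /d !ge_min !lexx !orbT.
exists d => // ga a b L ab bad bat L0 Hga HL Hae Q QB.
set q := fun s => chart X c (ga s).
have qr s : a <= s <= b -> `|q s - q0| <= r.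
  by move=> /Hga[_ h]; apply: ltW; exact: lt_le_trans h ddr.
have Vq s : a <= s <= b -> (chart X c @` dom X c) (q s) by move=> /qr/rV.
pose k := Hl X H c (q0, Q) + e / 2.
have HQ s : a <= s <= b -> Hl X H c (q s, Q) <= k.
  move=> sab; have b1 : box q0 r B (q s, Q) by split=> //; exact: qr.
  have b2 : box q0 r B (q0, Q) by split=> //=; rewrite subrr normr0 ltW.
  have [h _ _] := hL _ _ b2 b1.
  have h' : `|Hl X H c (q s, Q) - Hl X H c (q0, Q)| <= e / 2.
    apply: le_trans h _; rewrite mulrC -ler_pdivlMr// pairB subrr prod_norm_le normr0.
    have [_ h] := Hga s sab; rewrite (le_trans (ltW h) ddK)/= divr_ge0// ltW//.
  by have := le_trans (ler_norm _) h'; rewrite /k; lra.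
(* With P = Du and w the velocity, the derivative is - H(P) + <P - Q, w> + k. It is nonnegative,
   since H(Q) >= H(P) + <Q - P, w> by convexity and k >= H(Q) along the curve. *)
pose f s := U X u c (b - s, q s) - pairing Q (q s) + s * k.
(* Monotonicity is proved up to [b' < b], because [u] is not known to be C^1 up to time 0; [b']
   tends to [b] at the end. *)
have part b' : a < b' < b -> f a <= f b'.
  move=> /andP[ab' b'b]; apply: ac_dini_le; first exact: ltW.
    have It t : b - b' <= t <= b - a -> (`]0, tau[%classic : set R) t.
      move=> /andP[h1 h2]; rewrite /= in_itv/= (le_lt_trans h2 bat) andbT.
      by apply: lt_le_trans h1; rewrite subr_gt0.
    have [C C0 HC] := strip_lipschitz (U_C1 c) It rV.
    apply: (@lipschitz_ac _ _ _ (C * (1 + L) + n%:R * `|Q| * L + `|k|)) => s t /andP[s1 s2] /andP[t1 t2].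
    have sab : a <= s <= b by rewrite s1 (le_trans s2 (ltW b'b)).
    have tab : a <= t <= b by rewrite t1 (le_trans t2 (ltW b'b)).
    have hq := HL s t sab tab; rewrite -/(q t) -/(q s) in hq.
    have h1 : `|U X u c (b - t, q t) - U X u c (b - s, q s)| <= C * ((1 + L) * `|t - s|).
      have t3 : b - b' <= b - t <= b - a by rewrite !lerD2l !lerN2 t2 t1.
      have s3 : b - b' <= b - s <= b - a by rewrite !lerD2l !lerN2 s2 s1.
      apply: le_trans (HC _ _ _ _ s3 t3 (qr _ sab) (qr _ tab)) _.
      apply: ler_wpM2l => //; rewrite prod_norm_le mulrDl mul1r; apply/andP; split.
        have -> : b - t - (b - s) = - (t - s) by ring.
        by rewrite normrN lerDl mulr_ge0.
      by apply: le_trans hq _; rewrite lerDr.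
    have h2 : `|pairing Q (q t) - pairing Q (q s)| <= n%:R * `|Q| * (L * `|t - s|).
      rewrite -pairingBr; apply: le_trans (pairing_norm _ _) _.
      by rewrite ler_wpM2l// mulr_ge0.
    have h3 : `|t * k - s * k| <= `|k| * `|t - s|.
      by rewrite -mulrBl normrM mulrC.
    have -> : f t - f s = (U X u c (b - t, q t) - U X u c (b - s, q s)) -
       (pairing Q (q t) - pairing Q (q s)) + (t * k - s * k) by rewrite /f; ring.
    apply: le_trans (ler_normD _ _) _; rewrite [leRHS]mulrDl; apply: lerD => //.
    apply: le_trans (ler_normB _ _) _; rewrite [leRHS]mulrDl; apply: lerD => //.
      by rewrite -mulrA.
    by rewrite -[n%:R * _ * _ * _]mulrA.
  apply: ae_imp Hae => s Hs /andP[as_ sb'].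
  have sb : s < b := lt_trans sb' b'b.
  have sab : a <= s <= b by rewrite !ltW.
  have tt : 0 < b - s < tau by rewrite subr_gt0 sb (lt_trans _ bat)// ltrD2l ltrN2.
  have dq := Hs ltac:(by rewrite as_); rewrite -/(q s) -/q in dq.
  set P := Du X u c (b - s) (q s) in dq; set w := Hdp X H c (q s, P) in dq.
  have db : is_derive s (1 : R) (fun s : R => b - s) (-1).
    apply/is_deriveP => e' e'0; exists 1 => // h _.
    rewrite (_ : _ - _ - _ = 0) ?normr0 ?mulr_ge0// ?ltW//.
    by rewrite /GRing.scale/=; ring.
  have dU := is_derive_Dd_comp (F := U X u c) (g := fun s => (b - s, q s))
    (U_diff U_C1 tt (Vq s sab)) (is_derive_pair db dq).
  rewrite /= (Dd_U (-1) w tt (Vq s sab)) -/P mulN1r in dU.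
  have dQ : is_derive s 1 (fun s => pairing Q (q s)) (pairing Q w).
    have cQ : is_derive s (1 : R) (fun _ : R => Q) 0 by exact: is_derive_cst.
    apply: is_derive_eq (is_derive_pairing cQ dq) _.
    by rewrite -(scale0r (0 : E)) pairingZl mul0r add0r.
  have dk : is_derive s (1 : R) (fun s : R => s * k) k.
    apply/is_deriveP => e' e'0; exists 1 => // h _.
    rewrite (_ : _ - _ - _ = 0) ?normr0 ?mulr_ge0// ?ltW//.
    by rewrite /GRing.scale/=; ring.
  have df := is_deriveD (is_deriveB dU dQ) dk.
  apply: is_derive_right_dini df _.
  have := Hl_convex H_tonelli P Q (Vq s sab); rewrite -/w pairingBr.
  have := HQ s sab; rewrite [pairing P w]pairingC [pairing Q w]pairingC; exact: slope_arith.
have start : phi (ga a) + (m - e / 2) * (b - a) <= u (b - a) (ga a).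
  have aab : a <= a <= b by rewrite lexx ltW.
  have [da ha] := Hga a aab.
  apply: u_phi_ge; first by rewrite subr_gt0 ab.
  move=> s /andP[s0 s1]; apply: Hd1 => //; last exact: le_lt_trans s1 bat.
    by rewrite s0 (le_lt_trans s1 (lt_le_trans bad dd1)).
  exact: lt_le_trans ha dd1.
apply/ler_addgt0Pr => e' e'0.
have bab : a <= b <= b by rewrite lexx ltW.
have [db hb] := Hga b bab.
have e'2 : 0 < e' / 2 by rewrite divr_gt0.
have [d2 d20 Hd2] := u_upper db e'2.
(* Collects the rates of all errors made when [b] is replaced by [b - h]. *)
pose CC := L + n%:R * `|Q| * L + `|k| + 1.
have nQL : 0 <= n%:R * `|Q| * L by rewrite !mulr_ge0.
have CC0 : 0 < CC by rewrite ltr_wpDl// !addr_ge0.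
have [CCL CCk] : L <= CC /\ n%:R * `|Q| * L + `|k| <= CC by exact: sum4_le.
pose h := Num.min ((b - a) / 2) (Num.min (d2 / 2) (Num.min (d2 / 2 / CC) (e' / 2 / CC))).
have ba0 : 0 < b - a by rewrite subr_gt0.
have h0 : 0 < h by rewrite /h !lt_min !divr_gt0.
have [h1 h2 h3 h4] : [/\ h <= (b - a) / 2, h <= d2 / 2, h * CC <= d2 / 2 & h * CC <= e' / 2].
  by split; rewrite -?ler_pdivlMr// /h !ge_min !lexx ?orbT.
pose b' := b - h.
have ab'b : a < b' < b := half_shift h0 h1.
have b'ab : a <= b' <= b by case/andP: ab'b => ? ?; rewrite !ltW.
have [db' hb'] := Hga b' b'ab.
have hq := HL b' b b'ab bab; rewrite -/(q b) -/(q b') in hq.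
have bb' : `|b - b'| = h by rewrite /b' opprB addrC subrK gtr0_norm.
rewrite bb' in hq.
have hLq : L * h <= h * CC by rewrite mulrC ler_wpM2l ?(ltW h0).
have fin : u (b - b') (ga b') <= phi (ga b) + e' / 2.
  have bh : b - b' = h by rewrite /b' opprB addrC subrK.
  apply: Hd2 => //; rewrite ?bh; first by rewrite h0 (le_lt_trans h2)// half_lt.
    by apply: le_lt_trans h1 _; apply: lt_trans bat; exact: half_lt.
  by rewrite distrC (le_lt_trans hq)// (le_lt_trans hLq)// (le_lt_trans h3)// half_lt.
have pQ : `|pairing Q (q b) - pairing Q (q b')| + `|k| * h <= h * CC.
  have t1 : `|pairing Q (q b) - pairing Q (q b')| <= n%:R * `|Q| * (L * h).
    rewrite -pairingBr; apply: le_trans (pairing_norm _ _) _.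
    by rewrite ler_wpM2l// mulr_ge0.
  have t2 : n%:R * `|Q| * (L * h) + `|k| * h <= h * CC.
    by rewrite mulrA -mulrDl mulrC ler_wpM2l ?(ltW h0).
  by apply: le_trans t2; rewrite lerD2r.
have da : dom X c (ga a) by apply: (Hga a _).1; rewrite lexx ltW.
have := part b' ab'b; rewrite /f /U/= !chartK// -/(q a) => hf.
have kh : - (`|k| * h) <= k * h.
  by rewrite -mulNr ler_wpM2r ?(ltW h0)// lerNl -normrN; exact: ler_norm.
have := ler_norm (pairing Q (q b) - pairing Q (q b')).
rewrite -/(q b) -/(q a) pairingBr.
have -> : (b - a) * (Hl X H c (q0, Q) - m + e) = (b - a) * k - (m - e / 2) * (b - a).
  by rewrite /k; field.
move: hf; have -> : b' * k = b * k - k * h by rewrite /b'; ring.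
rewrite mulrBl.
exact: (cell_arith kh pQ h4 start fin).
Qed.

End Cell.

(** * From the energy inequality to mean velocities *)

Lemma delta_norm_le (R : realType) n (i : 'I_n) : `|delta_mx 0 i : 'rV[R]_n| <= 1.
Proof.
apply: rv_norm_le => // j; rewrite !mxE eqxx/=; case: (j == i) => //=.
  by rewrite normr1.
by rewrite normr0.
Qed.

(** The hypothesis says that [D / ell] is a subgradient of [h] at [p] up to the slack [d]. Testing
    it at [p] plus or minus [l] times a basis vector pins down each coordinate: [l] is so small that
    the remainder of [h] is at most [l * (eta / 2)], and the slack has the same size. The condition
    [l <= 1] keeps [Q] within the range tested. *)
Lemma slope_rigidity (R : realType) n (h : 'rV[R]_n -> R) p : differentiable h p ->
  forall eta : R, 0 < eta -> exists2 d : R, 0 < d & forall (D : 'rV[R]_n) (ell : R), 0 < ell ->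
  (forall Q, `|Q - p| <= 1 -> ell * (h p - h Q - d) <= pairing (p - Q) D) ->
  `|D - ell *: gr h p| <= eta * ell.
Proof.
move=> dh eta eta0; have eta2 : 0 < eta / 2 by rewrite divr_gt0.
have [d0 d00 Hd0] := Dd_approx dh eta2.
pose l := Num.min 1 (d0 / 2).
have l0 : 0 < l by rewrite /l lt_min ltr01 divr_gt0.
have l1 : l <= 1 by rewrite /l ge_min lexx.
have ld : l < d0.
  by apply: (@le_lt_trans _ _ (d0 / 2)); [rewrite /l ge_min lexx orbT|lra].
exists (l * (eta / 2)); first by rewrite mulr_gt0.
move=> D ell ell0 HQ; apply: rv_norm_le; first by rewrite mulr_ge0// ltW.
move=> i; rewrite coordB mxE.
have key (s : R) : `|s| = 1 -> s * (D 0 i - ell * gr h p 0 i) <= eta * ell.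
  move=> s1; set v : 'rV[R]_n := (l * s) *: delta_mx 0 i.
  have vl : `|v| <= l.
    rewrite normrZ normrM s1 mulr1 gtr0_norm// ler_piMr ?(ltW l0)//; exact: delta_norm_le.
  have := HQ (p + v); rewrite [p + v - p]addrC addKr => /(_ (le_trans vl l1)).
  have -> : p - (p + v) = - v by rewrite opprD addrA subrr add0r.
  rewrite pairingNl /v pairingZl pairingC pairing_delta -/v => h1.
  have := Hd0 v (le_lt_trans vl ld); rewrite -pairing_gr /v pairingZr pairing_delta -/v.
  rewrite ler_norml => /andP[_ h2].
  have h3 : eta / 2 * `|v| <= eta / 2 * l by rewrite ler_wpM2l// ltW.
  have h4 : ell * (h (p + v) - h p - l * s * gr h p 0 i) <= ell * (eta / 2 * l).
    by rewrite ler_wpM2l ?(ltW ell0)//; lra.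
  rewrite -(ler_pM2l l0).
  have -> : l * (eta * ell) = ell * (eta / 2 * l) + ell * (l * (eta / 2)) by field.
  move: h1 h4; rewrite !mulrBr; lra.
rewrite ler_norml; have := key 1 (normr1 _); have := key (-1).
by rewrite normrN normr1 mul1r mulN1r => /(_ erefl) h1 h2; rewrite h2 andbT lerNl.
Qed.

(** The first-order expansion, in the chart [c], of the function that touches [phi] from above at
    [x]. *)
Lemma superdifferential_upper (R : realType) n (M : topologicalType) (X : smooth_structure R n M)
    (g : riemannian_metric X) (phi : M -> R) c x p : dom X c x -> superdifferential g phi x p ->
  forall e : R, 0 < e -> exists2 d : R, 0 < d & forall z, dom X c z ->
    `|chart X c z - chart X c x| < d -> phi z - phi x <=
      pairing (cc X x c x p) (chart X c z - chart X c x) + e * `|chart X c z - chart X c x|.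
Proof.
move=> dx [r [psi [r0 Cpsi hpsi psix ->]]] e e0.
have xx : dball g x r x.
  have [r2 [C2 [r20 C20 _ H2]]] := dist_upper g dx.
  have x2 : `|chart X c x - chart X c x| < r2 by rewrite subrr normr0.
  have [_] := H2 x x dx dx x2 x2; rewrite subrr normr0 mulr0 /dball/= => h.
  exact: le_lt_trans h r0.
have dpsi b : dom X b x -> differentiable (psi \o param X b) (chart X b x).
  by move=> db; have [h _] := Cpsi b; apply: h; exists x.
have Ep : cc X x c x (DM X psi x) = gr (psi \o param X c) (chart X c x).
  rewrite (gr_change_chart (mem_dom X x) dx (dpsi x (mem_dom X x))).
  by rewrite /DM grE.
have [d1 d10 Hd1] := Dd_approx (dpsi c dx) e0.
have [r2 [C2 [r20 C20 _ H2]]] := dist_upper g dx.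
pose d := Num.min d1 (Num.min r2 (r / C2)).
exists d; first by rewrite /d !lt_min d10 r20 divr_gt0.
move=> z dz; rewrite /d !lt_min => /and3P[z1 z2 z3].
have x2 : `|chart X c x - chart X c x| < r2 by rewrite subrr normr0.
have [_ hz] := H2 x z dx dz x2 z2.
have zb : dball g x r z by rewrite /dball/=; apply: le_lt_trans hz _; rewrite mulrC -ltr_pdivlMr.
have := Hd1 _ z1; rewrite Ep pairing_gr [chart X c x + _]addrC subrK /= !chartK// psix.
by rewrite ler_norml => /andP[_]; have := hpsi z zb; lra.
Qed.

Section Displacement.
Variables (R : realType) (n : nat) (M : topologicalType).
Variables (X : smooth_structure R n M) (g : riemannian_metric X).
Hypotheses (M_hausdorff : hausdorff_space M) (M_compact : compact [set: M]).
Local Notation E := 'rV[R]_n.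
Variable H : M -> E -> R.
Hypothesis H_tonelli : tonelli g H.
Variable Phi : R -> M * E -> M * E.
Hypothesis Phi_flow : hamiltonian_flow X H Phi.
Variables (u : R -> M -> R) (G : set (M * E)) (tau : R).
Hypothesis tau_gt0 : 0 < tau.
Hypothesis graphE : forall t, 0 < t < tau ->
  [set (x, DM X (u t) x) | x in [set: M]] = Phi (- t) @` G.
Hypothesis U_C1 : forall c, Ck 1 (`]0, tau[ `*` (chart X c @` dom X c)) (U X u c).
Hypothesis u_t : forall t x, 0 < t < tau ->
  derive1 (fun s => u s x) t = H x (DM X (u t) x).
Variable phi : M -> R.
Hypothesis u_lower : forall x (e : R), 0 < e -> exists2 d : R, 0 < d &
  forall s : R, 0 < s < d -> s < tau -> phi x - e <= u s x.
Hypothesis u_upper : forall c y, dom X c y -> forall e : R, 0 < e -> exists2 d : R, 0 < d &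
  forall (s : R) x, 0 < s < d -> s < tau -> dom X c x -> `|chart X c x - chart X c y| < d ->
  u s x <= phi y + e.
Hypothesis G_upper : forall c x p, dom X c x -> G (x, p) ->
  forall e : R, 0 < e -> exists2 d : R, 0 < d & forall z, dom X c z ->
    `|chart X c z - chart X c x| < d -> phi z - phi x <=
      pairing (cc X x c x p) (chart X c z - chart X c x) + e * `|chart X c z - chart X c x|.
Implicit Types (c x y : M) (q p v w : E).

Lemma Hp_Hdp x p : Hp H x p = Hdp X H x (chart X x x, p).
Proof.
rewrite /Hp grE /Hdp/=; congr (gr _ _); apply/funext => p'.
by rewrite Hl_chart ?cc_id//; exact: mem_dom.
Qed.

Lemma Hdp_Hp c x p : dom X c x ->
  tc X x c x (Hp H x p) = Hdp X H c (chart X c x, cc X x c x p).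
Proof. by move=> d; rewrite Hp_Hdp (Hdp_change H_tonelli _ (mem_dom X x) d). Qed.

(** The increment of [phi] is bounded below by the energy inequality and above by the
    superdifferential; eliminating it leaves exactly the hypothesis of [slope_rigidity]. *)
Lemma displacement c x p (E0 r B K L : R) : dom X c x -> local_data X H c (chart X c x) E0 r B K ->
  G (x, p) -> H x p <= E0 -> 0 < L ->
  forall eta : R, 0 < eta -> exists e1 d : R, [/\ 0 < e1, 0 < d &
  forall (ell : R) z, 0 < ell -> dom X c z -> `|chart X c z - chart X c x| <= L * ell ->
    `|chart X c z - chart X c x| < d ->
    (forall Q, `|Q| <= B -> pairing Q (chart X c z - chart X c x) -
       ell * (Hl X H c (chart X c x, Q) - H x p + e1) <= phi z - phi x) ->
    `|chart X c z - chart X c x - ell *: Hdp X H c (chart X c x, cc X x c x p)| <= eta * ell].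
Proof.
move=> dx LD Gp Hp0 L0 eta eta0; have [r0 B0 K0 rV [hB _ _]] := LD.
have Vq : (chart X c @` dom X c) (chart X c x) by exists x.
set q0 := chart X c x in LD rV hB Vq *; set P := cc X x c x p.
pose h (Q : E) := Hl X H c (q0, Q).
have dh : differentiable h P by have [] := Dd_partial_snd (Hl_diff H_tonelli P Vq).
have hP : h P = H x p by rewrite (H_chart H p dx).
have PB : `|P| <= B - 1 by apply: (hB x p) => //; rewrite subrr normr0 ltW.
have [d d0 Hd] := slope_rigidity dh eta0.
(* Half of the slack [d] goes to the energy inequality, as [e1], and half to the remainder of the
   superdifferential, where the displacement is at most [L * ell]. *)
have e0 : 0 < d / 2 / L by rewrite !divr_gt0.
have [d1 d10 Hd1] := G_upper dx Gp e0.
exists (d / 2), d1; split=> //; first by rewrite divr_gt0.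
move=> ell z ell0 dz zL zd HQ; apply: Hd => // Q QP.
have QB : `|Q| <= B.
  by rewrite -[Q](subrK P); apply: le_trans (ler_normD _ _) _; lra.
have h1 := HQ Q QB; have h2 := Hd1 z dz zd.
have h3 : d / 2 / L * `|chart X c z - chart X c x| <= d / 2 * ell.
  apply: (@le_trans _ _ (d / 2 / L * (L * ell))); first by rewrite ler_wpM2l// ltW.
  by rewrite mulrA divfK// gt_eqF.
rewrite pairingBl hP -/P -/q0 in h2 h3 *; rewrite -/(h Q) in h1.
move: h1 h2 h3; move: (pairing Q _) (pairing P _) (d / 2 / L * _) => a b c'.
rewrite mulrDr !mulrBr => h1 h2 h3.
have -> : ell * d = d / 2 * ell + ell * (d / 2) by field.
lra.
Qed.

(** The mean velocity over [[0, ell]] of the characteristic started at [(x, Du(ell, x))] is close to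
    [Hp H x p] by [displacement], and close to its initial velocity, which is the field at [x]. *)
Lemma W_limit x p : G (x, p) -> (forall p', G (x, p') -> H x p <= H x p') ->
  forall eta : R, 0 < eta -> exists2 d : R, 0 < d & forall ell : R, 0 < ell < d -> ell < tau ->
    `|Hp H x (DM X (u ell) x) - Hp H x p| <= eta.
Proof.
move=> Gp Hmin eta eta0; have d := mem_dom X x.
have [E0 [HG HU]] := energy_bound M_compact H_tonelli Phi_flow tau_gt0 graphE U_C1.
have [r [B [K LD]]] := local_data_exists H_tonelli E0 d.
have [r0 B0 K0 rV [_ hL hK]] := LD.
have eta2 : 0 < eta / 2 by rewrite divr_gt0.
have [e1 [d1 [e10 d10 Hdisp]]] := displacement d LD Gp (HG _ Gp) K0 eta2.
have [d2 d20 Hcell] := cell M_hausdorff M_compact H_tonelli Phi_flow tau_gt0 graphE U_C1 u_t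
  u_lower u_upper d LD Hmin e10.
set q0 := chart X x x in LD rV hL Hdisp Hcell *.
pose D := Num.min (Num.min (r / 2 / K) (d1 / K)) (Num.min (Num.min (d2 / K) d2) (eta / 2 / (K * K))).
have D0 : 0 < D by rewrite /D !lt_min d20 !divr_gt0// mulr_gt0.
exists D => // ell /andP[ell0]; rewrite /D !lt_min => /andP[/andP[l1 l2] /andP[/andP[l3 l4] l5]] lt.
have tt : 0 < ell < tau by rewrite ell0.
have [z Gz hz] := graph_from graphE x tt.
pose rn := run Phi 1 (- ell) z; pose q s := (loc X x (rn s)).1.
have rn0 : rn 0 = (x, DM X (u ell) x) by rewrite /rn run_start.
have Kl (s : R) : 0 <= s <= ell -> K * s <= K * ell.
  by move=> /andP[_ h]; rewrite ler_wpM2l// ltW.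
have Kell : K * ell < r / 2 by rewrite mulrC -ltr_pdivlMr.
have st (s : R) : 0 <= s <= ell -> [/\ dom X x (rn s).1, box q0 r B (loc X x (rn s)) &
    `|loc X x (rn s) - loc X x (rn 0)| <= K * s].
  move=> sl; apply: (run_short M_hausdorff H_tonelli Phi_flow LD (normr1 _) (HG _ Gz)).
  - by rewrite -/rn rn0.
  - by rewrite -/rn rn0 subrr normr0 divr_ge0// ltW.
  - by case/andP: sl.
  - exact: le_lt_trans (Kl s sl) Kell.
have dv (s : R) : 0 <= s <= ell -> is_derive s 1 q (Hdp X H x (loc X x (rn s))).
  move=> /st[ds _ _]; have [h _] := run_derive H_tonelli Phi_flow (sg := 1) (s0 := - ell) ds.
  by rewrite scale1r in h.
have q00 : q 0 = q0 by rewrite /q rn0.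
have lip (s t : R) : 0 <= s -> s <= t -> t <= ell -> `|q t - q s| <= K * (t - s).
  move=> s0 s_t tl; have := is_derive_near_incr (w := 0) (C := K) s_t (f := q)
    (df := fun s => Hdp X H x (loc X x (rn s))) _ _.
  rewrite scaler0 subr0; apply => a /andP[a1 a2].
    by apply: dv; rewrite (le_trans s0 a1) (le_trans a2 tl).
  rewrite subr0; have [|_ ba _] := st a; first by rewrite (le_trans s0 a1) (le_trans a2 tl).
  by have [] := hK _ ba.
have ll : 0 <= ell <= ell by rewrite (ltW ell0) lexx.
have Kd2 : K * ell < d2 by rewrite mulrC -ltr_pdivlMr.
have [dl _ _] := st ell ll.
have lipl : `|q ell - q0| <= K * ell.
  by have := lip 0 ell (lexx _) (ltW ell0) (lexx _); rewrite q00 subr0.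
have disp : `|q ell - q0 - ell *: Hdp X H x (q0, cc X x x x p)| <= eta / 2 * ell.
  apply: (Hdisp ell (rn ell).1) => //.
    by apply: le_lt_trans lipl _; rewrite mulrC -ltr_pdivlMr.
  move=> Q QB.
  have := Hcell (fun s => (rn s).1) 0 ell K ell0 _ _ (ltW K0) _ _ _ Q QB.
  rewrite !subr0 rn0/= -/q0; apply => //.
  - move=> s sl; have [ds _ _] := st s sl; split=> //.
    have /andP[s0 s1] := sl; have := lip 0 s (lexx _) s0 s1; rewrite q00 subr0 => h.
    by apply: le_lt_trans h _; apply: le_lt_trans (Kl s sl) _.
  - move=> s t /andP[s0 s1] /andP[t0 t1]; have [h|h] := leP s t.
      by rewrite [`|t - s|]ger0_norm ?subr_ge0//; exact: lip.
    rewrite distrC [`|t - s|]distrC [`|s - t|]gtr0_norm ?subr_gt0//.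
    by apply: lip => //; exact: ltW.
  - apply: aeW => s /andP[s0 s1]; have sl : 0 <= s <= ell by rewrite !ltW.
    have [ds _ _] := st s sl.
    have ts : 0 < ell - s < tau by rewrite subr_gt0 s1 (le_lt_trans _ lt)// gerBl ltW.
    have := dv s sl; rewrite /q.
    (* After time [s] the characteristic is on the graph of Du(ell - s), so it solves the equation
       required by [cell]. *)
    have rE : rn s = Phi (- (ell - s)) z by rewrite /rn /run mul1r opprB addrC.
    have gE := graph_to graphE ts Gz; rewrite -rE in gE.
    by rewrite {1}gE (loc_graph U_C1 ds ts).
(* The run moves by at most [K * ell] in phase space and [H_p] is [K]-Lipschitz there, so the
   velocity changes by at most [K * (K * ell)]. *)
have dq : `|q ell - q 0 - (ell - 0) *: Hdp X H x (loc X x (rn 0))| <= K * (K * ell) * (ell - 0).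
  apply: (is_derive_near_incr (df := fun s => Hdp X H x (loc X x (rn s))) (ltW ell0) dv) => s sl.
  have [_ bs hs] := st s sl; have [_ b0 _] := st 0 ltac:(by rewrite lexx ltW).
  have [_ h _] := hL _ _ b0 bs; apply: le_trans h _; rewrite ler_wpM2l ?(ltW K0)//.
  exact: le_trans hs (Kl s sl).
rewrite !subr0 q00 in dq.
have l0E : loc X x (rn 0) = (q0, DM X (u ell) x) by rewrite rn0 /loc/= cc_id.
rewrite l0E in dq; rewrite cc_id// in disp.
rewrite !Hp_Hdp -/q0.
set w1 := Hdp X H x (q0, DM X (u ell) x) in dq *; set w0 := Hdp X H x (q0, p) in disp *.
have : `|ell *: (w1 - w0)| <= eta / 2 * ell + K * (K * ell) * ell.
  have alg (A b1 b0 : E) : ell *: (b1 - b0) = (A - ell *: b0) - (A - ell *: b1).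
    by apply/rowP => i; rewrite !mxE; ring.
  rewrite (alg (q ell - q0)).
  by apply: le_trans (ler_normB _ _) _; exact: lerD.
rewrite normrZ gtr0_norm//.
have -> : eta / 2 * ell + K * (K * ell) * ell = ell * (eta / 2 + K * K * ell) by ring.
rewrite ler_pM2l// => h; apply: le_trans h _.
have : K * K * ell < eta / 2 by rewrite mulrC -ltr_pdivlMr// mulr_gt0.
lra.
Qed.

End Displacement.

(** Makes the number of nodes inside an interval a decreasing measure for the induction of
    [cells]. *)
Lemma count_lt (T : eqType) (P Q : pred T) (s : seq T) w : (forall v, P v -> Q v) ->
  w \in s -> Q w -> ~~ P w -> (count P s < count Q s)%N.
Proof.
move=> PQ + Qw nPw; elim: s => // y s IH; rewrite inE => /orP[/eqP <-|ws] /=.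
  by rewrite (negbTE nPw) Qw add0n add1n ltnS; apply: sub_count.
rewrite -addnS leq_add ?IH//; have := PQ y; by case: (P y) => // ->.
Qed.

(** * Curves driven by a partition and their limits *)

Section Partitions.
Variable R : realType.
Implicit Types (a b t : R) (s : seq R).

Lemma mesh_cons a y s : mesh a (y :: s) = Num.max (y - a) (mesh y s).
Proof. by rewrite /mesh /= big_cons. Qed.

Lemma next_node_exists a s t : path <%R a s -> a <= t < last a s ->
  exists v, [/\ v \in s, t < v, (forall w, w \in s -> t < w -> v <= w) & v - t <= mesh a s].
Proof.
elim: s a => [|y s IH] a /=.
  by move=> _ /andP[h1 h2]; have := le_lt_trans h1 h2; rewrite ltxx.
move=> /andP[ay ps] /andP[at_ tl]; rewrite mesh_cons; have [yt|ty] := leP y t.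
  have [|v [vs tv vmin vm]] := IH y ps; first by rewrite yt.
  exists v; split=> //; first by rewrite inE vs orbT.
    move=> w; rewrite inE => /orP[/eqP ->|]; last exact: vmin.
    by move=> /lt_le_trans/(_ yt); rewrite ltxx.
  by rewrite le_max vm orbT.
exists y; split=> //; first by rewrite inE eqxx.
  move=> w; rewrite inE => /orP[/eqP ->//|ws _].
  have := order_path_min lt_trans ps => /allP/(_ _ ws); exact: ltW.
by rewrite le_max; apply/orP; left; lra.
Qed.

Lemma next_node_spec a b s t : itv_partition a b s -> a <= t < b ->
  [/\ next_node s t \in s, t < next_node s t,
     (forall w, w \in s -> t < w -> next_node s t <= w) & next_node s t - t <= mesh a s].
Proof.
move=> [ps /eqP ls] tab; have [|v [vs tv vmin vm]] := next_node_exists ps (t := t).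
  by rewrite ls.
suff -> : next_node s t = v by [].
apply/le_anti/andP; split.
  by apply: ge_inf => //; exists t => w [_ /ltW].
by apply: lb_le_inf; [exists v|move=> w [ws tw]; exact: vmin].
Qed.

Lemma partition_le a b s v : itv_partition a b s -> v \in s -> a < v <= b.
Proof.
move=> [ps /eqP ls] vs; have := order_path_min lt_trans ps => /allP/(_ _ vs) -> /=.
rewrite -ls; elim: s a v ps vs {ls} => [//|y s IH] a v /= /andP[ay ps].
rewrite inE => /orP[/eqP ->|]; last exact: IH.
have [->//|] : s = [::] \/ exists z, z \in s.
  by case: (s) => [|z s']; [left|right; exists z; rewrite inE eqxx].
move=> [z zs]; have := order_path_min lt_trans ps => /allP h.
apply: (@le_trans _ _ z); [exact/ltW/h|exact: IH].
Qed.

End Partitions.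

Lemma fraction_lt (R : realType) (D : R) : 0 < D -> [/\ D / 8 < D, D / 4 < D & D / 2 < D].
Proof. by move=> D0; split; lra. Qed.

Lemma sum_lt_half (R : realType) (a b D : R) : 0 < D -> a <= D / 8 -> b < D / 4 -> a + b < D / 2.
Proof. lra. Qed.

Lemma sum_lt_full (R : realType) (a b x D : R) : 0 < D -> a <= x -> x < D / 2 -> b <= D / 8 ->
  a + b < D.
Proof. lra. Qed.

(** The closing computation of [gamma_right]: [P'], [S], [a], [x] belong to the approximating curve,
    [P], [A], [b], [y] to the limit, and [F1], [F2], [F3], [z] bound the differences. *)
Lemma limit_arith (R : realType) (A P' P S a b x y F1 F2 F3 z e : R) :
  P' - S <= a - x -> a - b <= F1 -> - F2 <= x - y -> - F3 <= P' - P -> S <= A + z ->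
  F3 + z + F1 + F2 <= e -> P - A <= b - y + e.
Proof. lra. Qed.

Section Solutions.
Variables (R : realType) (n : nat) (M : topologicalType).
Variables (X : smooth_structure R n M) (g : riemannian_metric X).
Hypotheses (M_hausdorff : hausdorff_space M) (M_compact : compact [set: M]).
Hypothesis M_connected : connected [set: M].
Local Notation E := 'rV[R]_n.
Variable H : M -> E -> R.
Hypothesis H_tonelli : tonelli g H.
Variable Phi : R -> M * E -> M * E.
Hypothesis Phi_flow : hamiltonian_flow X H Phi.
Variables (u : R -> M -> R) (G : set (M * E)) (tau : R).
Hypothesis tau_gt0 : 0 < tau.
Hypothesis graphE : forall t, 0 < t < tau ->
  [set (x, DM X (u t) x) | x in [set: M]] = Phi (- t) @` G.
Hypothesis U_C1 : forall c, Ck 1 (`]0, tau[ `*` (chart X c @` dom X c)) (U X u c).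
Hypothesis u_t : forall t x, 0 < t < tau ->
  derive1 (fun s => u s x) t = H x (DM X (u t) x).
Variable phi : M -> R.
Hypothesis u_lower : forall x (e : R), 0 < e -> exists2 d : R, 0 < d &
  forall s : R, 0 < s < d -> s < tau -> phi x - e <= u s x.
Hypothesis u_upper : forall c y, dom X c y -> forall e : R, 0 < e -> exists2 d : R, 0 < d &
  forall (s : R) x, 0 < s < d -> s < tau -> dom X c x -> `|chart X c x - chart X c y| < d ->
  u s x <= phi y + e.
Hypothesis G_upper : forall c x p, dom X c x -> G (x, p) ->
  forall e : R, 0 < e -> exists2 d : R, 0 < d & forall z, dom X c z ->
    `|chart X c z - chart X c x| < d -> phi z - phi x <=
      pairing (cc X x c x p) (chart X c z - chart X c x) + e * `|chart X c z - chart X c x|.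
Variables (T0 T1 : R).
Implicit Types (c x y : M) (q p v w : E).

Definition field (Delta : seq R) (t : R) x : E := Hp H x (DM X (u (next_node Delta t - t)) x).

(** The strict bound on the mesh keeps the time left before the next node in the open interval []0,
    tau[], where [u] is C^1. *)
Definition solution Delta (sig : R -> M) :=
  [/\ itv_partition T0 T1 Delta, mesh T0 Delta < tau & ae_solution g T0 T1 (field Delta) sig].

Lemma solution_derive Delta sig : solution Delta sig ->
  {ae (@lebesgue_measure R), forall t, T0 <= t < T1 -> {for t, continuous sig} /\
    forall c, dom X c (sig t) -> is_derive t 1 (fun s => chart X c (sig s))
      (Hdp X H c (chart X c (sig t), Du X u c (next_node Delta t - t) (chart X c (sig t))))}.
Proof.
move=> [pD mD [_ aeD]]; apply: ae_imp aeD => t Ht /andP[t0 t1].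
have [ct dt] := Ht ltac:(by rewrite t0 ltW); split=> // c d.
have [_ h1 _ h2] := next_node_spec pD (t := t) ltac:(by rewrite t0).
have tt : 0 < next_node Delta t - t < tau by rewrite subr_gt0 h1 (le_lt_trans h2 mD).
have := is_derive_change_chart ct (mem_dom X (sig t)) d dt.
have lg := loc_graph U_C1 d tt; rewrite /loc/= in lg.
by rewrite (Hdp_Hp H_tonelli _ d) lg.
Qed.

Lemma ac_sub (a b : R) sig : T0 <= a -> b <= T1 -> absolutely_continuous g T0 T1 sig ->
  absolutely_continuous g a b sig.
Proof.
move=> h1 h2 acs e e0; have [d d0 Hd] := acs e e0; exists d => // m v w Hvw.
by apply: Hd => i; have [? ? ?] := Hvw i; split=> //; [exact: le_trans h1 _|exact: le_trans h2].
Qed.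

(** The energy bound makes [rho] and [K] independent of the partition and of the solution, as the
    passage to the limit requires. *)
Lemma solution_stays c x : dom X c x -> exists rho K : R, [/\ 0 < rho, 0 < K &
  forall Delta sig a b, solution Delta sig -> T0 <= a -> a <= b -> b <= T1 ->
    dom X c (sig a) -> `|chart X c (sig a) - chart X c x| <= rho -> K * (b - a) < rho ->
    dom X c (sig b) /\ `|chart X c (sig b) - chart X c (sig a)| <= K * (b - a)].
Proof.
move=> d; have [E0 [HG HU]] := energy_bound M_compact H_tonelli Phi_flow tau_gt0 graphE U_C1.
have [r [B [K LD]]] := local_data_exists H_tonelli E0 d.
have [r0 B0 K0 rV [_ hL hK]] := LD.
have [r1 [C [r10 C0 Hcut]]] := cutdist_lip g M_hausdorff M_connected d.
pose rho := Num.min r r1 / 4.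
have rho0 : 0 < rho by rewrite divr_gt0// lt_min r0.
have rr : 4 * rho <= r by rewrite /rho mulrC divfK// ge_min lexx.
have rr1 : 4 * rho <= r1 by rewrite /rho mulrC divfK// ge_min lexx orbT.
exists rho, K; split=> // Delta sig a b sol T0a ab bT1 da ha Kab.
have [_ _ [acs _]] := sol.
have [hV hC] := Hcut (chart X c (sig a)) rho ltac:(lra).
apply: (curve_stays_ac M_hausdorff (ltW K0) C0 ab da hV hC (ac_sub T0a bT1 acs)) => //.
apply: ae_imp (solution_derive sol) => t Ht /andP[at_ tb].
have [|ct dt] := Ht.
  by rewrite (le_trans T0a (ltW at_)) (lt_le_trans tb bT1).
split=> // dct hct; exists (Hdp X H c (chart X c (sig t), Du X u c (next_node Delta t - t) (chart X c (sig t)))); last exact: dt.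
have [pD mD _] := sol.
have tT : T0 <= t < T1 by rewrite (le_trans T0a (ltW at_)) (lt_le_trans tb bT1).
have [_ h1 _ h2] := next_node_spec pD tT.
have tt : 0 < next_node Delta t - t < tau by rewrite subr_gt0 h1 (le_lt_trans h2 mD).
rewrite -(loc_graph U_C1 dct tt).
have [] // := hK (loc X c (sig t, DM X (u (next_node Delta t - t)) (sig t))).
apply: (in_box LD) => //=; first exact: HU.
rewrite -[chart X c (sig t)](subrK (chart X c (sig a))) -addrA.
by apply: le_trans (ler_normD _ _) _; lra.
Qed.

(** [cell] summed between [a] and the node [b], by induction on the number of nodes strictly in
    between. The start may lie inside a cell; the end must be a node, because the field is Du at the
    time left before the node that closes the cell. *)
Lemma cells c x (E0 r B K m : R) : dom X c x ->
  local_data X H c (chart X c x) E0 r B K ->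
  (forall p, G (x, p) -> m <= H x p) ->
  forall e : R, 0 < e -> exists2 d : R, 0 < d &
  forall Delta sig (a b L : R), solution Delta sig -> mesh T0 Delta < d ->
    T0 <= a -> a < b -> b \in Delta -> 0 <= L ->
    (forall s, a <= s <= b -> dom X c (sig s) /\ `|chart X c (sig s) - chart X c x| < d) ->
    (forall s t, a <= s <= b -> a <= t <= b ->
       `|chart X c (sig t) - chart X c (sig s)| <= L * `|t - s|) ->
    forall Q, `|Q| <= B ->
    pairing Q (chart X c (sig b) - chart X c (sig a)) -
      (b - a) * (Hl X H c (chart X c x, Q) - m + e) <= phi (sig b) - phi (sig a).
Proof.
move=> dx LD Hm e e0.
have [d d0 Hcell] := cell M_hausdorff M_compact H_tonelli Phi_flow tau_gt0 graphE U_C1 u_t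
  u_lower u_upper dx LD Hm e0.
exists d => // Delta sig a b L sol mD T0a ab bD L0 Hin HL Q QB.
have [pD mT _] := sol; have /andP[_ bT1] := partition_le pD bD.
have [N] := ubnP (count (fun v : R => a < v < b) Delta).
elim: N a T0a ab Hin HL => // N IH a T0a ab Hin HL; rewrite ltnS => HN.
have aT : T0 <= a < T1 by rewrite T0a (lt_le_trans ab bT1).
have [n1 n2 n3 n4] := next_node_spec pD aT.
set w := next_node Delta a in n1 n2 n3 n4.
have wb : w <= b by exact: n3.
have one : pairing Q (chart X c (sig w) - chart X c (sig a)) -
      (w - a) * (Hl X H c (chart X c x, Q) - m + e) <= phi (sig w) - phi (sig a).
  apply: (Hcell sig a w L) => //.
  - exact: le_lt_trans n4 mD.
  - exact: le_lt_trans n4 mT.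
  - by move=> s /andP[s1 s2]; apply: Hin; rewrite s1 (le_trans s2 wb).
  - by move=> s t /andP[s1 s2] /andP[t1 t2]; apply: HL; rewrite ?s1 ?t1 ?(le_trans s2 wb) ?(le_trans t2 wb).
  apply: ae_imp (solution_derive sol) => s Hs /andP[as_ sw].
  have sT : T0 <= s < T1.
    by rewrite (le_trans T0a (ltW as_)) (lt_le_trans sw (le_trans wb bT1)).
  have [_ /(_ c)] := Hs sT.
  have -> : next_node Delta s = w.
    have [k1 k2 k3 _] := next_node_spec pD sT.
    apply/le_anti/andP; split; first exact: k3.
    by apply: n3 => //; exact: lt_trans as_ k2.
  by apply; apply: (Hin s _).1; rewrite (ltW as_) (le_trans (ltW sw) wb).
have [wbE|wnb] := eqVneq w b; first by rewrite -wbE.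
have {}wb : w < b by rewrite lt_neqAle wnb.
have := IH w (le_trans T0a (ltW n2)) wb _ _ _.
have lt_count : (count (fun v : R => (w < v < b)%R) Delta < N)%N.
  apply: leq_trans HN; apply: (count_lt _ n1) => /=.
  - by move=> v /andP[h ->]; rewrite (lt_trans n2 h).
  - by rewrite n2 wb.
  - by rewrite ltxx.
move=> two'; have two : pairing Q (chart X c (sig b) - chart X c (sig w)) -
      (b - w) * (Hl X H c (chart X c x, Q) - m + e) <= phi (sig b) - phi (sig w).
  apply: two' lt_count.
  - by move=> s /andP[s1 s2]; apply: Hin; rewrite s2 (le_trans (ltW n2) s1).
  - by move=> s t /andP[s1 s2] /andP[t1 t2]; apply: HL; rewrite ?s2 ?t2 ?(le_trans (ltW n2) s1) ?(le_trans (ltW n2) t1).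
have -> : chart X c (sig b) - chart X c (sig a) =
   (chart X c (sig b) - chart X c (sig w)) + (chart X c (sig w) - chart X c (sig a)).
  by rewrite addrA subrK.
rewrite pairingDr; move: one two; move: (Hl _ _ _ _ - m + e) (pairing Q _) (pairing Q _) => Z P1 P2.
by rewrite !mulrBl => h1 h2; lra.
Qed.

Section Limit.
Variables (Delta_ : nat -> seq R) (gamma_ : nat -> R -> M) (gamma : R -> M).
Hypothesis T01 : T0 < T1.
Hypothesis gamma_sol : forall k, itv_partition T0 T1 (Delta_ k) /\
  ae_solution g T0 T1 (field (Delta_ k)) (gamma_ k).
Hypothesis approx : forall e : R, 0 < e -> exists k, mesh T0 (Delta_ k) < e /\
  forall t, T0 <= t <= T1 -> dist g (gamma_ k t) (gamma t) < e.

Lemma approx_solution (e : R) : 0 < e -> exists k, [/\ solution (Delta_ k) (gamma_ k),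
  mesh T0 (Delta_ k) < e & forall t, T0 <= t <= T1 -> dist g (gamma_ k t) (gamma t) < e].
Proof.
move=> e0; have [|k [m1 h1]] := @approx (Num.min e tau); first by rewrite lt_min e0 tau_gt0.
move: m1; rewrite lt_min => /andP[m1 m2]; exists k; split=> //.
  by have [h2 h3] := gamma_sol k; split.
by move=> t /h1; rewrite lt_min => /andP[].
Qed.

(** Closeness in [dist] becomes closeness of coordinates with the factor [C], which brings both
    curves into the chart; the limit then inherits the Lipschitz constant [K] of the approximating
    curves. *)
Lemma track c x : dom X c x -> exists rho K C : R, [/\ 0 < rho, 0 < K, 0 < C,
  (forall k s t (z : R), solution (Delta_ k) (gamma_ k) ->
    (forall t, T0 <= t <= T1 -> dist g (gamma_ k t) (gamma t) < z) -> z < rho -> C * z < rho ->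
    T0 <= s -> s <= t -> t <= T1 -> dom X c (gamma s) ->
    `|chart X c (gamma s) - chart X c x| <= rho -> K * (t - s) < rho ->
    (forall a, s <= a <= t -> [/\ dom X c (gamma_ k a), dom X c (gamma a) &
        `|chart X c (gamma_ k a) - chart X c (gamma a)| <= C * z]) /\
    (forall a b, s <= a -> a <= b -> b <= t ->
        `|chart X c (gamma_ k b) - chart X c (gamma_ k a)| <= K * (b - a))) &
  (forall s t, T0 <= s -> s <= t -> t <= T1 -> dom X c (gamma s) ->
    `|chart X c (gamma s) - chart X c x| <= rho -> K * (t - s) < rho ->
    dom X c (gamma t) /\ `|chart X c (gamma t) - chart X c (gamma s)| <= K * (t - s))].
Proof.
move=> d; have [rho0 [K [rho00 K0 Hst]]] := solution_stays d.
have [r3 [C [r30 C0 _ H3]]] := dist_chart g M_hausdorff M_connected d.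
have [rho [rh0 rr rr1]] : exists rho, [/\ 0 < rho, 4 * rho <= rho0 & 4 * rho <= r3].
  exists (Num.min rho0 r3 / 4); split; first by rewrite divr_gt0// lt_min rho00.
    by rewrite mulrC divfK// ge_min lexx.
  by rewrite mulrC divfK// ge_min lexx orbT.
have first_part k s t (z : R) : solution (Delta_ k) (gamma_ k) ->
    (forall t, T0 <= t <= T1 -> dist g (gamma_ k t) (gamma t) < z) -> z < rho -> C * z < rho ->
    T0 <= s -> s <= t -> t <= T1 -> dom X c (gamma s) ->
    `|chart X c (gamma s) - chart X c x| <= rho -> K * (t - s) < rho ->
    (forall a, s <= a <= t -> [/\ dom X c (gamma_ k a), dom X c (gamma a) &
        `|chart X c (gamma_ k a) - chart X c (gamma a)| <= C * z]) /\
    (forall a b, s <= a -> a <= b -> b <= t ->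
        `|chart X c (gamma_ k b) - chart X c (gamma_ k a)| <= K * (b - a)).
  move=> sol hz zrho Cz T0s st tT1 ds hs Kst.
  have sT : T0 <= s <= T1 by rewrite T0s (le_trans st).
  have [||dks hks] := H3 (gamma s) (gamma_ k s) z ds _ (or_intror (ltW (hz s sT))).
  - by lra.
  - by lra.
  have hks0 : `|chart X c (gamma_ k s) - chart X c x| <= 2 * rho.
    rewrite -[chart X c (gamma_ k s)](subrK (chart X c (gamma s))) -addrA.
    by apply: le_trans (ler_normD _ _) _; lra.
  have Ka a : s <= a -> a <= t -> K * (a - s) < rho.
    by move=> sa at_; apply: le_lt_trans Kst; rewrite ler_wpM2l ?(ltW K0)//; lra.
  have hka a : s <= a -> a <= t -> dom X c (gamma_ k a) /\
      `|chart X c (gamma_ k a) - chart X c x| <= 3 * rho.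
    move=> sa at_; have [|||da ha] := Hst (Delta_ k) (gamma_ k) s a sol T0s sa _ dks.
    - exact: le_trans at_ tT1.
    - by lra.
    - by have := Ka a sa at_; lra.
    split=> //; rewrite -[chart X c (gamma_ k a)](subrK (chart X c (gamma_ k s))) -addrA.
    by apply: le_trans (ler_normD _ _) _; have := Ka a sa at_; lra.
  split=> [a /andP[sa at_]|a b sa ab bt].
    have [dka hka0] := hka a sa at_.
    have aT : T0 <= a <= T1 by rewrite (le_trans T0s sa) (le_trans at_ tT1).
    have [||da ha] := H3 (gamma_ k a) (gamma a) z dka _ (or_introl (ltW (hz a aT))).
    - by lra.
    - by lra.
    by split=> //; rewrite distrC.
  have [dka hka0] := hka a sa (le_trans ab bt).
  have [||] // := Hst (Delta_ k) (gamma_ k) a b sol (le_trans T0s sa) ab (le_trans bt tT1) dka.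
    by lra.
  by have := Ka b (le_trans sa ab) bt; have : K * (b - a) <= K * (b - s); [rewrite ler_wpM2l ?(ltW K0)//; lra|lra].
exists rho, K, C; split=> // s t T0s st tT1 ds hs Kst.
have sst : s <= s <= t by rewrite lexx.
have tst : s <= t <= t by rewrite lexx st.
have key (e : R) : 0 < e -> dom X c (gamma t) /\
    `|chart X c (gamma t) - chart X c (gamma s)| <= K * (t - s) + e.
  move=> e0; pose z := Num.min (rho / 2) (Num.min (rho / 2 / C) (e / 2 / C)).
  have z0 : 0 < z by rewrite /z !lt_min !divr_gt0.
  have [z1 z2 z3] : [/\ z <= rho / 2, C * z <= rho / 2 & C * z <= e / 2].
    by split; rewrite ?[C * _]mulrC -?ler_pdivlMr// /z !ge_min !lexx ?orbT.
  have [k [sol _ hk]] := approx_solution z0.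
  have hr := half_lt rh0.
  have [h1 h2] := first_part k s t z sol hk (le_lt_trans z1 hr) (le_lt_trans z2 hr) T0s st tT1 ds hs Kst.
  have [_ _ e1] := h1 s sst; have [_ dt e2] := h1 t tst; split=> //.
  have e3 := h2 s t (lexx _) st (lexx _).
  have -> : chart X c (gamma t) - chart X c (gamma s) =
      - (chart X c (gamma_ k t) - chart X c (gamma t)) +
      (chart X c (gamma_ k t) - chart X c (gamma_ k s)) +
      (chart X c (gamma_ k s) - chart X c (gamma s)).
    by apply/rowP => i; rewrite !mxE; ring.
  apply: le_trans (ler_normD _ _) _; apply: le_trans (lerD (ler_normD _ _) (lexx _)) _.
  rewrite normrN; lra.
split; first exact: (key 1 ltr01).1.
by apply/ler_addgt0Pr => e /key[].
Qed.

(** With [h] fixed, the energy inequality for the approximating curves passes to the limit curve on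
    [[t, t + h]]; [displacement] then gives the estimate, and [h] tends to 0 only afterwards. *)
Lemma gamma_right c p t : T0 <= t < T1 -> dom X c (gamma t) -> G (gamma t, p) ->
  (forall p', G (gamma t, p') -> H (gamma t) p <= H (gamma t) p') ->
  forall eta : R, 0 < eta -> exists2 d : R, 0 < d & forall h : R, 0 < h < d ->
    `|chart X c (gamma (t + h)) - chart X c (gamma t) -
      h *: Hdp X H c (chart X c (gamma t), cc X (gamma t) c (gamma t) p)| <= eta * h.
Proof.
move=> /andP[T0t tT1] dx Gp Hmin eta eta0; set x := gamma t in dx Gp Hmin *.
have [E0 [HG HU]] := energy_bound M_compact H_tonelli Phi_flow tau_gt0 graphE U_C1.
have [r [B [K1 LD]]] := local_data_exists H_tonelli E0 dx.
have [rho [K [C [rho0 K0 C0 Htr Hlip]]]] := track dx.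
have [e1 [d1 [e10 d10 Hdisp]]] := displacement H_tonelli G_upper dx LD Gp (HG _ Gp) K0 eta0.
have [d2 d20 Hcells] := cells dx LD Hmin e10.
have [rp [Cp [rp0 Cp0 _ Hphi]]] := phi_lipschitz M_compact H_tonelli Phi_flow tau_gt0
  graphE U_C1 u_lower u_upper dx.
set q0 := chart X c x in LD Hdisp Hcells Hphi Htr Hlip *.
pose D := Num.min (Num.min rho d1) (Num.min d2 rp).
have D0 : 0 < D by rewrite /D !lt_min rho0 d10 d20 rp0.
have [Dr Dd1 Dd2 Drp] : [/\ D <= rho, D <= d1, D <= d2 & D <= rp].
  by rewrite /D !ge_min !lexx !orbT.
exists (Num.min (T1 - t) (D / 4 / K)); first by rewrite lt_min subr_gt0 tT1 !divr_gt0.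
move=> h /andP[h0]; rewrite lt_min => /andP[h1 h2].
have Kh : K * h < D / 4 by rewrite mulrC -ltr_pdivlMr.
have xq : `|chart X c (gamma t) - q0| <= rho by rewrite subrr normr0 ltW.
have th : t <= t + h by rewrite lerDl ltW.
have thT : t + h < T1 by rewrite -ltrBrDl.
have [D8 D4 D2] := fraction_lt D0.
have hh : t + h - t = h by rewrite addrC addKr.
have [|dh lh] := Hlip t (t + h) T0t th (ltW thT) dx xq; first by rewrite hh (lt_trans Kh)// (lt_le_trans D4 Dr).
rewrite hh in lh.
apply: (Hdisp h (gamma (t + h))) => //; first exact: le_lt_trans lh (lt_trans Kh (lt_le_trans D4 Dd1)).
move=> Q QB; set Z := Hl X H c (q0, Q) - H x p + e1.
(* The sum of the errors below, each proportional to the accuracy [z] of the approximation. *)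
pose CC := n%:R * `|Q| * (K + 2 * C) + `|Z| + Cp * (K + 2 * C) + 1.
have KC : 0 < K + 2 * C by rewrite addr_gt0// mulr_gt0.
have CC0 : 0 < CC by rewrite ltr_wpDl// !addr_ge0// mulr_ge0// ?mulr_ge0// ltW.
apply/ler_addgt0Pr => e e0.
pose z := Num.min (Num.min (D / 8) (D / 8 / C)) (Num.min (D / 8 / K) (e / CC)).
have z0 : 0 < z by rewrite /z !lt_min !divr_gt0.
have [z1 z2 z3 z4] : [/\ z <= D / 8, C * z <= D / 8, K * z <= D / 8 & CC * z <= e].
  by split; rewrite ?[_ * z]mulrC -?ler_pdivlMr// /z !ge_min !lexx ?orbT.
have zd2 : Num.min z d2 <= z by rewrite ge_min lexx.
have [k [sol mk hk0]] := approx_solution (e := Num.min z d2) ltac:(by rewrite lt_min z0).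
have hk s : T0 <= s <= T1 -> dist g (gamma_ k s) (gamma s) < z.
  by move=> /hk0/lt_le_trans; apply.
have [mz md2] : mesh T0 (Delta_ k) < z /\ mesh T0 (Delta_ k) < d2.
  by move: mk; rewrite lt_min => /andP[].
have [pD _ _] := sol.
(* As [cells] must end at a node, the approximating curve is followed up to the first node after
   [t + h], at most one mesh later. *)
have [n1 n2 _ n4] := next_node_spec pD (t := t + h) ltac:(by rewrite (le_trans T0t th)).
set b := next_node (Delta_ k) (t + h) in n1 n2 n4.
have /andP[_ bT1] := partition_le pD n1.
have tb : t < b by apply: le_lt_trans th n2.
have bth : b - (t + h) <= z by apply: le_trans n4 (ltW mz).
have Kb : K * (b - t) < D / 2.
  have : K * (b - (t + h)) <= K * z by rewrite ler_wpM2l ?(ltW K0).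
  have -> : K * (b - t) = K * (b - (t + h)) + K * h by ring.
  by move=> h3; exact: sum_lt_half D0 (le_trans h3 z3) Kh.
have zrho : z < rho := le_lt_trans z1 (lt_le_trans D8 Dr).
have Czrho : C * z < rho := le_lt_trans z2 (lt_le_trans D8 Dr).
have Kbrho : K * (b - t) < rho := lt_trans Kb (lt_le_trans D2 Dr).
have [g1 g2] := Htr k t b z sol hk zrho Czrho T0t (ltW tb) bT1 dx xq Kbrho.
have tt : t <= t <= b by rewrite lexx ltW.
have bb : t <= b <= b by rewrite lexx ltW.
have tth : t <= t + h <= b by rewrite th ltW.
have [dkt _ kt] := g1 t tt; have [dkb db kb] := g1 b bb; have [dkh _ kh] := g1 (t + h) tth.
rewrite -/q0 -/x in kt.
have bh := g2 (t + h) b th (ltW n2) (lexx _).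
have {}bh : `|chart X c (gamma_ k b) - chart X c (gamma_ k (t + h))| <= K * z.
  by apply: le_trans bh _; rewrite ler_wpM2l ?(ltW K0).
have inq s : t <= s <= b -> `|chart X c (gamma_ k s) - q0| < D.
  move=> /andP[ts sb]; have hs := g2 t s (lexx _) ts sb.
  have : K * (s - t) <= K * (b - t) by rewrite ler_wpM2l ?(ltW K0)// lerD2r.
  rewrite -[chart X c (gamma_ k s)](subrK (chart X c (gamma_ k t))) -addrA => hs'.
  by apply: le_lt_trans (ler_normD _ _) _; exact: sum_lt_full D0 (le_trans hs hs') Kb (le_trans kt z2).
have main := Hcells (Delta_ k) (gamma_ k) t b K sol md2 T0t tb n1 (ltW K0) _ _ Q QB.
have {}main : pairing Q (chart X c (gamma_ k b) - chart X c (gamma_ k t)) - (b - t) * Z <=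
    phi (gamma_ k b) - phi (gamma_ k t).
  apply: main.
    move=> s sb; have [ds _ _] := g1 s sb; split=> //; exact: lt_le_trans (inq s sb) Dd2.
  move=> s s' /andP[s0 s1] /andP[t0 t1]; have [ss|ss] := leP s s'.
    by rewrite [`|s' - s|]ger0_norm ?subr_ge0//; exact: g2.
  rewrite distrC [`|s' - s|]distrC [`|s - s'|]gtr0_norm ?subr_gt0//.
  by apply: g2 => //; exact: ltW.
have f1 : `|phi (gamma_ k b) - phi (gamma (t + h))| <= Cp * (K * z + C * z).
  apply: le_trans (Hphi _ _ dkb dh _ _) _.
  - by apply: le_trans (ltW (inq b bb)) Drp.
  - exact: le_trans lh (ltW (lt_le_trans (lt_trans Kh D4) Drp)).
  rewrite ler_wpM2l// -[chart X c (gamma_ k b)](subrK (chart X c (gamma_ k (t + h)))) -addrA.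
  by apply: le_trans (ler_normD _ _) _; exact: lerD.
have f2 : `|phi (gamma_ k t) - phi x| <= Cp * (C * z).
  apply: le_trans (Hphi _ _ dkt dx _ _) _.
  - by apply: le_trans (ltW (inq t tt)) Drp.
  - by rewrite subrr normr0 ltW.
  by rewrite ler_wpM2l.
have f3 : `|pairing Q (chart X c (gamma_ k b) - chart X c (gamma_ k t)) -
    pairing Q (chart X c (gamma (t + h)) - q0)| <= n%:R * `|Q| * (K * z + C * z + C * z).
  rewrite -pairingBr; apply: le_trans (pairing_norm _ _) _; rewrite ler_wpM2l ?mulr_ge0//.
  have -> : chart X c (gamma_ k b) - chart X c (gamma_ k t) - (chart X c (gamma (t + h)) - q0) =
    (chart X c (gamma_ k b) - chart X c (gamma_ k (t + h))) +
    (chart X c (gamma_ k (t + h)) - chart X c (gamma (t + h))) - (chart X c (gamma_ k t) - q0).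
    by apply/rowP => i; rewrite !mxE; ring.
  apply: le_trans (ler_normB _ _) _; apply: lerD => //.
  by apply: le_trans (ler_normD _ _) _; exact: lerD.
have f4 : (b - t) * Z <= h * Z + z * `|Z|.
  have -> : (b - t) * Z = h * Z + (b - (t + h)) * Z by ring.
  rewrite lerD2l; apply: (@le_trans _ _ ((b - (t + h)) * `|Z|)).
    by rewrite ler_wpM2l ?ler_norm// subr_ge0 ltW.
  by rewrite ler_wpM2r.
have total : n%:R * `|Q| * (K * z + C * z + C * z) + z * `|Z| +
    Cp * (K * z + C * z) + Cp * (C * z) <= e.
  apply: le_trans z4; rewrite [leRHS](_ : _ = n%:R * `|Q| * (K * z + C * z + C * z) + z * `|Z| +
    Cp * (K * z + C * z) + Cp * (C * z) + z); first by rewrite lerDl ltW.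
  by rewrite /CC; ring.
move: main f1 f2 f3 f4 total.
rewrite !ler_norml => m0 /andP[_ k1] /andP[k2 _] /andP[k3 _] k4 k5.
exact: limit_arith m0 k1 k2 k3 k4 k5.
Qed.

End Limit.
End Solutions.

(** * Regularity and velocity of the limit curve *)

Section AlmostEverywhere.
Variable R : realType.
Local Notation mu := (@lebesgue_measure R).

Lemma ae_countable (I : countType) (P : I -> R -> Prop) :
  (forall i, {ae mu, forall t, P i t}) -> {ae mu, forall t, forall i, P i t}.
Proof.
move=> HP.
pose F (k : nat) := if unpickle k is Some i then ~` [set t | P i t] else set0.
have : mu.-negligible (\bigcup_k F k).
  apply: negligible_bigcup => k; rewrite /F; case: (unpickle k) => [i|]; first exact: HP.
  exact: negligible_set0.
apply: negligibleS => t /= nP; apply: contrapT => nF; apply: nP => i.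
apply: contrapT => nPi; apply: nF; exists (pickle i) => //.
by rewrite /F pickleK.
Qed.

Lemma rational_between (a b : R) : a < b -> exists q : rat, a < ratr q < b.
Proof. by move=> ab; have [q] := rat_in_itvoo ab; rewrite in_itv/=; exists q. Qed.

End AlmostEverywhere.

Section LimitCurve.
Variables (R : realType) (n : nat) (M : topologicalType).
Variables (X : smooth_structure R n M) (g : riemannian_metric X).
Hypotheses (M_hausdorff : hausdorff_space M) (M_compact : compact [set: M]).
Hypothesis M_connected : connected [set: M].
Local Notation E := 'rV[R]_n.
Local Notation mu := (@lebesgue_measure R).
Variable H : M -> E -> R.
Hypothesis H_tonelli : tonelli g H.
Variable Phi : R -> M * E -> M * E.
Hypothesis Phi_flow : hamiltonian_flow X H Phi.
Variables (u : R -> M -> R) (G : set (M * E)) (tau : R).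
Hypothesis tau_gt0 : 0 < tau.
Hypothesis graphE : forall t, 0 < t < tau ->
  [set (x, DM X (u t) x) | x in [set: M]] = Phi (- t) @` G.
Hypothesis U_C1 : forall c, Ck 1 (`]0, tau[ `*` (chart X c @` dom X c)) (U X u c).
Hypothesis u_t : forall t x, 0 < t < tau ->
  derive1 (fun s => u s x) t = H x (DM X (u t) x).
Variable phi : M -> R.
Hypothesis u_lower : forall x (e : R), 0 < e -> exists2 d : R, 0 < d &
  forall s : R, 0 < s < d -> s < tau -> phi x - e <= u s x.
Hypothesis u_upper : forall c y, dom X c y -> forall e : R, 0 < e -> exists2 d : R, 0 < d &
  forall (s : R) x, 0 < s < d -> s < tau -> dom X c x -> `|chart X c x - chart X c y| < d ->
  u s x <= phi y + e.
Hypothesis G_upper : forall c x p, dom X c x -> G (x, p) ->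
  forall e : R, 0 < e -> exists2 d : R, 0 < d & forall z, dom X c z ->
    `|chart X c z - chart X c x| < d -> phi z - phi x <=
      pairing (cc X x c x p) (chart X c z - chart X c x) + e * `|chart X c z - chart X c x|.
Variables (T0 T1 : R).
Variables (Delta_ : nat -> seq R) (gamma_ : nat -> R -> M) (gamma : R -> M).
Hypothesis gamma_sol : forall k, itv_partition T0 T1 (Delta_ k) /\
  ae_solution g T0 T1 (field X H u (Delta_ k)) (gamma_ k).
Hypothesis approx : forall e : R, 0 < e -> exists k, mesh T0 (Delta_ k) < e /\
  forall t, T0 <= t <= T1 -> dist g (gamma_ k t) (gamma t) < e.
Variable psh : M -> E.
Hypothesis psh_G : forall x, G (x, psh x).
Hypothesis psh_min : forall x p, G (x, p) -> H x (psh x) <= H x p.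
Implicit Types (c x y : M) (s t : R).

(** Three moves in the chart, from the limit curve to an approximating one, along it, and back. Each
    changes the coordinates by at most [C * D], and [4 * (C * D) <= e] makes the total strictly
    smaller than [e]. *)
Lemma limit_continuous c t0 : T0 <= t0 <= T1 -> dom X c (gamma t0) ->
  forall e : R, 0 < e -> exists2 d : R, 0 < d & forall s, T0 <= s <= T1 -> `|s - t0| < d ->
    dom X c (gamma s) /\ `|chart X c (gamma s) - chart X c (gamma t0)| < e.
Proof.
move=> t0T d0 e e0; have [r3 [C [r30 C0 _ H3]]] := dist_chart g M_hausdorff M_connected d0.
set q0 := chart X c (gamma t0) in H3 *.
have [D [D0 D1 D2 D3]] : exists D, [/\ 0 < D, D < r3, 4 * (C * D) <= r3 & 4 * (C * D) <= e].
  exists (Num.min (r3 / 2) (Num.min (r3 / 4 / C) (e / 4 / C))).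
  set D := Num.min _ _.
  have [h1 h2 h3] : [/\ D <= r3 / 2, C * D <= r3 / 4 & C * D <= e / 4].
    by split; rewrite ?[C * _]mulrC -?ler_pdivlMr// /D !ge_min !lexx ?orbT.
  by split; try lra; rewrite /D !lt_min !divr_gt0.
have CD : 0 < C * D by rewrite mulr_gt0.
have [k [_ hk]] := approx D0; have [_ [ack _]] := gamma_sol k.
have [d dpos Hd] := ack D D0; exists d => // s sT st.
have q00 : `|chart X c (gamma t0) - q0| < r3 by rewrite subrr normr0.
have [d1 h1] := H3 (gamma t0) (gamma_ k t0) D d0 q00 (or_intror (ltW (hk t0 t0T))) D1.
have pair a b : T0 <= a -> a <= b -> b <= T1 -> `|b - a| < d -> dist g (gamma_ k a) (gamma_ k b) < D.
  move=> h2 h3 h4 h5; have := Hd 1%N (fun=> a) (fun=> b).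
  rewrite !big_ord1; apply => //; first by move=> i j; rewrite (ord1 i) (ord1 j).
  by move: h5; rewrite ger0_norm// subr_ge0.
have or_dist : dist g (gamma_ k t0) (gamma_ k s) <= D \/ dist g (gamma_ k s) (gamma_ k t0) <= D.
  have /andP[a1 a2] := t0T; have /andP[b1 b2] := sT.
  have [h|h] := leP t0 s; [left; apply/ltW/pair => //|right; apply/ltW/pair => //].
    exact: ltW.
  by rewrite distrC.
have h1' : `|chart X c (gamma_ k t0) - q0| < r3 by apply: le_lt_trans h1 _; lra.
have [d2 h2] := H3 _ _ D d1 h1' or_dist D1.
have h2' : `|chart X c (gamma_ k s) - q0| <= C * D + C * D.
  rewrite -[chart X c (gamma_ k s)](subrK (chart X c (gamma_ k t0))) -addrA.
  by apply: le_trans (ler_normD _ _) _; exact: lerD.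
have h2'' : `|chart X c (gamma_ k s) - q0| < r3 by apply: le_lt_trans h2' _; lra.
have [d3 h3] := H3 _ _ D d2 h2'' (or_introl (ltW (hk s sT))) D1.
split=> //; rewrite -[chart X c (gamma s)](subrK (chart X c (gamma_ k s))) -addrA.
by apply: le_lt_trans (ler_normD _ _) _; lra.
Qed.

Lemma limit_local_lipschitz c t0 : T0 <= t0 <= T1 -> dom X c (gamma t0) ->
  exists r K : R, [/\ 0 < r, 0 < K & forall s t, T0 <= s -> s <= t -> t <= T1 ->
    `|s - t0| < r -> `|t - t0| < r -> [/\ dom X c (gamma s),
      `|chart X c (gamma t) - chart X c (gamma s)| <= K * (t - s) &
      dist g (gamma s) (gamma t) <= K * (t - s)]].
Proof.
move=> t0T d0.
have [rho [K [_ [rho0 K0 _ _ Hlip]]]] := track M_hausdorff M_compact M_connected H_tonelli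
  Phi_flow tau_gt0 graphE U_C1 gamma_sol approx d0.
have [r2 [C [r20 C0 _ H2]]] := dist_upper g d0.
have [|d dpos Hd] := limit_continuous t0T d0 (e := Num.min rho r2); first by rewrite lt_min rho0.
exists (Num.min d (rho / 4 / K)), (K + C * K); split.
- by rewrite lt_min dpos !divr_gt0.
- by rewrite addr_gt0// mulr_gt0.
move=> s t T0s st tT1; rewrite !lt_min => /andP[s1 s2] /andP[t1 t2].
have [ds] := Hd s ltac:(by rewrite T0s (le_trans st)) s1; rewrite lt_min => /andP[hs1 hs2].
have [dt] := Hd t ltac:(by rewrite tT1 (le_trans T0s)) t1; rewrite lt_min => /andP[ht1 ht2].
have Kst : K * (t - s) < rho.
  have ts : t - s < rho / 2 / K.
    have : `|t - s| < rho / 4 / K + rho / 4 / K.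
      rewrite -[t - s](_ : (t - t0) - (s - t0) = _); last by ring.
      by apply: le_lt_trans (ler_normB _ _) _; exact: ltrD.
    rewrite ger0_norm ?subr_ge0// -mulrDl => h; apply: lt_le_trans h _.
    by rewrite ler_pM2r ?invr_gt0//; lra.
  by rewrite mulrC -ltr_pdivlMr//; apply: lt_le_trans ts _; rewrite ler_pM2r ?invr_gt0//; lra.
have ts0 : 0 <= t - s by rewrite subr_ge0.
have [_ h] := Hlip s t T0s st tT1 ds (ltW hs1) Kst.
split=> //.
  by apply: le_trans h _; rewrite mulrDl lerDl mulr_ge0// mulr_ge0// ltW.
have [_ hd] := H2 _ _ ds dt hs2 ht2; apply: le_trans hd _.
rewrite mulrDl; apply: (@le_trans _ _ (C * (K * (t - s)))); first by rewrite ler_wpM2l// ltW.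
by rewrite mulrA lerDr mulr_ge0// ltW.
Qed.

(** Compactness of [[T0, T1]]: pairs of times violating the bound at smaller and smaller distance
    and with larger and larger constants would accumulate at one time, against the local bound
    there. *)
Lemma limit_lipschitz : exists r K : R, [/\ 0 < r, 0 < K & forall s t, T0 <= s -> s <= t -> t <= T1 ->
    t - s < r -> dist g (gamma s) (gamma t) <= K * (t - s)].
Proof.
apply: contrapT => Hn.
have /choice[F HF] : forall k : nat, exists st : R * R, [/\ T0 <= st.1, st.1 <= st.2, st.2 <= T1,
    st.2 - st.1 < k.+1%:R^-1 & k.+1%:R * (st.2 - st.1) < dist g (gamma st.1) (gamma st.2)].
  move=> k; apply: contrapT => Hk; apply: Hn; exists k.+1%:R^-1, k.+1%:R.
  split; rewrite ?invr_gt0// => s t h1 h2 h3 h4; rewrite leNgt; apply/negP => h5.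
  by apply: Hk; exists (s, t).
(* Real numbers as vectors of length 1, to which [bounded_seq_cluster] applies. *)
pose P k : 'rV[R]_1 := const_mx (F k).1.
have PB k : (0 <= k)%N -> `|P k| <= `|T0| + `|T1|.
  move=> _; apply: rv_norm_le => [|i]; first by rewrite addr_ge0.
  have [h1 h2 h3 _ _] := HF k; rewrite mxE.
  have := ler_norm T1; have := ler_norm (- T0); rewrite normrN => n1 n2.
  have := normr_ge0 T0; have := normr_ge0 T1 => n3 n4.
  by rewrite ler_norml; apply/andP; split; lra.
have [Q HQ] := bounded_seq_cluster PB.
pose t0 := Q 0 0.
have near (e : R) : 0 < e -> forall N, exists2 k, (N <= k)%N & `|(F k).1 - t0| < e.
  move=> e0 N; have [k Nk hk] := HQ e e0 N; exists k => //.
  by apply: le_lt_trans hk; have := coord_norm_le (P k - Q) 0; rewrite coordB mxE.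
have t0T : T0 <= t0 <= T1.
  apply/andP; split; apply/ler_addgt0Pr => e e0; have [k _] := near e e0 0%N;
    rewrite ltr_norml => /andP[k1 k2]; have [h1 h2 h3 _ _] := HF k; lra.
have [r [K [r0 K0 Hloc]]] := limit_local_lipschitz t0T (mem_dom X (gamma t0)).
have r20 : 0 < r / 2 by rewrite divr_gt0.
have [N1 _ HN1] := near_infty_natSinv_lt (PosNum r20).
have [N2 HN2] : exists N2 : nat, K <= N2%:R.
  by exists (Num.trunc K).+1; apply: ltW; rewrite truncnS_gt.
have [k Nk hk] := near (r / 2) r20 (maxn N1 N2).
have [h1 h2 h3 h4 h5] := HF k.
have k1 : k.+1%:R^-1 < r / 2 by apply: HN1; rewrite /= (leq_trans _ Nk)// leq_maxl.
have k2 : K <= k.+1%:R.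
  by apply: le_trans HN2 _; rewrite ler_nat (leq_trans _ (leqnSn k))// (leq_trans _ Nk)// leq_maxr.
have [||_ _] := Hloc (F k).1 (F k).2 h1 h2 h3.
- by lra.
- rewrite -[_ - t0](_ : ((F k).2 - (F k).1) + ((F k).1 - t0) = _); last by ring.
  have h6 := lt_trans h4 k1; apply: le_lt_trans (ler_normD _ _) _.
  have -> : `|(F k).2 - (F k).1| = (F k).2 - (F k).1 by rewrite ger0_norm// subr_ge0.
  clear h4 h5 k1; lra.
rewrite leNgt => /negP; apply; apply: le_lt_trans h5.
by rewrite ler_wpM2r// subr_ge0.
Qed.

Lemma limit_absolutely_continuous : absolutely_continuous g T0 T1 gamma.
Proof.
have [r [K [r0 K0 HK]]] := limit_lipschitz.
move=> e e0; exists (Num.min r (e / K)); first by rewrite lt_min r0 divr_gt0.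
move=> m v w Hvw _; rewrite lt_min => /andP[s1 s2].
have each i : w i - v i < r.
  apply: le_lt_trans s1; rewrite (bigD1 i)//= lerDl sumr_ge0// => j _.
  by have [_ h _] := Hvw j; rewrite subr_ge0.
apply: (@le_lt_trans _ _ (\sum_i K * (w i - v i))).
  by apply: ler_sum => i _; have [h1 h2 h3] := Hvw i; exact: HK.
by rewrite -mulr_sumr mulrC -ltr_pdivlMr.
Qed.

Definition chart_interval (a b : R) c :=
  [/\ T0 <= a, a < b, b <= T1 & exists K : R, forall s t, a <= s -> s <= t -> t <= b ->
    dom X c (gamma s) /\ `|chart X c (gamma t) - chart X c (gamma s)| <= K * (t - s)].

(** Each coordinate of [gamma] is Lipschitz and has the expected right derivative everywhere by
    [gamma_right], hence that derivative almost everywhere. Continuity of [gamma] at such a time is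
    recovered from its coordinates. *)
Lemma velocity_on_chart a b c : chart_interval a b c ->
  {ae mu, forall t, a < t < b -> has_velocity X gamma t (Hp H (gamma t) (psh (gamma t)))}.
Proof.
move=> [T0a ab bT1 [K HK]].
have dm t : a <= t <= b -> dom X c (gamma t).
  by move=> /andP[h1 h2]; have [] := HK t t h1 (lexx _) h2.
pose V t := Hdp X H c (chart X c (gamma t), cc X (gamma t) c (gamma t) (psh (gamma t))).
have aei (i : 'I_n) : {ae mu, forall t, a < t < b ->
    is_derive t 1 (fun s => chart X c (gamma s) 0 i) (V t 0 i)}.
  apply: (lipschitz_right_derivable_ae (K := K) (g := fun t => V t 0 i) ab).
    move=> s t /andP[s1 s2] /andP[t1 t2].
    rewrite -coordB; apply: le_trans (coord_norm_le _ i) _.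
    have [h|h] := leP s t.
      by rewrite [`|t - s|]ger0_norm ?subr_ge0//; have [] := HK s t s1 h t2.
    rewrite distrC [`|t - s|]distrC [`|s - t|]gtr0_norm ?subr_gt0//.
    by have [] := HK t s t1 (ltW h) s2.
  move=> t /andP[t1 t2] e e0.
  have tT : T0 <= t < T1 by rewrite (le_trans T0a t1) (lt_le_trans t2 bT1).
  have [d d0 Hd] := gamma_right M_hausdorff M_compact M_connected H_tonelli
    Phi_flow tau_gt0 graphE U_C1 u_t u_lower u_upper G_upper gamma_sol approx tT
    (dm t ltac:(by rewrite t1 ltW)) (psh_G (gamma t)) (psh_min (x := gamma t)) e0.
  exists d => // h hd; apply: le_trans (Hd h hd).
  have alg (A A' W : E) : (A - A' - h *: W) 0 i = A 0 i - A' 0 i - W 0 i * h.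
    by rewrite !mxE mulrC.
  by apply: le_trans (coord_norm_le _ i); rewrite alg.
apply: ae_imp (ae_countable aei) => t Ht tab.
have ta : a <= t <= b by case/andP: tab => ? ?; rewrite !ltW.
have dq : is_derive t 1 (fun s => chart X c (gamma s)) (V t).
  by apply/is_derive_coord => i; exact: Ht.
have nab : \forall s \near t, dom X c (gamma s).
  have : nbhs t [set s | a < s < b].
    have tin : t \in `]a, b[ by rewrite in_itv.
    by apply: filterS (near_in_itvoo tin) => s; rewrite in_itv.
  by apply: filterS => s /andP[h1 h2]; apply: dm; rewrite !ltW.
have cq : {for t, continuous (fun s => chart X c (gamma s))}.
  by apply: differentiable_continuous; apply/derivable1_diffP; case: dq.
have cg : {for t, continuous gamma}.
  have dt := dm t ta.
  have cp : {for chart X c (gamma t), continuous (param X c)}.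
    by apply: param_continuous; exists (gamma t).
  have := continuous_comp cq cp; rewrite /prop_for /continuous_at /= chartK//.
  apply: cvg_trans; apply: near_eq_cvg; apply: filterS nab => s ds /=.
  by rewrite chartK.
split=> //.
have := is_derive_change_chart cg (dm t ta) (mem_dom X (gamma t)) dq.
by rewrite /V (Hdp_change H_tonelli _ (dm t ta) (mem_dom X _)) (cc_loc _ (dm t ta)) -Hp_Hdp.
Qed.

(** Every time strictly between [T0] and [T1] lies in an interval with rational end points that fits
    in one chart. There are countably many of these, so their exceptional null sets have a null
    union. *)
Lemma limit_velocity :
  {ae mu, forall t, T0 <= t <= T1 -> has_velocity X gamma t (Hp H (gamma t) (psh (gamma t)))}.
Proof.
pose P (ab : rat * rat) (t : R) := (exists c, chart_interval (ratr ab.1) (ratr ab.2) c) ->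
  ratr ab.1 < t < ratr ab.2 -> has_velocity X gamma t (Hp H (gamma t) (psh (gamma t))).
have aeP : {ae mu, forall t, forall ab, P ab t}.
  apply: ae_countable => ab; rewrite /P.
  have [[c hc]|nc] := pselect (exists c, chart_interval (ratr ab.1) (ratr ab.2) c).
    by apply: ae_imp (velocity_on_chart hc) => t ht _.
  by apply: aeW => t /nc.
have ends : {ae mu, forall t, t != T0 /\ t != T1}.
  have : mu.-negligible ([set T0] `|` [set T1]).
    apply: negligibleU.
      by exists [set T0]; split => //; exact: lebesgue_measure_set1.
    by exists [set T1]; split => //; exact: lebesgue_measure_set1.
  apply: negligibleS => t /= nt; apply: contrapT => h; apply: nt.
  by split; apply/eqP => tE; apply: h; [left|right].
have both : mu.-negligible (~` [set t | forall ab, P ab t] `|` ~` [set t | t != T0 /\ t != T1]).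
  exact: negligibleU.
apply: negligibleS both => t /= nh; apply: contrapT => h; apply: nh => /andP[t0 t1].
have [Pt [tn0 tn1]] : (forall ab, P ab t) /\ (t != T0 /\ t != T1).
  by split; apply: contrapT => h'; apply: h; [left|right].
have {t0}T0t : T0 < t by rewrite lt_neqAle eq_sym tn0.
have {t1}tT1 : t < T1 by rewrite lt_neqAle tn1.
have tT : T0 <= t <= T1 by rewrite !ltW.
have [r [K [r0 K0 Hloc]]] := limit_local_lipschitz tT (mem_dom X (gamma t)).
have [a /andP[a1 a2]] : exists q : rat, Num.max T0 (t - r) < ratr q < t.
  by apply: rational_between; rewrite gt_max T0t ltrBlDr ltrDl.
have [b /andP[b1 b2]] : exists q : rat, t < ratr q < Num.min T1 (t + r).
  by apply: rational_between; rewrite lt_min tT1 ltrDl.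
move: a1; rewrite gt_max => /andP[a1 a1']; move: b2; rewrite lt_min => /andP[b2 b2'].
apply: (Pt (a, b)) => /=; last by rewrite a2.
exists (gamma t); split; rewrite ?ltW//; first exact: lt_trans a2 b1.
exists K => s s' s1 s2 s3.
have near v : ratr a <= v -> v <= ratr b -> `|v - t| < r.
  by move=> h1 h2; rewrite ltr_norml; apply/andP; split; lra.
have [||||h1 h2 _] := Hloc s s' _ s2; last by split.
- by apply: le_trans (ltW a1) s1.
- by apply: le_trans s3 (ltW b2).
- by apply: near => //; exact: le_trans s2 s3.
- by apply: near => //; exact: le_trans s1 s2.
Qed.

End LimitCurve.

Theorem mainTheorem3 (R : realType) (n : nat) (M : topologicalType)
    (X : smooth_structure R n M) (g : riemannian_metric X)
    (M_hausdorff : hausdorff_space M) (M_compact : compact [set: M])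
    (M_connected : connected [set: M])
    (H : M -> 'rV[R]_n -> R) (H_tonelli : tonelli g H)
    (Phi : R -> M * 'rV[R]_n -> M * 'rV[R]_n)
    (Phi_flow : hamiltonian_flow X H Phi)
    (phi : M -> R) (phi_SCL : SCL g phi) (T : R) (T_gt0 : 0 < T)
    (tau : R) (tau_phi : tau_spec g H Phi phi tau) :
  (forall t x, - T <= t < T ->
     forall eps : R, 0 < eps -> exists2 delta : R, 0 < delta &
       forall Delta : seq R, itv_partition (- T) T Delta ->
         mesh (- T) Delta <= tau -> mesh (- T) Delta < delta ->
         `|Wfield g H phi Delta t x - Hp H x (psharp g H phi x)| < eps) /\
  (forall (Delta : nat -> seq R) (gamma_ : nat -> R -> M) (gamma : R -> M),
     (forall k, itv_partition (- T) T (Delta k)) ->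
     (forall k, mesh (- T) (Delta k) <= tau) ->
     (forall k, ae_solution g (- T) T (Wfield g H phi (Delta k)) (gamma_ k)) ->
     mesh (- T) (Delta k) @[k --> \oo] --> (0 : R) ->
     (forall eps : R, 0 < eps -> \forall k \near \oo,
        forall t, - T <= t <= T -> dist g (gamma_ k t) (gamma t) < eps) ->
     strict_singular_characteristic g H phi (- T) T gamma).
Proof.
case: tau_phi => tau_gt0 tau_loc [tau1 [_ _ _ graph1 [U1 u_t1]] tau_tau1].
pose u t x := Tplus g H t phi x.
pose G := [set z : M * 'rV[R]_n | superdifferential g phi z.1 z.2].
have lt1 t : 0 < t < tau -> 0 < t < tau1.
  by move=> /andP[-> h]; exact: lt_le_trans h tau_tau1.
have graphE t : 0 < t < tau ->
    [set (x, DM X (u t) x) | x in [set: M]] = Phi (- t) @` G.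
  by move=> /lt1; exact: graph1.
have U_C1 c : Ck 1 (`]0, tau[ `*` (chart X c @` dom X c)) (U X u c).
  have [C1 _] := U1 c; apply: Ck_subset C1 => -[t q] [/=].
  by rewrite in_itv/= => /lt1 h Vq; split=> //=; rewrite in_itv.
have u_t t x : 0 < t < tau -> derive1 (fun s => u s x) t = H x (DM X (u t) x).
  by move=> /lt1 h; apply/eqP; rewrite -subr_eq0; apply/eqP; exact: u_t1.
have u_lower x e : 0 < e -> exists2 d : R, 0 < d &
    forall s : R, 0 < s < d -> s < tau -> phi x - e <= u s x.
  move=> /(Tplus_lower tau_loc x)[d d0 Hd]; exists d => // s sd st.
  by apply: Hd => //; exact: ltW.
have G_ne := G_nonempty M_hausdorff M_compact H_tonelli Phi_flow tau_gt0 graphE U_C1.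
have u_upper c y : dom X c y -> forall e : R, 0 < e -> exists2 d : R, 0 < d &
    forall (s : R) x, 0 < s < d -> s < tau -> dom X c x ->
    `|chart X c x - chart X c y| < d -> u s x <= phi y + e.
  move=> dy e e0.
  have [d d0 Hd] := Tplus_upper M_hausdorff M_compact M_connected H_tonelli tau_loc (G_ne y) dy e0.
  by exists d => // s x sd st; apply: Hd => //; exact: ltW.
have G_upper c x p (dx : dom X c x) (Gp : G (x, p)) :=
  superdifferential_upper (phi := phi) dx Gp.
(* [xget] returns an element of the set of minimizers once this set is known to be nonempty. *)
have psharpP x : G (x, psharp g H phi x) /\
    forall p, G (x, p) -> H x (psharp g H phi x) <= H x p.
  have [p Gp Hp] := G_minimizer M_hausdorff M_compact H_tonelli Phi_flow tau_gt0 graphE U_C1 x.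
  by apply: (@xgetPex _ 0 [set p | superdifferential g phi x p /\
    forall p', superdifferential g phi x p' -> H x p <= H x p']); exists p.
have psh_G x := (psharpP x).1; have psh_min x := (psharpP x).2.
split=> [t x tT eps eps0|Delta gamma_ gamma pD mD solD mesh0 unif].
  have eps2 : 0 < eps / 2 by rewrite divr_gt0.
  have [d d0 Hd] := W_limit M_hausdorff M_compact H_tonelli Phi_flow tau_gt0 graphE U_C1 u_t
    u_lower u_upper G_upper (psh_G x) (psh_min x) eps2.
  (* The bound by [tau] makes the time left before the next node strictly smaller than [tau], as the
     facts on [u] concern the open interval. *)
  exists (Num.min d tau); first by rewrite lt_min d0.
  move=> Delta pD _; rewrite lt_min => /andP[m1 m2].
  have [_ h1 _ h2] := next_node_spec pD tT.
  apply: (@le_lt_trans _ _ (eps / 2)); last by lra.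
  apply: Hd; first by rewrite subr_gt0 h1 (le_lt_trans h2).
  exact: le_lt_trans h2 m2.
have gamma_sol k : itv_partition (- T) T (Delta k) /\
    ae_solution g (- T) T (field X H u (Delta k)) (gamma_ k).
  exact: (conj (pD k) (solD k)).
have approx (e : R) : 0 < e -> exists k, mesh (- T) (Delta k) < e /\
    forall t, - T <= t <= T -> dist g (gamma_ k t) (gamma t) < e.
  move=> e0; have /cvgrPdist_lt/(_ _ e0)[N1 _ HN1] := mesh0.
  have [N2 _ HN2] := unif e e0.
  exists (maxn N1 N2); split; last by apply: HN2; rewrite /= leq_maxr.
  have := HN1 (maxn N1 N2); rewrite /= leq_maxl => /(_ isT).
  by rewrite sub0r normrN; apply: le_lt_trans; exact: ler_norm.
split.
  exact: (limit_absolutely_continuous M_hausdorff M_compact M_connected H_tonelli Phi_flow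
    tau_gt0 graphE U_C1 gamma_sol approx).
exact: (limit_velocity M_hausdorff M_compact M_connected H_tonelli Phi_flow tau_gt0 graphE U_C1
  u_t u_lower u_upper G_upper gamma_sol approx psh_G psh_min).
Qed.
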